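(* Let $\mathcal{I}$ be a system of dyadic arcs in $\mathbb{T}$. There exist two bilinear operators $S_{\mathcal{I}}$ and $T_{\mathcal{I}}$ on the product space $H^1_{\mathcal{I}}(\mathbb{T})\times BMO^+_{\mathcal{I}}(\mathbb{T})$ such that $$f\cdot b=S_{\mathcal{I}}(f,b)+T_{\mathcal{I}}(f,b)\quad\text{in }\mathcal{D}'$$ for all $f\in H^1_{\mathcal{I}}(\mathbb{T})$ and $b\in BMO^+_{\mathcal{I}}(\mathbb{T})$, with $S_{\mathcal{I}}:H^1_{\mathcal{I}}(\mathbb{T})\times BMO^+_{\mathcal{I}}(\mathbb{T})\to L^1(\mathbb{T})$ and $T_{\mathcal{I}}:H^1_{\mathcal{I}}(\mathbb{T})\times BMO^+_{\mathcal{I}}(\mathbb{T})\to H^{\log}_{\mathcal{I}}(\mathbb{T})$ bounded.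
   Context: $\mathbb{T}=\mathbb{R}/2\pi\mathbb{Z}$ with Lebesgue measure $d\theta$; $|A|$ is the Lebesgue measure of $A$; $\mathcal{D}'$ is the space of distributions on $\mathbb{T}$. $\Psi_0(t):=t\,[\log(e+t)]^{-1}$, $t\ge0$. A system of dyadic arcs $\mathcal{I}$ is a family of the form $\mathcal{I}^{\delta}=\{[2\pi(2^{-k}m+\delta),2\pi(2^{-k}(m+1)+\delta)):k\in\mathbb{N}_0,\ m=0,\dots,2^k-1\}$ (mod $2\pi$) for some $\delta\in[0,1)$. For $I\in\mathcal{I}$, $h_I:=|I|^{-1/2}(\chi_{I_-}-\chi_{I_+})$, with $I_-,I_+$ the left and right halves of $I$. For a collection of complex numbers $\mathbf{f}=\{f_I\}_{I\in\mathcal{I}}\cup\{f_0\}$ put $f_N:=f_0+\sum_{I\in\mathcal{I},|I|\ge2^{-N}}f_Ih_I$ and $S_{\mathcal{I}}[\mathbf{f}]:=|f_0|+\big(\sum_{I\in\mathcal{I}}|f_I|^2\chi_I/|I|\big)^{1/2}$. For $f\in L^1(\mathbb{T})$ put $S_{\mathcal{I}}[f]:=S_{\mathcal{I}}[\mathbf{f}]$ with $f_I=\langle f,h_I\rangle=\int_{\mathbb{T}}fh_I\,d\theta$ and $f_0=\widehat f(0)=(2\pi)^{-1}\int_{\mathbb{T}}f\,d\theta$. (The square function $S_{\mathcal{I}}[\cdot]$ is not to be confused with the bilinear operator $S_{\mathcal{I}}(\cdot,\cdot)$.) $H^1_{\mathcal{I}}(\mathbb{T})$ is the space of $f\in L^1(\mathbb{T})$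 with $\|f\|_{H^1_{\mathcal{I}}(\mathbb{T})}:=\|S_{\mathcal{I}}[f]\|_{L^1(\mathbb{T})}<\infty$. $BMO^+_{\mathcal{I}}(\mathbb{T})$ is the space of $b\in L^1(\mathbb{T})$ with $\|b\|_{BMO^+_{\mathcal{I}}(\mathbb{T})}:=\big(\sup_{I\in\mathcal{I}}\frac1{|I|}\int_I|b-\langle b\rangle_I|^2d\theta\big)^{1/2}+\big|\int_{\mathbb{T}}b\,d\theta\big|<\infty$, where $\langle b\rangle_I:=|I|^{-1}\int_Ib\,d\theta$. $h^{\log}_{\mathcal{I}}(\mathbb{T})$ is the class of all collections $\mathbf{f}$ with $\int_{\mathbb{T}}\Psi_0(S_{\mathcal{I}}[\mathbf{f}])\,d\theta<\infty$, with quasi-norm $\|\mathbf{f}\|_{h^{\log}_{\mathcal{I}}(\mathbb{T})}:=\inf\{\lambda>0:(2\pi)^{-1}\int_{\mathbb{T}}\Psi_0(\lambda^{-1}S_{\mathcal{I}}[\mathbf{f}])\,d\theta\le1\}$. For each such $\mathbf{f}$ the sequence $(f_N)_N$ converges in $\mathcal{D}'$ to some $\iota(\mathbf{f})$; $H^{\log}_{\mathcal{I}}(\mathbb{T}):=\iota[h^{\log}_{\mathcal{I}}(\mathbb{T})]$ with $\|f\|_{H^{\log}_{\mathcal{I}}(\mathbb{T})}:=\|\mathbf{f}\|_{h^{\log}_{\mathcal{I}}(\mathbb{T})}$ for $f=\iota(\mathbf{f})$. The product $f\cdot b\in\mathcal{D}'$ is the product in the sense of distributions: $\langle f\cdot b,\varphi\rangle:=\langle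 f,\varphi b\rangle$ for $\varphi\in C^\infty(\mathbb{T})$, where the right-hand side is the $H^1_{\mathcal{I}}$–$BMO_{\mathcal{I}}$ duality pairing (i.e. the continuous extension to $H^1_{\mathcal{I}}(\mathbb{T})$ of $f\mapsto\int_{\mathbb{T}}f\varphi b\,d\theta$ from functions $f$ with finite Haar expansion). *)

(* Defs.v *)
From mathcomp Require Import all_boot all_order all_algebra.
From mathcomp Require Import complex.
From mathcomp Require Import all_classical all_reals all_analysis.

Set Implicit Arguments.
Unset Strict Implicit.
Unset Printing Implicit Defensive.

Import Order.TTheory GRing.Theory Num.Theory.
Import numFieldNormedType.Exports.
Import Normc.

Local Open Scope classical_set_scope.
Local Open Scope ring_scope.

(* The circle R/2piZ is represented by its fundamental domain [0, 2pi[: a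
   complex function on the circle is a function R -> R[i] of which only the
   values on [0, 2pi[ matter, and elements of L^1 are such functions considered
   up to almost everywhere equality. Test functions are 2pi-periodic on R. *)
Definition circle {R : realType} : set R := `[0, 2 * pi[.

Definition cint {R : realType} (A : set R) (f : R -> R[i]) : R[i] :=
  Complex (Rintegral (@lebesgue_measure R) A (fun x => complex.Re (f x)))
          (Rintegral (@lebesgue_measure R) A (fun x => complex.Im (f x))).

Definition inL1 {R : realType} (f : R -> R[i]) : Prop :=
  (@lebesgue_measure R).-integrable circle (fun x => (complex.Re (f x))%:E)
  /\
  (@lebesgue_measure R).-integrable circle (fun x => (complex.Im (f x))%:E).

Definition L1norm {R : realType} (f : R -> R[i]) : \bar R :=
  \int[@lebesgue_measure R]_(x in circle) (normc (f x))%:E.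

Definition ae_circle {R : realType} (f g : R -> R[i]) : Prop :=
  {ae @lebesgue_measure R, forall x, circle x -> f x = g x}.

(* Index (k, m) with m < 2^k, standing for the m-th arc of generation k. *)
Definition dyadic : Type := {k : nat & 'I_(2 ^ k)}.

(* [2pi(2^-k m + delta), 2pi(2^-k (m+1) + delta)[ reduced mod 2pi. *)
Definition dyadic_arc {R : realType} (delta : R) (k m : nat) : set R :=
  [set x | circle x /\ exists j : int,
     2 * pi * (m%:R / 2 ^+ k + delta) <= x + 2 * pi * j%:~R
       < 2 * pi * (m.+1%:R / 2 ^+ k + delta)].

Definition haar_arc {R : realType} (delta : R) (I : dyadic) : set R :=
  dyadic_arc delta (tag I) (tagged I).

Definition arc_left {R : realType} (delta : R) (I : dyadic) : set R :=
  dyadic_arc delta (tag I).+1 (2 * tagged I)%N.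

Definition arc_right {R : realType} (delta : R) (I : dyadic) : set R :=
  dyadic_arc delta (tag I).+1 ((2 * tagged I).+1)%N.

Definition arc_len {R : realType} (delta : R) (I : dyadic) : R :=
  fine (@lebesgue_measure R (haar_arc delta I)).

Definition haar {R : realType} (delta : R) (I : dyadic) (x : R) : R :=
  (Num.sqrt (arc_len delta I))^-1 *
  (\1_(arc_left delta I) x - \1_(arc_right delta I) x).

Record collection (R : realType) := Collection {
  mean_coef : R[i];
  haar_coef : dyadic -> R[i] }.

Definition coefs_of {R : realType} (delta : R) (f : R -> R[i]) :
    collection R :=
  Collection (((2 * pi)^-1)%:C%C * cint circle f)
             (fun I => cint circle (fun x => f x * (haar delta I x)%:C%C)).

Definition haar_partial {R : realType} (delta : R) (ff : collection R)
    (N : nat) (x : R) : R[i] :=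
  mean_coef ff +
  \sum_(I \in [set I | 2 ^- N <= arc_len delta I])
     haar_coef ff I * (haar delta I x)%:C%C.

Definition square_fun {R : realType} (delta : R) (ff : collection R) (x : R) :
    \bar R :=
  ((normc (mean_coef ff))%:E +
   sqrte (\esum_(I in [set: dyadic])
     (normc (haar_coef ff I) ^+ 2 * \1_(haar_arc delta I) x / arc_len delta I)%:E))%E.

Definition H1norm {R : realType} (delta : R) (f : R -> R[i]) : \bar R :=
  \int[@lebesgue_measure R]_(x in circle)
     square_fun delta (coefs_of delta f) x.

Definition inH1 {R : realType} (delta : R) (f : R -> R[i]) : Prop :=
  inL1 f /\ (H1norm delta f < +oo)%E.

Definition arc_mean {R : realType} (delta : R) (b : R -> R[i]) (I : dyadic) :
    R[i] :=
  ((arc_len delta I)^-1)%:C%C * cint (haar_arc delta I) b.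

Definition BMOnorm {R : realType} (delta : R) (b : R -> R[i]) : \bar R :=
  (sqrte (ereal_sup
     [set ((arc_len delta I)^-1)%:E *
          \int[@lebesgue_measure R]_(x in haar_arc delta I)
             (normc (b x - arc_mean delta b I) ^+ 2)%:E
     | I in [set: dyadic]])
   + (normc (cint circle b))%:E)%E.

Definition inBMO {R : realType} (delta : R) (b : R -> R[i]) : Prop :=
  inL1 b /\ (BMOnorm delta b < +oo)%E.

(* Psi_0(t) = t / log(e + t) on [0, +oo], with its limit value at +oo; the
   value at -oo is irrelevant. *)
Definition Psi0 {R : realType} (t : \bar R) : \bar R :=
  match t with
  | r%:E => (r / ln (expR 1 + r))%:E
  | +oo => +oo
  | -oo => 0
  end%E.

Definition in_hlog {R : realType} (delta : R) (ff : collection R) : Prop :=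
  (\int[@lebesgue_measure R]_(x in circle) Psi0 (square_fun delta ff x)
     < +oo)%E.

Definition hlog_norm {R : realType} (delta : R) (ff : collection R) : \bar R :=
  ereal_inf [set l%:E | l in [set l : R | 0 < l /\
    (((2 * pi)^-1)%:E * \int[@lebesgue_measure R]_(x in circle)
        Psi0 ((l^-1)%:E * square_fun delta ff x) <= 1)%E]].

Definition test_function {R : realType} (phi : R -> R[i]) : Prop :=
  (forall x, phi (x + 2 * pi) = phi x) /\
  (forall (n : nat) (x : R),
     derivable (derive1n n (fun y => complex.Re (phi y))) x 1 /\
     derivable (derive1n n (fun y => complex.Im (phi y))) x 1).

Definition cderiv {R : realType} (n : nat) (phi : R -> R[i]) (x : R) : R[i] :=
  Complex (derive1n n (fun y => complex.Re (phi y)) x)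
          (derive1n n (fun y => complex.Im (phi y)) x).

(* Functionals are total on R -> R[i]; only their values at test functions
   matter. Continuity on C^oo is a bound by finitely many of the seminorms
   sup |phi^(j)|. *)
Definition distribution_on_circle {R : realType} (u : (R -> R[i]) -> R[i]) :
    Prop :=
  (forall (a : R[i]) phi psi, test_function phi -> test_function psi ->
     u (fun x => a * phi x + psi x) = a * u phi + u psi) /\
  (exists (n : nat) (C : R), forall phi (M : R), test_function phi ->
     (forall j x, (j <= n)%N -> normc (cderiv j phi x) <= M) ->
     normc (u phi) <= C * M).

Definition dist_eq {R : realType} (u v : (R -> R[i]) -> R[i]) : Prop :=
  forall phi, test_function phi -> u phi = v phi.

Definition dist_of_fun {R : realType} (f phi : R -> R[i]) : R[i] :=
  cint circle (fun x => f x * phi x).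

(* iota(ff) = u : the partial sums of ff converge to u in D'. *)
Definition is_iota {R : realType} (delta : R) (ff : collection R)
    (u : (R -> R[i]) -> R[i]) : Prop :=
  distribution_on_circle u /\
  forall phi, test_function phi ->
    (fun N => normc (dist_of_fun (haar_partial delta ff N) phi - u phi))
      @ \oo --> (0 : R).

Definition inHlog {R : realType} (delta : R) (u : (R -> R[i]) -> R[i]) : Prop :=
  exists ff, in_hlog delta ff /\ is_iota delta ff u.

(* The norm of any ff in h^log with iota(ff) = u; the infimum over the
   preimages makes this well defined without knowing that iota is injective. *)
Definition Hlog_norm {R : realType} (delta : R) (u : (R -> R[i]) -> R[i]) :
    \bar R :=
  ereal_inf [set hlog_norm delta ff
            | ff in [set ff | in_hlog delta ff /\ is_iota delta ff u]].

Definition finite_haar {R : realType} (delta : R) (f : R -> R[i]) : Prop :=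
  exists ff : collection R, finite_set [set I | haar_coef ff I != 0] /\
    f = (fun x => mean_coef ff +
           \sum_(I \in [set I | haar_coef ff I != 0])
              haar_coef ff I * (haar delta I x)%:C%C).

(* L is the duality pairing f |-> <f, g> : the bounded linear functional on
   H^1 that is given by integration against g on finite Haar expansions. *)
Definition is_pairing {R : realType} (delta : R) (g : R -> R[i])
    (L : (R -> R[i]) -> R[i]) : Prop :=
  [/\ forall (a : R[i]) f1 f2, inH1 delta f1 -> inH1 delta f2 ->
        L (fun x => a * f1 x + f2 x) = a * L f1 + L f2,
      exists C : R, forall f, inH1 delta f ->
        ((normc (L f))%:E <= C%:E * H1norm delta f)%E
    & forall f, finite_haar delta f ->
        L f = cint circle (fun x => f x * g x)].

(* u = f . b in D', that is, u(phi) = <f, phi b> for every test function. *)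
Definition is_product {R : realType} (delta : R) (f b : R -> R[i])
    (u : (R -> R[i]) -> R[i]) : Prop :=
  distribution_on_circle u /\
  forall phi, test_function phi ->
    exists L, is_pairing delta (fun x => phi x * b x) L /\ u phi = L f.

(* Bilinearity on X x Y of an operator whose values lie in a function space
   (U -> R[i]) with equality eqv. *)
Definition bilinear_on {R : realType} {U : Type} (X Y : (R -> R[i]) -> Prop)
    (eqv : (U -> R[i]) -> (U -> R[i]) -> Prop)
    (B : (R -> R[i]) -> (R -> R[i]) -> U -> R[i]) : Prop :=
  (forall (a : R[i]) f1 f2 b, X f1 -> X f2 -> Y b ->
     eqv (B (fun x => a * f1 x + f2 x) b)
         (fun t => a * B f1 b t + B f2 b t)) /\
  (forall (a : R[i]) f b1 b2, X f -> Y b1 -> Y b2 ->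
     eqv (B f (fun x => a * b1 x + b2 x))
         (fun t => a * B f b1 t + B f b2 t)).

(* Main.v *)
(* Let E_N f be the mean of f over the arcs of generation N and d_k f the jump of
   this martingale at generation k, of modulus |f_I| |I|^(-1/2) on I. Then
   E_N f E_N b = sum_(k < N) d_k f d_k b + T_N, where T_N is the martingale with
   mean f_0 b_0 and jumps d_k f E_k b + E_k f d_k b.
   S(f, b) is the limit of the diagonal sums: they converge absolutely in L^1 by
   the Garsia-Herz proof of the H^1-BMO duality, which weights the sum of
   |d_k f| |d_k b| by the running square function of f. T(f, b) is defined as the
   distribution f.b - S(f, b). It is the limit of T_N, since E_N b and b have the
   same mean on the arcs J of generation N, whence E_N f (phi b - phi E_N b) has
   integral O(2^-N).
   The square function of T_N is at most b* S[f] plus that of the paraproduct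
   sum E_k f d_k b. The latter is in L^1, because its integral is controlled by that of
   f*, and f* is in L^1 by Davis's inequality. The former is in L^log by
   John-Nirenberg for b* and the inequality Psi_0(u v) <= u + e^v - 1.
   As d_k f is, up to sign, known at time k, every estimate reduces to a one-step
   supermartingale inequality on the binary tree. *)

Require Import Defs.
From mathcomp Require Import all_boot all_order all_algebra.
From mathcomp Require Import complex.
From mathcomp Require Import all_classical all_reals all_analysis.
From mathcomp Require Import measurable_realfun ring lra zify.
Import Order.TTheory GRing.Theory Num.Theory.
Import numFieldNormedType.Exports.
Set Implicit Arguments.
Unset Strict Implicit.
Unset Printing Implicit Defensive.
Local Open Scope classical_set_scope.
Local Open Scope ring_scope.
Import Normc.

(** * Inequalities on the binary tree *)

Section Tree.
Context {R : realType}.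
Implicit Types (F G : nat -> R) (W X d x u A : nat -> nat -> R).

(** The estimates are proved for averages over the [2^N] nodes of one generation, with constants
    independent of [N]; monotone or dominated convergence then carries them to the circle. The
    halves of node [m] are [2m] and [2m + 1], so a conditional expectation is the mean of two
    numbers and a supermartingale inequality becomes an elementary inequality between reals. BMO
    enters the tree through the variance of [b] on each arc, a potential [A] with [0 <= A <= B^2]
    whose mean drop over one generation is the squared jump of [b]. Each square of a jump of [b] is
    paid for out of [A]. The logarithm cannot be avoided along this route: the maximal function of
    [b] is exponentially integrable but unbounded, so its product with the square function of [f]
    need not be integrable. For [f.b] to be a distribution, [phi b] has to stay in BMO. This is a
    balance of scales: on an arc [I] of generation [k] the test function oscillates by [O(|I|)],
    while the mean of [b] is only [O(k + 1)], and [|I| (k + 1)] is bounded. *)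

Definition tavg N F : R := (2 ^+ N)^-1 * \sum_(m < 2 ^ N) F m.

Lemma big_ord_double n (F : nat -> R) :
  \sum_(m < n.*2) F m = \sum_(m < n) (F m.*2 + F m.*2.+1).
Proof.
elim: n => [|n IH]; first by rewrite !big_ord0.
by rewrite doubleS !big_ord_recr /= IH addrA.
Qed.

Lemma tavg0 F : tavg 0 F = F 0%N.
Proof. by rewrite /tavg expr0 invr1 mul1r expn0 big_ord1. Qed.

Lemma tavgS N F : tavg N.+1 F = tavg N (fun m => (F m.*2 + F m.*2.+1) / 2).
Proof.
rewrite /tavg expnS mul2n big_ord_double -mulr_suml exprS invfM.
by ring.
Qed.

Lemma tavg_le N F G : (forall m, (m < 2 ^ N)%N -> F m <= G m) ->
  tavg N F <= tavg N G.
Proof.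
move=> FG; rewrite /tavg ler_wpM2l ?invr_ge0 ?exprn_ge0//.
by apply: ler_sum => i _; apply: FG.
Qed.

Lemma tavgD N F G : tavg N (fun m => F m + G m) = tavg N F + tavg N G.
Proof. by rewrite /tavg big_split/= mulrDr. Qed.

Lemma tavgZ N c F : tavg N (fun m => c * F m) = c * tavg N F.
Proof. by rewrite /tavg -mulr_sumr mulrCA. Qed.

Lemma tavgB N F G : tavg N (fun m => F m - G m) = tavg N F - tavg N G.
Proof.
rewrite -[- tavg N G]mulN1r -tavgZ -tavgD; congr tavg; apply/funext => m.
by rewrite mulN1r.
Qed.

Lemma tavg_cst N c : tavg N (fun=> c) = c.
Proof.
by rewrite /tavg sumr_const card_ord -[c *+ _]mulr_natl natrX mulrA mulVf ?mul1r// expf_neq0.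
Qed.

Lemma tavg_ge0 N F : (forall m, (m < 2 ^ N)%N -> 0 <= F m) -> 0 <= tavg N F.
Proof. by move=> F0; rewrite -(tavg_cst N 0); apply: tavg_le. Qed.

Lemma tavg_half N F : tavg N.+1 (fun m => F m./2) = tavg N F.
Proof.
rewrite tavgS; congr tavg; apply/funext => m.
by rewrite doubleK -[_.*2.+1./2]/(uphalf m.*2) uphalf_double; lra.
Qed.

(** The Bellman function method: each estimate below comes from a [W] that is controlled at the
    root, dominates the wanted quantity at generation [N], and leaves only this local inequality to
    check. *)
Lemma tree_supermartingale W N :
  (forall k m, (m < 2 ^ k)%N ->
     W k.+1 m.*2 + W k.+1 m.*2.+1 <= 2 * W k m) ->
  tavg N (W N) <= W 0%N 0%N.
Proof.
move=> HW; elim: N => [|N IH]; first by rewrite tavg0.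
apply: le_trans IH; rewrite tavgS; apply: tavg_le => m mN.
by have := HW _ _ mN; lra.
Qed.

(* Sum of [d] over the strict ancestors of the node [(k, m)]. *)
Fixpoint rsum d k m : R :=
  if k is k'.+1 then rsum d k' m./2 + d k' m./2 else 0.

(** Unlike in [rsum], the node itself counts: [x k m] is a value at the node, whereas the [d k m]
    summed by [rsum] belongs to the jump from the node to its halves. *)
Fixpoint rmax x k m : R :=
  if k is k'.+1 then Num.max (rmax x k' m./2) `|x k m| else `|x 0%N m|.

Lemma half_doubleS m : (m.*2.+1./2 = m)%N.
Proof. by rewrite -[LHS]/(uphalf m.*2) uphalf_double. Qed.

Lemma half_lt k m : (m < 2 ^ k.+1)%N -> (m./2 < 2 ^ k)%N.
Proof. by rewrite expnS; lia. Qed.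

(** Passes from a child and its parent [m./2] to a parent and its two halves, the form in which
    martingale hypotheses are given. *)
Lemma half_eq k (P : nat -> Prop) : (forall m, (m < 2 ^ k)%N ->
  P m.*2 /\ P m.*2.+1) -> forall m, (m < 2 ^ k.+1)%N -> P m.
Proof.
move=> H m mk; have [H1 H2] := H _ (half_lt mk).
by rewrite -(odd_double_half m); case: (odd m).
Qed.

Lemma rsumS d k m : rsum d k.+1 m = rsum d k m./2 + d k m./2.
Proof. by []. Qed.

Lemma rmaxS x k m : rmax x k.+1 m = Num.max (rmax x k m./2) `|x k.+1 m|.
Proof. by []. Qed.

Lemma rsum_le d1 d2 k m : (forall j i, (i < 2 ^ j)%N -> d1 j i <= d2 j i) ->
  (m < 2 ^ k)%N -> rsum d1 k m <= rsum d2 k m.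
Proof.
move=> H; elim: k m => [//|k IH] m mk /=.
by apply: lerD; [apply: IH|apply: H]; exact: half_lt.
Qed.

Lemma rsum_ge0 d k m : (forall j i, (i < 2 ^ j)%N -> 0 <= d j i) ->
  (m < 2 ^ k)%N -> 0 <= rsum d k m.
Proof.
move=> H; elim: k m => [//|k IH] m mk /=.
by apply: addr_ge0; [apply: IH|apply: H]; exact: half_lt.
Qed.

Lemma rsumZ c d k m : rsum (fun j i => c * d j i) k m = c * rsum d k m.
Proof. by elim: k m => [|k IH] m /=; rewrite ?mulr0// IH mulrDr. Qed.

Lemma rsumD d1 d2 k m :
  rsum (fun j i => d1 j i + d2 j i) k m = rsum d1 k m + rsum d2 k m.
Proof. by elim: k m => [|k IH] m /=; rewrite ?addr0// IH addrACA. Qed.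

Lemma rmax_ge x k m : `|x k m| <= rmax x k m.
Proof. by case: k => [|k] //=; rewrite le_max lexx orbT. Qed.

Lemma rmax_ge0 x k m : 0 <= rmax x k m.
Proof. exact: le_trans (normr_ge0 _) (rmax_ge x k m). Qed.

Lemma rmax_half x k m : rmax x k m./2 <= rmax x k.+1 m.
Proof. by rewrite /= le_max lexx. Qed.

(** With [M] the running maximum, [W = 2 M^2 - 4 M X] is a supermartingale: for fixed [M] it
    decreases in mean because [X] is a submartingale, and updating [M] to a larger [X] lowers it by
    [2 (X - M)^2]. At the root [W = - 2 X^2], and [W >= M^2 - 4 X^2] since [(M - 2 X)^2 >= 0]. *)
Lemma doob X N : (forall k m, 0 <= X k m) ->
  (forall k m, (m < 2 ^ k)%N -> 2 * X k m <= X k.+1 m.*2 + X k.+1 m.*2.+1) ->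
  tavg N (fun m => rmax X N m ^+ 2) <= 4 * tavg N (fun m => X N m ^+ 2).
Proof.
move=> X0 HX.
pose W k m := 2 * rmax X k m ^+ 2 - 4 * (rmax X k m * X k m).
have key k m i : 0 <= 2 * rmax X k m ^+ 2 - 4 * (rmax X k m * X k.+1 i) -
    (2 * Num.max (rmax X k m) (X k.+1 i) ^+ 2
       - 4 * (Num.max (rmax X k m) (X k.+1 i) * X k.+1 i)).
  by case: (leP (rmax X k m) (X k.+1 i)) => ?; nra.
have : tavg N (W N) <= W 0%N 0%N.
  apply: tree_supermartingale => k m mk; rewrite /W !rmaxS half_doubleS doubleK.
  rewrite !(ger0_norm (X0 _ _)).
  have := key k m m.*2; have := key k m m.*2.+1.
  have := HX k m mk; have := rmax_ge0 X k m; nra.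
rewrite {2}/W /= ger0_norm// => H.
rewrite -subr_le0 -tavgZ -tavgB; apply: (@le_trans _ _ (tavg N (W N))).
  apply: tavg_le => m _; rewrite /W.
  by have := sqr_ge0 (rmax X N m - 2 * X N m); lra.
by apply: le_trans H _; have := sqr_ge0 (X 0%N 0%N); lra.
Qed.

(** A Carleson embedding for weights that grow along the tree. In [W] the drop of [A] pays for
    [beta], and the growth of [u] multiplies [A - K <= 0], so it can only help. *)
Lemma carleson u A beta K N :
  (forall k m, (m < 2 ^ k)%N -> 0 <= u k m) ->
  (forall k m, (m < 2 ^ k)%N -> u k m <= u k.+1 m.*2 /\ u k m <= u k.+1 m.*2.+1) ->
  (forall k m, (m < 2 ^ k)%N -> 0 <= A k m <= K) ->
  (forall k m, (m < 2 ^ k)%N ->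
     2 * beta k m + (A k.+1 m.*2 + A k.+1 m.*2.+1) <= 2 * A k m) ->
  tavg N (rsum (fun k m => u k m * beta k m) N) <= K * tavg N (u N).
Proof.
move=> u0 uincr A01 HA.
pose W k m := rsum (fun k m => u k m * beta k m) k m + u k m * (A k m - K).
have dbl k m : (m < 2 ^ k)%N -> (m.*2 < 2 ^ k.+1)%N /\ (m.*2.+1 < 2 ^ k.+1)%N.
  by rewrite expnS; lia.
have : tavg N (W N) <= W 0%N 0%N.
  apply: tree_supermartingale => k m mk; rewrite /W !rsumS half_doubleS doubleK.
  have [m1 m2] := dbl _ _ mk.
  have /andP[_ a1] := A01 _ _ m1; have /andP[_ a2] := A01 _ _ m2.
  have [u1 u2] := uincr _ _ mk; have := HA _ _ mk; have := u0 _ _ mk.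
  nra.
have W0 : W 0%N 0%N <= 0.
  rewrite /W/= add0r mulr_ge0_le0 ?subr_le0 ?u0//.
  by have /andP[] := A01 0%N 0%N erefl.
move=> /le_trans/(_ W0) H.
rewrite -subr_le0 -tavgZ -tavgB; apply: le_trans H.
apply: tavg_le => m mN; rewrite /W lerD2l.
have := u0 _ _ mN; have /andP[] := A01 _ _ mN; nra.
Qed.


(** Telescoping: if [a] and [b] are the square roots of the sum before and after adding [e], then
    [e / b = (b^2 - a^2) / b <= 2 (b - a)]. *)
Lemma rsum_div_sqrt d N m : (m < 2 ^ N)%N ->
  (forall k m, (m < 2 ^ k)%N -> 0 <= d k m) ->
  rsum (fun k m => d k m / Num.sqrt (rsum d k m + d k m)) N m
    <= 2 * Num.sqrt (rsum d N m).
Proof.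
move=> mN d0; elim: N m mN => [|N IH] m mN; first by rewrite mulr_ge0.
rewrite !rsumS; set i := m./2; have iN : (i < 2 ^ N)%N by exact: half_lt.
have := IH _ iN; have q0 := rsum_ge0 d0 iN; have e0 := d0 _ _ iN.
move: (rsum d N i) (d N i) q0 e0 => q e q0 e0 H.
apply: le_trans (lerD H (lexx _)) _.
(* If all terms so far vanish, the quotient is [0] by the convention [0^-1 = 0]. *)
have [qe|qe] := eqVneq (q + e) 0.
  rewrite qe sqrtr0 invr0 mulr0 addr0 mulr0.
  by have -> : q = 0; [lra|rewrite sqrtr0 mulr0].
have qe0 : 0 < q + e by lra.
have r0 : 0 < Num.sqrt (q + e) by rewrite sqrtr_gt0.
rewrite -lerBrDl ler_pdivrMr//.
have := sqr_sqrtr q0; have := sqr_sqrtr (ltW qe0); have := sqrtr_ge0 q.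
move: (Num.sqrt q) (Num.sqrt (q + e)) r0 => a b; nra.
Qed.

Section WithSquareFunction.
Variables (d : nat -> nat -> R) (a : R).
Hypothesis d_ge0 : forall k m, (m < 2 ^ k)%N -> 0 <= d k m.
Hypothesis Ha : forall N,
  tavg N (fun m => Num.sqrt (rsum (fun k m => d k m ^+ 2) N m)) <= a.

(** The jump out of a node has the same size towards both halves, so its square can be included and
    [q k m] still depends on the node alone: it is the squared square function one generation later,
    known one step ahead. *)
Let q k m := rsum (fun k m => d k m ^+ 2) k m + d k m ^+ 2.

Let d2_ge0 k m : (m < 2 ^ k)%N -> 0 <= d k m ^+ 2.
Proof. by move=> _; exact: sqr_ge0. Qed.

Let q_ge0 k m : (m < 2 ^ k)%N -> 0 <= q k m.
Proof. by move=> mk; rewrite addr_ge0 ?d2_ge0 ?rsum_ge0//; exact: d2_ge0. Qed.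

Let q_incr k m : (m < 2 ^ k)%N ->
  q k m <= q k.+1 m.*2 /\ q k m <= q k.+1 m.*2.+1.
Proof.
move=> mk; rewrite /q !rsumS doubleK half_doubleS.
by split; rewrite lerDl sqr_ge0.
Qed.

Let tavg_q N : tavg N (fun m => Num.sqrt (q N m)) <= a.
Proof.
by rewrite -tavg_half; apply: le_trans (Ha N.+1); apply: tavg_le => m _.
Qed.

Let a_ge0 : 0 <= a.
Proof. by apply: le_trans (Ha 0); rewrite tavg0 sqrtr_ge0. Qed.

(* AM-GM weighted by the running square function [s] of [d]: [d^2 / s]
   telescopes, and [carleson] controls [s * e^2]. *)
Lemma garsia_herz e A B N : 0 < B ->
  (forall k m, (m < 2 ^ k)%N -> 0 <= e k m) ->
  (forall k m, (m < 2 ^ k)%N -> 0 <= A k m <= B ^+ 2) ->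
  (forall k m, (m < 2 ^ k)%N ->
     2 * e k m ^+ 2 + (A k.+1 m.*2 + A k.+1 m.*2.+1) <= 2 * A k m) ->
  tavg N (rsum (fun k m => d k m * e k m) N) <= 2 * B * a.
Proof.
move=> B0 e0 AB HA.
have H1 : tavg N (rsum (fun k m => d k m ^+ 2 / Num.sqrt (q k m)) N) <= 2 * a.
  apply: (@le_trans _ _ (2 * tavg N
    (fun m => Num.sqrt (rsum (fun k m => d k m ^+ 2) N m)))).
    by rewrite -tavgZ; apply: tavg_le => m mN; exact: rsum_div_sqrt.
  by rewrite ler_pM2l.
have H2 : tavg N (rsum (fun k m => Num.sqrt (q k m) * e k m ^+ 2) N)
    <= B ^+ 2 * a.
  apply: le_trans (ler_wpM2l (sqr_ge0 B) (tavg_q N)).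
  apply: (@carleson _ A) => // k m mk.
  by have [? ?] := q_incr mk; split; rewrite ler_wsqrtr.
(* The weights balance the bounds [2 * a] and [B ^+ 2 * a] of the two sums; the total is
   [3/2 * B * a]. *)
apply: (@le_trans _ _ (tavg N (fun m =>
  B / 2 * rsum (fun k m => d k m ^+ 2 / Num.sqrt (q k m)) N m +
  (2 * B)^-1 * rsum (fun k m => Num.sqrt (q k m) * e k m ^+ 2) N m))).
  apply: tavg_le => m mN; rewrite -!rsumZ -rsumD; apply: rsum_le => // {mN}m k mk.
  have d0 := d_ge0 mk; have e1 := e0 _ _ mk; have qq := q_ge0 mk.
  have [q0|q0] := eqVneq (q m k) 0.
    have := sqr_ge0 (d m k); have := rsum_ge0 d2_ge0 mk => h1 h2.
    have -> : d m k = 0 by move: q0; rewrite /q; nra.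
    by rewrite !(mul0r, expr0n, mulr0) /= addr_ge0// ?mulr_ge0 ?sqr_ge0 ?invr_ge0//; lra.
  have s0 : 0 < Num.sqrt (q m k) by rewrite sqrtr_gt0; lra.
  move: (Num.sqrt _) s0 => s s0.
  rewrite -subr_ge0.
  have -> : B / 2 * (d m k ^+ 2 / s) + (2 * B)^-1 * (s * e m k ^+ 2) - d m k * e m k
    = (B * d m k - s * e m k) ^+ 2 / (2 * B * s).
    by field; rewrite !gt_eqF.
  by rewrite divr_ge0 ?sqr_ge0// !mulr_ge0// ltW.
rewrite tavgD !tavgZ.
apply: (@le_trans _ _ (B / 2 * (2 * a) + (2 * B)^-1 * (B ^+ 2 * a))).
  by apply: lerD; apply: ler_wpM2l => //; rewrite ?invr_ge0; nra.
have -> : (2 * B)^-1 * (B ^+ 2 * a) = B * a / 2 by field; rewrite gt_eqF.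
by have := mulr_ge0 (ltW B0) a_ge0; lra.
Qed.

(** The jumps of [x] are divided by [r], the fourth root of [q]. The squared jumps of the resulting
    martingale [g] are at most [d^2 / sqrt q], whose sums telescope, so [g] has second moment at
    most [2 * a] and [doob] controls its running maximum [G]. Undoing the division gives [|x| <=
    |x_0| + 2 r G <= |x_0| + r^2 + G^2]. The constant is [9 = 1 + 4 * 2], from [r^2 = sqrt q], from
    [doob], and from the second moment. *)
Lemma davis x N :
  (forall k m, (m < 2 ^ k)%N -> `|x k.+1 m.*2 - x k m| <= d k m) ->
  (forall k m, (m < 2 ^ k)%N -> x k.+1 m.*2 + x k.+1 m.*2.+1 = 2 * x k m) ->
  tavg N (rmax x N) <= `|x 0%N 0%N| + 9 * a.
Proof.
move=> xd xm.
pose s k m := Num.sqrt (q k m); pose r k m := Num.sqrt (s k m).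
have s0 k m : 0 <= s k m by exact: sqrtr_ge0.
have r0 k m : 0 <= r k m by exact: sqrtr_ge0.
have rr k m : r k m ^+ 2 = s k m by rewrite sqr_sqrtr.
have r_incr k m : (m < 2 ^ k)%N -> r k m <= r k.+1 m.*2 /\ r k m <= r k.+1 m.*2.+1.
  by move=> mk; have [? ?] := q_incr mk; split; rewrite !ler_wsqrtr.
(* A martingale transform with the predictable multiplier [1 / r]. Where [r] vanishes so does the
   jump of [x], by [r00], which makes the convention [0^-1 = 0] the right one. *)
pose g := fix g k m := if k is k'.+1 then
  g k' m./2 + (x k m - x k' m./2) / r k' m./2 else 0.
have gS k m : g k.+1 m = g k m./2 + (x k.+1 m - x k m./2) / r k m./2 by [].
have gm k m : (m < 2 ^ k)%N -> g k.+1 m.*2 + g k.+1 m.*2.+1 = 2 * g k m.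
  move=> mk; rewrite !gS doubleK half_doubleS addrACA -mulrDl.
  have := xm _ _ mk => h.
  by have -> : x k.+1 m.*2 - x k m + (x k.+1 m.*2.+1 - x k m) = 0; lra.
have xd' k m : (m < 2 ^ k.+1)%N -> `|x k.+1 m - x k m./2| <= d k m./2.
  move: m; apply: half_eq => m mk; rewrite doubleK half_doubleS; split; first exact: xd.
  apply: le_trans (xd _ _ mk); rewrite -normrN le_eqVlt; apply/orP; left.
  by apply/eqP; congr `| _ |; have := xm _ _ mk; lra.
have dr k m : (m < 2 ^ k)%N -> d k m <= s k m.
  move=> mk; rewrite -[d k m]ger0_norm ?d_ge0// -sqrtr_sqr ler_wsqrtr//.
  by rewrite /q lerDr; exact: rsum_ge0.
have r00 k m : (m < 2 ^ k)%N -> r k m = 0 -> d k m = 0.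
  move=> mk rk; have := dr _ _ mk; rewrite -rr rk expr0n/= => h.
  by apply/eqP; rewrite eq_le h d_ge0.
have gsq : tavg N (fun m => g N m ^+ 2) <= 2 * a.
  pose D k m := d k m ^+ 2 / s k m.
  pose W k m := g k m ^+ 2 - rsum D k m.
  have : tavg N (W N) <= 0.
    have -> : 0 = W 0%N 0%N by rewrite /W /= expr0n subr0.
    apply: tree_supermartingale => k m mk; rewrite /W; have := gm _ _ mk; rewrite !rsumS doubleK half_doubleS !gS doubleK half_doubleS.
    have := xd _ _ mk; have := xm _ _ mk => h1 h2 _.
    have -> : x k.+1 m.*2.+1 - x k m = - (x k.+1 m.*2 - x k m) by lra.
    move: (x k.+1 m.*2 - x k m) h2 => t ht.
    have [rk|rk] := eqVneq (r k m) 0.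
      have dk := r00 _ _ mk rk; move: ht; rewrite dk normr_le0 => /eqP ->.
      by rewrite /D dk expr0n /= !mul0r oppr0 mul0r !addr0; lra.
    have t2 : t ^+ 2 <= d k m ^+ 2.
      rewrite -[t ^+ 2]ger0_norm ?sqr_ge0// normrX ler_sqr ?nnegrE//.
      exact: d_ge0.
    have : (t / r k m) ^+ 2 <= D k m.
      by rewrite /D -rr exprMn exprVn ler_wpM2r ?invr_ge0 ?exprn_ge0.
    by rewrite mulNr; move: (t / _) (D k m) => w v ?; lra.
  rewrite /W tavgB subr_le0 => /le_trans; apply.
  apply: (@le_trans _ _ (2 * tavg N
    (fun m => Num.sqrt (rsum (fun k m => d k m ^+ 2) N m)))).
    by rewrite -tavgZ; apply: tavg_le => m mN; exact: rsum_div_sqrt.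
  by rewrite ler_pM2l.
(* Summation by parts, with dx = r dg. *)
have parts k m : (m < 2 ^ k.+1)%N ->
    `|x k.+1 m - x 0%N 0%N - r k m./2 * g k.+1 m| <= r k m./2 * rmax g k m./2.
  elim: k m => [|k IH] m mk.
    have m0 : (m./2 = 0)%N by move: (half_lt mk); rewrite expn0; lia.
    rewrite gS m0 /= add0r normr0 mulr0.
    have [rk|rk] := eqVneq (r 0%N 0%N) 0.
      have := xd' _ _ mk; rewrite m0 (r00 _ _ _ rk)// normr_le0 => /eqP ->.
      by rewrite mul0r mulr0 subrr normr0.
    by rewrite mulrCA divff// mulr1 subrr normr0.
  have mk2 := half_lt mk; have := IH _ mk2.
  set i := m./2 in mk2 *; set j := i./2.
  have rij : r k j <= r k.+1 i.
    by move: i mk2 @j; apply: half_eq => l lk; rewrite doubleK half_doubleS; exact: r_incr.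
  have -> : x k.+2 m - x 0%N 0%N - r k.+1 i * g k.+2 m =
      x k.+1 i - x 0%N 0%N - r k j * g k.+1 i - (r k.+1 i - r k j) * g k.+1 i.
    rewrite (gS k.+1) -/i; have [rk|rk] := eqVneq (r k.+1 i) 0.
      have : x k.+2 m - x k.+1 i = 0.
        apply/eqP; rewrite -normr_le0 -(r00 _ _ mk2 rk); exact: xd'.
      by rewrite rk => h; lra.
    by field.
  move=> h; apply: le_trans (ler_normB _ _) _.
  rewrite normrM (ger0_norm (_ : 0 <= r k.+1 i - r k j)) ?subr_ge0//.
  have h1 := rmax_half g k i; have h2 := rmax_ge g k.+1 i; have h3 := r0 k j.
  have : r k j * rmax g k j <= r k j * rmax g k.+1 i by rewrite ler_wpM2l.
  have : (r k.+1 i - r k j) * `|g k.+1 i| <= (r k.+1 i - r k j) * rmax g k.+1 i.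
    by rewrite ler_wpM2l// subr_ge0.
  move=> *; nra.
have rmx k m : (m < 2 ^ k)%N ->
    rmax x k m <= `|x 0%N 0%N| + (s k m + rmax g k m ^+ 2).
  elim: k m => [|k IH] m mk.
    move: mk; rewrite expn0; case: m => // _ /=.
    by rewrite lerDl addr_ge0 ?sqr_ge0.
  have mk2 := half_lt mk.
  have sincr : s k m./2 <= s k.+1 m.
    by move: m mk mk2; apply: half_eq => l lk; rewrite doubleK half_doubleS;
       split=> _; have [? ?] := q_incr lk; rewrite ler_wsqrtr.
  have gi : rmax g k m./2 ^+ 2 <= rmax g k.+1 m ^+ 2.
    by rewrite ler_sqr ?nnegrE ?rmax_ge0// rmax_half.
  rewrite rmaxS ge_max; apply/andP; split.
    by apply: le_trans (IH _ mk2) _; rewrite lerD2l lerD.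
  have h := parts _ _ mk.
  have := ler_normD (x k.+1 m - x 0%N 0%N - r k m./2 * g k.+1 m)
    (r k m./2 * g k.+1 m + x 0%N 0%N).
  have -> : x k.+1 m - x 0%N 0%N - r k m./2 * g k.+1 m +
    (r k m./2 * g k.+1 m + x 0%N 0%N) = x k.+1 m by lra.
  have := ler_normD (r k m./2 * g k.+1 m) (x 0%N 0%N).
  rewrite normrM (ger0_norm (r0 k m./2)).
  have := rmax_half g k m; have := rmax_ge g k.+1 m; have := rr k m./2.
  have := r0 k m./2.
  move: (rmax g k m./2) (rmax g k.+1 m) (r k m./2) (s k m./2) (s k.+1 m) h sincr.
  move=> G0 G1 r1 s1 s2 h si r1p rs1 h1 h2 h3 h4.
  have : r1 * G0 <= r1 * G1 by rewrite ler_wpM2l.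
  have : r1 * `|g k.+1 m| <= r1 * G1 by rewrite ler_wpM2l.
  have := sqr_ge0 (r1 - G1).
  lra.
apply: le_trans (tavg_le (rmx N)) _.
rewrite !tavgD tavg_cst lerD2l.
(* [doob] asks for a nonnegative submartingale, which [|g|] is. *)
have := tavg_q N; have e : rmax g N = rmax (fun k m => `|g k m|) N.
  by elim: N {gsq} => [|k IH]; apply/funext => m /=; rewrite ?IH normr_id.
have : tavg N (fun m => rmax g N m ^+ 2) <= 4 * (2 * a).
  rewrite e; apply: le_trans (doob _ _ _) _ => //.
    move=> k m mk; have := ler_normD (g k.+1 m.*2) (g k.+1 m.*2.+1).
    by rewrite gm// normrM (ger0_norm (_ : 0 <= 2)).
  rewrite ler_pM2l//; apply: le_trans gsq; apply: tavg_le => m _.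
  by rewrite -normrX ger0_norm// sqr_ge0.
by lra.
Qed.

(** One factor [|x|] of each term is bounded by the final running maximum [x^*] and taken out of the
    sum, the other by the running maximum at its own node. The remaining sum [Q] is a Carleson sum
    with this increasing weight, so its average is at most [B^2] times that of [x^*]. By AM-GM the
    root of [x^* Q] is at most [B/2 x^* + Q / (2B)], and [davis] concludes. *)
Lemma paraproduct x e A B N : 0 < B ->
  (forall k m, (m < 2 ^ k)%N -> `|x k.+1 m.*2 - x k m| <= d k m) ->
  (forall k m, (m < 2 ^ k)%N -> x k.+1 m.*2 + x k.+1 m.*2.+1 = 2 * x k m) ->
  (forall k m, (m < 2 ^ k)%N -> 0 <= A k m <= B ^+ 2) ->
  (forall k m, (m < 2 ^ k)%N ->
     2 * e k m ^+ 2 + (A k.+1 m.*2 + A k.+1 m.*2.+1) <= 2 * A k m) ->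
  tavg N (fun m => Num.sqrt (rsum (fun k m => (x k m * e k m) ^+ 2) N m))
    <= B * (`|x 0%N 0%N| + 9 * a).
Proof.
move=> B0 xd xm AB HA; have D := davis N xd xm.
have H : tavg N (rsum (fun k m => rmax x k m * e k m ^+ 2) N)
    <= B ^+ 2 * tavg N (rmax x N).
  apply: (@carleson _ A) => // k m mk; first exact: rmax_ge0.
  by have := rmax_half x k m.*2; have := rmax_half x k m.*2.+1; rewrite doubleK half_doubleS.
apply: le_trans (ler_wpM2l (ltW B0) D).
apply: (@le_trans _ _ (tavg N (fun m => B / 2 * rmax x N m +
   (2 * B)^-1 * rsum (fun k m => rmax x k m * e k m ^+ 2) N m))).
  apply: tavg_le => m mN.
  set P := rsum _ N m; set Q := rsum _ N m.
  have Q0 : 0 <= Q.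
    by apply: rsum_ge0 => // *; rewrite mulr_ge0 ?rmax_ge0 ?sqr_ge0.
  have PQ : P <= rmax x N m * Q.
    rewrite /P /Q; elim: N m mN {P Q Q0 D H} => [|N IH] m mN; first by rewrite mulr0.
    rewrite !rsumS; have := IH _ (half_lt mN).
    have Q0 : 0 <= rsum (fun k m => rmax x k m * e k m ^+ 2) N m./2.
      by apply: rsum_ge0 (half_lt mN) => // *; rewrite mulr_ge0 ?rmax_ge0 ?sqr_ge0.
    have h1 := rmax_half x N m; have h2 := rmax_ge x N m./2.
    have h3 := normr_ge0 (x N m./2); have h4 := sqr_ge0 (e N m./2).
    rewrite exprMn -[x N m./2 ^+ 2]ger0_norm ?sqr_ge0// normrX.
    move: Q0 h1 h2 h3 h4; set q' := rsum (fun k m => rmax x k m * e k m ^+ 2) N m./2.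
    set p := rsum _ N m./2; set X0 := rmax x N m./2; set X1 := rmax x N.+1 m.
    move: (e N m./2 ^+ 2) `|x N m./2| => f y q0 h1 h2 h3 h4 h5.
    have : X0 * q' <= X1 * q' by rewrite ler_wpM2r.
    have : y ^+ 2 * f <= X1 * (X0 * f).
      by rewrite mulrA ler_wpM2r// expr2 ler_pM//; lra.
    lra.
  have X0 := rmax_ge0 x N m.
  have : Num.sqrt P <= Num.sqrt ((B / 2 * rmax x N m + (2 * B)^-1 * Q) ^+ 2).
    apply: ler_wsqrtr; apply: le_trans PQ _; rewrite -subr_ge0.
    have -> : (B / 2 * rmax x N m + (2 * B)^-1 * Q) ^+ 2 - rmax x N m * Q =
      (B / 2 * rmax x N m - (2 * B)^-1 * Q) ^+ 2 by field; rewrite gt_eqF.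
    exact: sqr_ge0.
  rewrite sqrtr_sqr ger0_norm// addr_ge0// mulr_ge0// ?invr_ge0; nra.
rewrite tavgD !tavgZ.
have : (2 * B)^-1 * tavg N (rsum (fun k m => rmax x k m * e k m ^+ 2) N)
   <= (2 * B)^-1 * (B ^+ 2 * tavg N (rmax x N)).
  by rewrite ler_wpM2l// invr_ge0; nra.
have -> : (2 * B)^-1 * (B ^+ 2 * tavg N (rmax x N)) = B / 2 * tavg N (rmax x N).
  by field; rewrite gt_eqF.
by lra.
Qed.

End WithSquareFunction.

(** From [1 - t <= expR (- t)] one gets [(1 - t) * expR t <= 1], and [(1 - t) (1 + t + 2 t^2) = 1 +
    t^2 (1 - 2 t) >= 1] for [t <= 1/2]. *)
Lemma expR_le_quad (t : R) : `|t| <= 2^-1 -> expR t <= 1 + t + 2 * t ^+ 2.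
Proof.
rewrite ler_norml => /andP[t1 t2].
have := expR_ge1Dx (- t); rewrite expRN => h.
have e0 := expR_gt0 t.
have : (1 - t) * expR t <= 1.
  by apply: le_trans (ler_wpM2r (ltW e0) h) _; rewrite mulVf ?gt_eqF.
move: (expR t) e0 => e e0 h'.
have : (1 - t) * e <= (1 - t) * (1 + t + 2 * t ^+ 2) by nra.
by rewrite ler_pM2l//; lra.
Qed.

Lemma john_nirenberg h A N :
  (forall k m, (m < 2 ^ k)%N -> h k.+1 m.*2 + h k.+1 m.*2.+1 = 2 * h k m) ->
  (forall k m, (m < 2 ^ k)%N -> 0 <= A k m <= 1) ->
  (forall k m, (m < 2 ^ k)%N ->
     2 * (h k.+1 m.*2 - h k m) ^+ 2 + (A k.+1 m.*2 + A k.+1 m.*2.+1)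
       <= 2 * A k m) ->
  tavg N (fun m => expR (h N m / 4)) <= 4 * expR (h 0%N 0%N / 4).
Proof.
move=> hm A01 HA.
(* A Bellman function: the term [- A^2] pays for the correlation between the
   jump of [h] and that of the remaining variance [A]. *)
pose W k m := expR (h k m / 4) * (1 + 4 * A k m - A k m ^+ 2).
have WN : tavg N (W N) <= W 0%N 0%N.
  apply: tree_supermartingale => k m mk; rewrite /W.
  have -> : h k.+1 m.*2.+1 / 4 = h k m / 4 - (h k.+1 m.*2 - h k m) / 4.
    by have := hm _ _ mk; lra.
  have -> : h k.+1 m.*2 / 4 = h k m / 4 + (h k.+1 m.*2 - h k m) / 4 by lra.
  rewrite !expRD -!mulrA [leRHS]mulrCA -mulrDr ler_pM2l ?expR_gt0//.
  have [m1 m2] : (m.*2 < 2 ^ k.+1)%N /\ (m.*2.+1 < 2 ^ k.+1)%N.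
    by rewrite expnS; lia.
  move: (HA _ _ mk) (A01 _ _ mk) (A01 _ _ m1) (A01 _ _ m2).
  set t := (_ - h k m) / 4; have -> : h k.+1 m.*2 - h k m = 4 * t by rewrite /t; lra.
  move: (A k m) (A k.+1 m.*2) (A k.+1 m.*2.+1) => a a1 a2 H /andP[? ?] /andP[? ?] /andP[? ?].
  have t2 : t ^+ 2 <= 2^-1 ^+ 2 by lra.
  have t1 : `|t| <= 2^-1 by rewrite -ler_sqr ?nnegrE// -normrX ger0_norm ?sqr_ge0.
  have e1 := expR_le_quad t1.
  have := @expR_le_quad (- t); rewrite normrN sqrrN => /(_ t1) e2.
  have p1 : 0 <= 1 + 4 * a1 - a1 ^+ 2 by nra.
  have p2 : 0 <= 1 + 4 * a2 - a2 ^+ 2 by nra.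
  apply: le_trans (lerD (ler_wpM2r p1 e1) (ler_wpM2r p2 e2)) _.
  (* Mean and half-difference of the variance left on the two halves. The correlation is the product
     [t * al], which [h3] absorbs into [t^2] and the [al^2] gained from the concave term. *)
  pose c := (a1 + a2) / 2; pose al := (a1 - a2) / 2.
  have -> : a1 = c + al by rewrite /c /al; lra.
  have -> : a2 = c - al by rewrite /c /al; lra.
  have ca : c + 16 * t ^+ 2 <= a by rewrite /c; lra.
  have c0 : 0 <= c <= 1 by rewrite /c; lra.
  have [c1 c2] := andP c0; have h5 := sqr_ge0 t.
  have h1 : c ^+ 2 + 2 * (16 * t ^+ 2) <= 4 * (a - c) + c ^+ 2 - (a ^+ 2 - c ^+ 2).
    have : 0 <= (a - c) * (2 - a - c) by rewrite mulr_ge0//; lra.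
    by lra.
  have h2 : t ^+ 2 * (1 + 4 * c - c ^+ 2) <= t ^+ 2 * 4.
    by rewrite ler_wpM2l ?sqr_ge0//; nra.
  have h3 : t * (4 - 2 * c) * al <= 4 * t ^+ 2 + al ^+ 2.
    have : 0 <= (t * (2 - c) - al) ^+ 2 by exact: sqr_ge0.
    have : t ^+ 2 * (2 - c) ^+ 2 <= t ^+ 2 * 4.
      by rewrite ler_wpM2l ?sqr_ge0//; nra.
    by lra.
  have h4 : 0 <= t ^+ 2 * al ^+ 2 by rewrite mulr_ge0 ?sqr_ge0.
  by lra.
(* For [0 <= A <= 1] the factor [1 + 4 A - A^2] lies between [1] and [4], whence the constant
   [4]. *)
apply: (@le_trans _ _ (tavg N (W N))).
  apply: tavg_le => m mN; rewrite /W; have /andP[? ?] := A01 _ _ mN.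
  by rewrite -[leLHS]mulr1 ler_pM2l ?expR_gt0//; nra.
apply: le_trans WN _; rewrite /W; have /andP[? ?] := A01 0%N 0%N erefl.
by rewrite mulrC ler_pM2r ?expR_gt0//; nra.
Qed.

(** Doob's inequality applied to [X = expR (h'/8) + expR (- h'/8)], a submartingale by convexity
    that dominates [expR (|h'|/8)]. Its square has the exponent [1/4] of [john_nirenberg], used for
    [h'] and for [- h']. The constant is [64 = 4 * 2 * (4 + 4)]: Doob, the square of a sum, and two
    exponential bounds. *)
Lemma john_nirenberg_max h A B N : 0 < B ->
  (forall k m, (m < 2 ^ k)%N -> h k.+1 m.*2 + h k.+1 m.*2.+1 = 2 * h k m) ->
  (forall k m, (m < 2 ^ k)%N -> 0 <= A k m <= B ^+ 2) ->
  (forall k m, (m < 2 ^ k)%N ->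
     2 * (h k.+1 m.*2 - h k m) ^+ 2 + (A k.+1 m.*2 + A k.+1 m.*2.+1)
       <= 2 * A k m) ->
  tavg N (fun m => expR (rmax h N m / (4 * B)))
    <= 64 * expR (`|h 0%N 0%N| / (4 * B)).
Proof.
move=> B0 hm A01 HA.
pose h' k m := h k m / B; pose A' k m := A k m / B ^+ 2.
have B2 : 0 < B ^+ 2 by rewrite exprn_gt0.
have hm' k m : (m < 2 ^ k)%N -> h' k.+1 m.*2 + h' k.+1 m.*2.+1 = 2 * h' k m.
  by move=> mk; rewrite /h' -mulrDl hm// mulrA.
have A01' k m : (m < 2 ^ k)%N -> 0 <= A' k m <= 1.
  move=> mk; have /andP[? ?] := A01 _ _ mk.
  by rewrite /A' divr_ge0 ?ler_pdivrMr ?mul1r// ltW.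
have HA' k m : (m < 2 ^ k)%N ->
     2 * (h' k.+1 m.*2 - h' k m) ^+ 2 + (A' k.+1 m.*2 + A' k.+1 m.*2.+1)
       <= 2 * A' k m.
  move=> mk; rewrite /h' /A' -mulrBl expr_div_n -subr_ge0.
  set z := (X in 0 <= X); have -> : z = (2 * A k m - (2 * (h k.+1 m.*2 - h k m) ^+ 2
    + (A k.+1 m.*2 + A k.+1 m.*2.+1))) / B ^+ 2 by rewrite /z; lra.
  by rewrite divr_ge0 ?subr_ge0 ?HA// ltW.
pose X k m := expR (h' k m / 8) + expR (- h' k m / 8).
have X0 k m : 0 <= X k m by rewrite addr_ge0// ltW// expR_gt0.
have step (u v w : R) : v + w = 2 * u -> 2 * expR u <= expR v + expR w.
  move=> e; have [t vt] : exists t, v = u + t by exists (v - u); lra.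
  have -> : w = u - t by lra.
  rewrite vt !expRD -mulrDr mulrC ler_pM2l ?expR_gt0//.
  by have := expR_ge1Dx t; have := expR_ge1Dx (- t); lra.
have XS k m : (m < 2 ^ k)%N -> 2 * X k m <= X k.+1 m.*2 + X k.+1 m.*2.+1.
  move=> mk; rewrite /X mulrDr addrACA; have := hm' _ _ mk.
  move: (h' k m) (h' k.+1 m.*2) (h' k.+1 m.*2.+1) => u v w e.
  by apply: lerD; apply: step; lra.
have hX k m : expR (`|h' k m| / 8) <= X k m.
  rewrite /X; case: (ger0P (h' k m)) => _; rewrite ?lerDl ?lerDr; exact: expR_ge0.
have mX : tavg N (fun m => expR (rmax h N m / (4 * B))) <=
    tavg N (fun m => rmax X N m ^+ 2).
  apply: tavg_le => m _.
  have : expR (rmax h N m / (8 * B)) <= rmax X N m.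
    elim: N m => [|N IH] m.
      rewrite /= (ger0_norm (X0 _ _)); apply: le_trans (hX _ _).
      by rewrite ler_expR /h' normrM normfV (gtr0_norm B0) invfM mulrCA mulrC.
    rewrite !rmaxS le_max; case: (leP (rmax h N m./2)) => _.
      apply/orP; right; rewrite (ger0_norm (X0 _ _)); apply: le_trans (hX _ _).
      by rewrite ler_expR /h' normrM normfV (gtr0_norm B0) invfM mulrCA mulrC.
    by rewrite IH.
  have -> : rmax h N m / (4 * B) = rmax h N m / (8 * B) * 2.
    by field; rewrite gt_eqF.
  by rewrite expRM_natr ler_sqr ?nnegrE ?rmax_ge0 ?expR_ge0.
apply: le_trans mX _; apply: le_trans (doob _ X0 XS) _.
have J1 := john_nirenberg N hm' A01' HA'.
have J2 := @john_nirenberg (fun k m => - h' k m) A' N.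
have {}J2 : tavg N (fun m => expR (- h' N m / 4)) <= 4 * expR (- h' 0%N 0%N / 4).
  apply: J2 => // k m mk; first by have := hm' _ _ mk; lra.
  by rewrite -opprD sqrrN; exact: HA'.
have XX : tavg N (fun m => X N m ^+ 2) <=
    2 * (tavg N (fun m => expR (h' N m / 4)) + tavg N (fun m => expR (- h' N m / 4))).
  rewrite -tavgD -tavgZ; apply: tavg_le => m _; rewrite /X.
  have -> : h' N m / 4 = (h' N m / 8) * 2 by lra.
  have -> : - h' N m / 4 = (- h' N m / 8) * 2 by lra.
  rewrite !expRM_natr; move: (expR _) (expR _) => u v.
  by have := sqr_ge0 (u - v); lra.
have hB : `|h 0%N 0%N| / (4 * B) = `|h 0%N 0%N| / B / 4.
  by field; rewrite gt_eqF.
have E1 : expR (h' 0%N 0%N / 4) <= expR (`|h 0%N 0%N| / (4 * B)).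
  by rewrite ler_expR hB ler_pM2r// /h' ler_pM2r ?invr_gt0// ler_norm.
have E2 : expR (- h' 0%N 0%N / 4) <= expR (`|h 0%N 0%N| / (4 * B)).
  by rewrite ler_expR hB ler_pM2r// /h' -mulNr ler_pM2r ?invr_gt0// -normrN ler_norm.
by lra.
Qed.
End Tree.

(** * Dyadic arcs and binary nodes *)

Section Arcs.
Context {R : realType}.
Variable delta : R.
Hypothesis hdelta : 0 <= delta < 1.
Implicit Types (x y : R) (f g h : R -> R) (F : nat -> R).
Local Notation mu := (@lebesgue_measure R).

(* The position of [x] relative to the origin of the dyadic system, in turns. *)
Definition turn x : R :=
  let y := x / (2 * pi) - delta in if y < 0 then y + 1 else y.

Definition node k x : nat := Num.truncn (2 ^+ k * turn x).

Let p0 : 0 < 2 * pi :> R. Proof. by rewrite mulr_gt0 ?pi_gt0. Qed.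

Let shiftE x (d t : R) : x + 2 * pi * t = 2 * pi * (x / (2 * pi) - d + t + d).
Proof. by move: (2 * pi) p0 => L L0; field; rewrite gt_eqF. Qed.

Let int_eq0 (i : int) : -1 < i -> i < 1 -> i = 0.
Proof. lia. Qed.

Let int_eq01 (i : int) : -1 < i -> i < 2 -> i = 0 \/ i = 1.
Proof. lia. Qed.

Lemma circleP x : circle x <-> 0 <= x < 2 * pi.
Proof. by rewrite /circle /= in_itv. Qed.

Lemma turn_itv x : circle x -> 0 <= turn x < 1.
Proof.
move=> /circleP /andP[x0 x1]; have /andP[d0 d1] := hdelta.
have : 0 <= x / (2 * pi) < 1.
  by rewrite divr_ge0 ?(ltW p0)//= ltr_pdivrMr// mul1r.
by rewrite /turn; move=> /andP[? ?]; case: ltP => ?; lra.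
Qed.

Lemma node_lt k x : circle x -> (node k x < 2 ^ k)%N.
Proof.
move=> cx; have /andP[t0 t1] := turn_itv cx.
rewrite /node truncn_lt_nat ?mulr_ge0 ?exprn_ge0//.
by rewrite natrX -[ltRHS]mulr1 ltr_pM2l ?exprn_gt0.
Qed.

Lemma nodeS k x : circle x -> (node k.+1 x)./2 = node k x.
Proof.
move=> cx; have /andP[t0 t1] := turn_itv cx.
have t2 : 0 <= 2 ^+ k * turn x by rewrite mulr_ge0 ?exprn_ge0.
apply/esym/truncn_def; have : 0 <= 2 ^+ k.+1 * turn x by rewrite exprS -mulrA mulr_ge0.
move=> /truncn_itv; rewrite -/(node k.+1 x) exprS -mulrA => /andP[h1 h2].
rewrite -[ltRHS]natr1 in h2; rewrite -[ltRHS]natr1; move: h1 h2.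
have -> : (node k.+1 x)%:R = (odd (node k.+1 x))%:R + 2 * (node k.+1 x)./2%:R :> R.
  by rewrite -natrM mul2n -natrD odd_double_half.
have : 0 <= ((odd (node k.+1 x))%:R : R) <= 1 by case: (odd _); rewrite /= ?lexx ler01.
by move=> /andP[? ?] h1 h2; apply/andP; split; lra.
Qed.

(** [turn x] and the translated position [t] differ by an integer and both lie in [[0, 1[], so the
    integer is [0]. This removes the existential over translates from arcs. *)
Lemma arcP k m x : (m < 2 ^ k)%N ->
  dyadic_arc delta k m x <-> circle x /\ node k x = m.
Proof.
move=> mk; have k0 : 0 < 2 ^+ k :> R by rewrite exprn_gt0.
have M : (m.+1%:R : R) <= 2 ^+ k by rewrite -natrX ler_nat.
have eqv (t : R) : (2 * pi * (m%:R / 2 ^+ k + delta) <= 2 * pi * (t + delta)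
    < 2 * pi * (m.+1%:R / 2 ^+ k + delta)) = (m%:R <= 2 ^+ k * t < m.+1%:R).
  by rewrite ler_pM2l// ltr_pM2l// lerD2r ltrD2r ler_pdivrMr// ltr_pdivlMr// ![t * _]mulrC.
split => [[cx [j]]|[cx mx]].
  have /andP[t0 t1] := turn_itv cx.
  pose t : R := x / (2 * pi) - delta + j%:~R.
  have -> : x + 2 * pi * j%:~R = 2 * pi * (t + delta).
    exact: shiftE.
  rewrite eqv => /andP[h1 h2]; split=> //.
  have : 0 <= t < 1.
    apply/andP; split.
      by rewrite -(pmulr_rge0 _ k0); apply: le_trans h1.
    by rewrite -(ltr_pM2l k0) mulr1; apply: lt_le_trans h2 M.
  move=> /andP[t2 t3]; apply: truncn_def; suff -> : turn x = t by apply/andP.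
  have [i ti] : exists i : int, turn x = t + i%:~R.
    rewrite /turn /t; case: ifP => _; [exists (1 - j)|exists (- j)];
      by rewrite ?rmorphB ?rmorphN /=; lra.
  have : (-1)%:~R < (i%:~R : R) < 1%:~R by rewrite rmorphN /=; lra.
  rewrite !ltr_int ti => /andP[? ?]; have -> : i = 0 by exact: int_eq0.
  by rewrite addr0.
split=> //; have /andP[t0 t1] := turn_itv cx.
have tt : 0 <= 2 ^+ k * turn x by rewrite mulr_ge0// ltW.
have := truncn_itv tt; rewrite -/(node k x) mx -eqv /turn.
case: ifP => _ h; [exists 1|exists 0]; move: h; rewrite (shiftE x delta) ?mulr1z ?mulr0z ?addr0; exact.
Qed.

Lemma arc_circle k m : (m < 2 ^ k)%N -> dyadic_arc delta k m `<=` circle.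
Proof. by move=> mk x /(arcP _ mk)[]. Qed.

Lemma arc_node k x : circle x -> dyadic_arc delta k (node k x) x.
Proof. by move=> cx; apply/arcP => //; exact: node_lt. Qed.

Lemma arc00 : dyadic_arc delta 0 0 = circle.
Proof.
apply/seteqP; split => x; first by move/(arcP (k:=0) (m:=0) x erefl) => [].
move=> cx; apply/(arcP (k:=0) (m:=0) x erefl); split=> //.
by have := node_lt 0 cx; rewrite expn0; case: node.
Qed.

Lemma arc_split k m : (m < 2 ^ k)%N -> dyadic_arc delta k m =
  dyadic_arc delta k.+1 m.*2 `|` dyadic_arc delta k.+1 m.*2.+1.
Proof.
move=> mk; have [m1 m2] : (m.*2 < 2 ^ k.+1)%N /\ (m.*2.+1 < 2 ^ k.+1)%N.
  by rewrite expnS; lia.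
apply/seteqP; split => x.
  move=> /(arcP _ mk)[cx nx].
  have := nodeS k cx; rewrite nx => h; have := odd_double_half (node k.+1 x).
  by rewrite h; case: odd => e; [right|left]; apply/arcP.
case=> [/(arcP _ m1)|/(arcP _ m2)] [cx nx]; apply/(arcP _ mk); split=> //;
  rewrite -(nodeS k cx) nx; [exact: doubleK|exact: half_doubleS].
Qed.

Lemma arc_disj k m n : (m < 2 ^ k)%N -> (n < 2 ^ k)%N -> m != n ->
  [disjoint dyadic_arc delta k m & dyadic_arc delta k n].
Proof.
move=> mk nk /eqP mn; rewrite disj_set2E; apply/eqP/seteqP; split=> x //.
by case=> /(arcP _ mk)[_ e1] /(arcP _ nk)[_ e2]; apply: mn; rewrite -e1.
Qed.

(** The endpoints satisfy [0 <= a] and [b < 4 pi], so only the translates [j = 0] and [j = 1] meet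
    the fundamental domain: the part of the arc below [2 pi] and the part that wraps around. Either
    may be empty. *)
Let arcE k m : (m < 2 ^ k)%N ->
  let a := 2 * pi * (m%:R / 2 ^+ k + delta) in
  let b := 2 * pi * (m.+1%:R / 2 ^+ k + delta) in
  dyadic_arc delta k m = `[a, Num.min b (2 * pi)[ `|`
     `[Num.max (a - 2 * pi) 0, b - 2 * pi[.
Proof.
move=> mk a b; have k0 : 0 < 2 ^+ k :> R by rewrite exprn_gt0.
have M : (m.+1%:R : R) / 2 ^+ k <= 1 by rewrite ler_pdivrMr// mul1r -natrX ler_nat.
have M0 : 0 <= (m%:R : R) / 2 ^+ k by rewrite divr_ge0// ltW.
have /andP[d0 d1] := hdelta.
have a0 : 0 <= a by rewrite mulr_ge0 ?addr_ge0 ?(ltW p0).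
have b2 : b < 2 * (2 * pi).
  by rewrite /b [ltRHS]mulrC ltr_pM2l//; lra.
apply/seteqP; split => x.
  move=> [/circleP/andP[x0 x1] [j /andP[]]]; rewrite -/a -/b => h1 h2.
  have : (-1)%:~R < (j%:~R : R) < 2%:~R.
    rewrite rmorphN /= -(ltr_pM2l p0) -(ltr_pM2l p0 j%:~R).
    by apply/andP; split; lra.
  rewrite !ltr_int => /andP[j0 j1].
  have [j2|j2] := int_eq01 j0 j1.
    left; rewrite j2 mulr0 addr0 in h1 h2.
    by rewrite /= in_itv /= lt_min h1 h2.
  right; rewrite j2 mulr1 in h1 h2; rewrite /= in_itv /= ge_max x0 andbT.
  by apply/andP; split; lra.
case; rewrite /= in_itv /= => /andP[].
  rewrite lt_min => h1 /andP[h2 h3]; split; first by apply/circleP/andP; split => //; lra.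
  by exists 0; rewrite mulr0 addr0; apply/andP.
rewrite ge_max => /andP[h1 h2] h3; split; first by apply/circleP/andP; split => //; lra.
by exists 1; rewrite mulr1 -/a -/b; apply/andP; split; lra.
Qed.

Lemma measurable_arc k m : (m < 2 ^ k)%N ->
  @measurable _ (measurableTypeR R) (dyadic_arc delta k m).
Proof. by move=> mk; rewrite arcE//; exact: measurableU. Qed.

Let mu_co (a b : R) : mu `[a, b[ = (if a < b then b - a else 0)%:E.
Proof. by rewrite lebesgue_measure_itv/= lte_fin; case: ltP. Qed.

(** Additivity of length for an arc that stays inside the period [L], straddles its end, or lies
    wholly beyond it. *)
Let wrapped_length (a b L : R) : 0 <= a -> 0 < b - a -> b < 2 * L ->
  (if (a < b) && (a < L) then Num.min b L - a else 0) +
  (if (a - L < b - L) && (0 < b - L) then b - L - Num.max (a - L) 0 else 0) = b - a.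
Proof.
move=> a0 ba b2; rewrite ltrD2r -(subr_gt0 a b) ba /=.
by case: (leP b L) => ?; case: (leP (a - L) 0) => ?; case: (ltP a L) => ?;
  case: (ltP 0 (b - L)) => ? /=; lra.
Qed.

Lemma measure_arc k m : (m < 2 ^ k)%N ->
  mu (dyadic_arc delta k m) = (2 * pi / 2 ^+ k)%:E.
Proof.
move=> mk; rewrite arcE//.
have k0 : 0 < 2 ^+ k :> R by rewrite exprn_gt0.
have M : (m.+1%:R : R) / 2 ^+ k <= 1 by rewrite ler_pdivrMr// mul1r -natrX ler_nat.
have M0 : 0 <= (m%:R : R) / 2 ^+ k by rewrite divr_ge0// ltW.
have /andP[d0 d1] := hdelta.
set a := 2 * pi * (m%:R / _ + _); set b := 2 * pi * _.
have ba : b - a = 2 * pi / 2 ^+ k.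
  by rewrite /a /b -natr1; field; rewrite gt_eqF.
have ba0 : 0 < b - a by rewrite ba divr_gt0.
have ba1 : b - a <= 2 * pi.
  by rewrite /b /a -mulrBr -[leRHS]mulr1 ler_pM2l//; lra.
have a0 : 0 <= a by rewrite mulr_ge0 ?addr_ge0 ?(ltW p0).
have b2 : b < 2 * (2 * pi).
  by rewrite /b [ltRHS]mulrC ltr_pM2l//; lra.
rewrite measureU//; last first.
  apply/seteqP; split => x //= []; rewrite !in_itv/= lt_min ge_max => /andP[? /andP[? ?]].
  by move=> /andP[/andP[? ?] ?]; lra.
apply: eq_trans (congr2 _ (mu_co _ _) (mu_co _ _)) _; rewrite -EFinD -ba.
by congr EFin; rewrite lt_min gt_max; exact: wrapped_length.
Qed.

End Arcs.

Lemma arc_children k m : (m < 2 ^ k)%N ->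
  (m.*2 < 2 ^ k.+1)%N /\ (m.*2.+1 < 2 ^ k.+1)%N.
Proof. by rewrite expnS; lia. Qed.

(** * Integrability on the circle *)

Section CircleIntegrals.
Context {R : realType}.
Implicit Types (x c M : R) (f g h : R -> R).
Local Notation mu := (@lebesgue_measure R).
Local Notation mint h := (mu.-integrable circle (fun x => (h x)%:E)).

Definition len k : R := 2 * pi / 2 ^+ k.

Lemma len_gt0 k : 0 < len k.
Proof. by rewrite divr_gt0 ?mulr_gt0 ?pi_gt0 ?exprn_gt0. Qed.

Lemma lenS k : len k = 2 * len k.+1.
Proof.
by rewrite /len exprS invfM; move: (2 * pi) => p; field; rewrite expf_neq0.
Qed.

Lemma measurable_circle : @measurable _ (measurableTypeR R) circle.
Proof. exact: measurable_itv. Qed.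

Hint Resolve measurable_circle : core.

Lemma measure_circle : mu circle = (2 * pi)%:E.
Proof.
by rewrite /circle lebesgue_measure_itv/= lte_fin mulr_gt0 ?pi_gt0// sube0.
Qed.

Lemma mint_cst c : mint (fun=> c).
Proof.
apply/integrableP; split; first exact: measurable_cst.
rewrite integral_cst ?measurable_circle//= measure_circle -EFinM.
exact: ltry.
Qed.

Lemma mint_meas h : mint h -> measurable_fun circle h.
Proof. by move=> /(measurable_int mu)/measurable_EFinP. Qed.

Lemma mintD h g : mint h -> mint g -> mint (fun x => h x + g x).
Proof.
by move=> ih ig; have := integrableD measurable_circle ih ig; under eq_fun do rewrite -EFinD.
Qed.

Lemma mintZ c h : mint h -> mint (fun x => c * h x).
Proof.
by move=> ih; have := integrableZl measurable_circle c ih; under eq_fun do rewrite -EFinM.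
Qed.

Lemma mint_le h g : measurable_fun circle h -> mint g ->
  (forall x, circle x -> `|h x| <= g x) -> mint h.
Proof.
move=> mh ig hg; apply: le_integrable ig => //; first exact/measurable_EFinP.
by move=> x cx /=; rewrite lee_fin (le_trans (hg _ cx))// ler_norm.
Qed.

Lemma mint_norm h : mint h -> mint (fun x => `|h x|).
Proof. by move=> ih; exact: integrable_norm ih. Qed.

Lemma mint_mulb f h M : measurable_fun circle f ->
  (forall x, circle x -> `|f x| <= M) -> mint h -> mint (fun x => f x * h x).
Proof.
move=> mf fM ih; apply: (@mint_le _ (fun x => M * `|h x|)).
- by apply: measurable_funM => //; exact: mint_meas.
- by apply: mintZ; exact: mint_norm.
- by move=> x cx; rewrite normrM ler_wpM2r// fM.
Qed.

Definition sqint h : Prop := mint h /\ mint (fun x => h x ^+ 2).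

Lemma sqint_shift h c : sqint h -> mint (fun x => (h x - c) ^+ 2).
Proof.
move=> [ih ih2]; have := mintD (mintD ih2 (mintZ (- 2 * c) ih)) (mint_cst (c ^+ 2)).
by apply: eq_integrable => // x _ /=; congr EFin; lra.
Qed.

End CircleIntegrals.

(** * Means and variances over dyadic arcs *)

Section ArcMeans.
Context {R : realType}.
Variable delta : R.
Hypothesis hdelta : 0 <= delta < 1.
Implicit Types (x y c M : R) (f g h : R -> R) (F : nat -> R).
Local Notation mu := (@lebesgue_measure R).
Local Notation arc := (dyadic_arc delta).
Local Notation mint h := (mu.-integrable circle (fun x => (h x)%:E)).
Local Notation node := (node delta).
Let measurable_circle' := @measurable_circle R.
Hint Resolve measurable_circle' : core.

Definition mean h k m : R := (\int[mu]_(x in arc k m) h x) / len k.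


Lemma fine_measure_arc k m : (m < 2 ^ k)%N -> fine (mu (arc k m)) = len k.
Proof. by move=> mk; rewrite measure_arc. Qed.

Lemma mint_arc h k m : (m < 2 ^ k)%N -> mint h ->
  mu.-integrable (arc k m) (EFin \o h).
Proof.
move=> mk; apply: integrableS => //; first exact: measurable_arc.
exact: arc_circle.
Qed.

Lemma mean_split h k m : mint h -> (m < 2 ^ k)%N ->
  mean h k.+1 m.*2 + mean h k.+1 m.*2.+1 = 2 * mean h k m.
Proof.
move=> ih mk; have [m1 m2] := arc_children mk.
rewrite /mean -mulrDl (arc_split hdelta mk) Rintegral_setU //; last first.
- by apply: arc_disj => //; apply/eqP; lia.
- by rewrite -(arc_split hdelta mk); exact: mint_arc.
- exact: measurable_arc.
- exact: measurable_arc.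
rewrite (lenS k); move: (_ + _) (len (R := R) k.+1) (len_gt0 (R := R) k.+1) => r l l0.
by field; rewrite gt_eqF.
Qed.

Lemma tavg_mean h N : mint h -> tavg N (mean h N) = mean h 0 0.
Proof.
move=> ih; elim: N => [|N <-]; first by rewrite tavg0.
rewrite tavgS /tavg; congr (_ * _); apply: eq_bigr => i _.
by rewrite mean_split// mulrC mulKf.
Qed.

Lemma mean_circle h : mean h 0 0 = (\int[mu]_(x in circle) h x) / (2 * pi).
Proof. by rewrite /mean (arc00 hdelta) /len expr0 divr1. Qed.

Lemma Rint_circle h N : mint h ->
  \int[mu]_(x in circle) h x = 2 * pi * tavg N (mean h N).
Proof.
by move=> ih; rewrite tavg_mean// mean_circle mulrC divfK// gt_eqF ?mulr_gt0 ?pi_gt0.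
Qed.

Lemma eq_mean h g k m : (forall x, arc k m x -> h x = g x) ->
  mean h k m = mean g k m.
Proof.
by move=> hg; rewrite /mean; congr (_ / _); apply: eq_Rintegral => x; rewrite inE => /hg.
Qed.

Lemma meanD h g k m : (m < 2 ^ k)%N -> mint h -> mint g ->
  mean (fun x => h x + g x) k m = mean h k m + mean g k m.
Proof.
move=> mk ih ig; rewrite /mean -mulrDl; congr (_ / _).
by rewrite RintegralD//; [exact: measurable_arc|exact: mint_arc|exact: mint_arc].
Qed.

Lemma meanZ c h k m : (m < 2 ^ k)%N -> mint h ->
  mean (fun x => c * h x) k m = c * mean h k m.
Proof.
move=> mk ih; rewrite /mean mulrA; congr (_ / _).
by rewrite RintegralZl//; [exact: measurable_arc|exact: mint_arc].
Qed.

Lemma mean_cst c k m : (m < 2 ^ k)%N -> mean (fun=> c) k m = c.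
Proof.
move=> mk; rewrite /mean Rintegral_cst; last exact: measurable_arc.
by rewrite fine_measure_arc// mulfK// gt_eqF ?len_gt0.
Qed.

Lemma mean_le h g k m : (m < 2 ^ k)%N -> mint h -> mint g ->
  (forall x, arc k m x -> h x <= g x) -> mean h k m <= mean g k m.
Proof.
move=> mk ih ig hg; rewrite /mean ler_pM2r ?invr_gt0 ?len_gt0//.
by apply: le_Rintegral => //; [exact: measurable_arc|exact: mint_arc|exact: mint_arc].
Qed.

Lemma measurable_node d (T : measurableType d) (G : nat -> T) N :
  measurable_fun circle (fun x => G (node N x)).
Proof.
move=> _ Y mY.
have -> : circle `&` (fun x => G (node N x)) @^-1` Y =
    \bigcup_(m in [set m | (m < 2 ^ N)%N /\ Y (G m)]) arc N m.
  apply/seteqP; split => x.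
    move=> [cx Yx]; exists (node N x); last exact: arc_node.
    by split => //; exact: node_lt.
  by move=> [m /= [mN Ym]] /(arcP hdelta _ mN)[cx nx]; split; rewrite //= nx.
by apply: bigcup_measurable => m [mN _]; exact: measurable_arc.
Qed.

Lemma node_bound F N : exists M, forall x, circle x -> `|F (node N x)| <= M.
Proof.
exists (\sum_(m < 2 ^ N) `|F m|) => x cx.
have nN := node_lt hdelta N cx.
by rewrite (bigD1 (Ordinal nN))//= lerDl sumr_ge0.
Qed.

Lemma mint_node F h N : mint h -> mint (fun x => F (node N x) * h x).
Proof.
move=> ih; have [M FM] := node_bound F N.
exact: mint_mulb (measurable_node _ _) FM ih.
Qed.

Lemma mean_node F h N m : (m < 2 ^ N)%N -> mint h ->
  mean (fun x => F (node N x) * h x) N m = F m * mean h N m.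
Proof.
move=> mN ih; rewrite -meanZ//; apply: eq_mean => x /(arcP hdelta _ mN)[_ ->] //.
Qed.

(** The bridge between the circle and the tree: against a function of the node, only the means of
    [h] over the arcs of generation [N] matter. *)
Lemma Rint_node F h N : mint h ->
  \int[mu]_(x in circle) (F (node N x) * h x) =
  2 * pi * tavg N (fun m => F m * mean h N m).
Proof.
move=> ih; rewrite (Rint_circle N) ?mint_node//; congr (_ * _).
by rewrite /tavg; congr (_ * _); apply: eq_bigr => i _; rewrite mean_node.
Qed.

Lemma integral_node F N : (forall m, (m < 2 ^ N)%N -> 0 <= F m) ->
  (\int[mu]_(x in circle) (F (node N x))%:E = (2 * pi * tavg N F)%:E)%E.
Proof.
move=> F0; have iF : mint (fun x => F (node N x)).
  by have := mint_node F N (mint_cst 1); under eq_fun do rewrite mulr1.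
rewrite -[LHS]fineK; last by apply: integrable_fin_num.
congr EFin; rewrite -[LHS]/(\int[mu]_(x in circle) (F (node N x)))%R.
have := Rint_node F N (mint_cst 1).
under eq_Rintegral do rewrite mulr1.
move=> ->; congr (_ * _); rewrite /tavg; congr (_ * _).
by apply: eq_bigr => i _; rewrite mean_cst// mulr1.
Qed.

Definition var h k m : R := mean (fun x => h x ^+ 2) k m - mean h k m ^+ 2.

Lemma mean_shift_sqr h c k m : sqint h -> (m < 2 ^ k)%N ->
  mean (fun x => (h x - c) ^+ 2) k m = var h k m + (mean h k m - c) ^+ 2.
Proof.
move=> [ih ih2] mk.
rewrite (@eq_mean _ (fun x => (h x ^+ 2 + (- 2 * c) * h x) + c ^+ 2)); last by move=> x _; lra.
have i1 := mintZ (- 2 * c) ih; have i2 := mintD ih2 i1.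
have i3 := mint_cst (c ^+ 2).
by rewrite !meanD ?meanZ ?mean_cst ?/var//; [lra|exact: mint_cst].
Qed.

Lemma var_ge0 h k m : sqint h -> (m < 2 ^ k)%N -> 0 <= var h k m.
Proof.
move=> sh mk; have := mean_shift_sqr (mean h k m) sh mk.
rewrite subrr expr0n addr0 => <-; rewrite -(mean_cst 0 mk).
by apply: mean_le => //; [exact: mint_cst|exact: sqint_shift|move=> x _; exact: sqr_ge0].
Qed.

(** The law of total variance. It makes the variance an admissible potential [A] in the tree
    inequalities. *)
Lemma var_split h k m : sqint h -> (m < 2 ^ k)%N ->
  2 * (mean h k.+1 m.*2 - mean h k m) ^+ 2 + (var h k.+1 m.*2 + var h k.+1 m.*2.+1)
    = 2 * var h k m.
Proof.
move=> [ih ih2] mk; rewrite /var.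
have e1 := mean_split ih mk; have e2 := mean_split ih2 mk.
have -> : mean h k.+1 m.*2.+1 = 2 * mean h k m - mean h k.+1 m.*2 by lra.
by lra.
Qed.

End ArcMeans.

(** * Martingale of a complex function and its square function *)


Section ComplexNorm.
Context {R : realType}.
Implicit Types (z w : R[i]).

Lemma normc_ge0 z : 0 <= normc z.
Proof. by case: z => a b; exact: sqrtr_ge0. Qed.

Lemma normc_real (a : R) : normc a%:C%C = `|a|.
Proof. by rewrite /normc/= expr0n addr0 sqrtr_sqr. Qed.

Lemma sqr_normcE z : normc z ^+ 2 = complex.Re z ^+ 2 + complex.Im z ^+ 2.
Proof. by case: z => a b /=; rewrite sqr_sqrtr// addr_ge0 ?sqr_ge0. Qed.

Lemma normc_geRe z : `|complex.Re z| <= normc z.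
Proof. by case: z => a b /=; rewrite -sqrtr_sqr ler_wsqrtr// lerDl sqr_ge0. Qed.

Lemma normc_geIm z : `|complex.Im z| <= normc z.
Proof. by case: z => a b /=; rewrite -sqrtr_sqr ler_wsqrtr// lerDr sqr_ge0. Qed.

Lemma normc_leD z : normc z <= `|complex.Re z| + `|complex.Im z|.
Proof.
case: z => a b /=; rewrite -[leRHS]ger0_norm ?addr_ge0// -sqrtr_sqr ler_wsqrtr//.
have E (t : R) : t ^+ 2 = `|t| ^+ 2 by rewrite -normrX ger0_norm ?sqr_ge0.
by rewrite (E a) (E b) sqrrD -addrA [_ *+ 2 + _]addrC addrA lerDl mulrn_wge0 ?mulr_ge0.
Qed.

Lemma cReD z w : complex.Re (z + w) = complex.Re z + complex.Re w.
Proof. by case: z; case: w. Qed.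

Lemma cImD z w : complex.Im (z + w) = complex.Im z + complex.Im w.
Proof. by case: z; case: w. Qed.

Lemma cReM z w : complex.Re (z * w) =
  complex.Re z * complex.Re w - complex.Im z * complex.Im w.
Proof. by case: z; case: w. Qed.

Lemma cImM z w : complex.Im (z * w) =
  complex.Re z * complex.Im w + complex.Im z * complex.Re w.
Proof. by case: z; case: w. Qed.

Lemma cReN z : complex.Re (- z) = - complex.Re z. Proof. by case: z. Qed.
Lemma cImN z : complex.Im (- z) = - complex.Im z. Proof. by case: z. Qed.

Lemma cReZ (a : R) z : complex.Re (a%:C%C * z) = a * complex.Re z.
Proof. by case: z => b c; rewrite /= mul0r subr0. Qed.

Lemma cImZ (a : R) z : complex.Im (a%:C%C * z) = a * complex.Im z.
Proof. by case: z => b c; rewrite /= mul0r addr0. Qed.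

Lemma complexP z w : complex.Re z = complex.Re w -> complex.Im z = complex.Im w ->
  z = w.
Proof. by case: z => a b; case: w => c d /= -> ->. Qed.

End ComplexNorm.

(** * Haar coefficients as martingale jumps *)

Section ComplexMeans.
Context {R : realType}.
Variable delta : R.
Hypothesis hdelta : 0 <= delta < 1.
Implicit Types (x y c M : R) (f g h : R -> R[i]) (d : nat -> nat -> R[i]).
Local Notation mu := (@lebesgue_measure R).
Local Notation arc := (dyadic_arc delta).
Local Notation mint h := (mu.-integrable circle (fun x => (h x)%:E)).
Local Notation node := (node delta).
Local Notation mean := (mean delta).

Definition cmean f k m : R[i] :=
  Complex (mean (fun x => complex.Re (f x)) k m)
          (mean (fun x => complex.Im (f x)) k m).

(** The jump towards the left half. By [cdel_right] the other jump is its opposite, so one complex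
    number per arc carries the martingale. *)
Definition cdel f k m : R[i] := cmean f k.+1 m.*2 - cmean f k m.

Lemma cmean_split f k m : inL1 f -> (m < 2 ^ k)%N ->
  cmean f k.+1 m.*2 + cmean f k.+1 m.*2.+1 = 2%:R * cmean f k m.
Proof.
move=> [f1 f2] mk; have e1 := mean_split hdelta f1 mk; have e2 := mean_split hdelta f2 mk.
by apply: complexP; rewrite ?cReD ?cImD ?cReM ?cImM /= ?e1 ?e2 !(mul0r, addr0, subr0);
  congr (_ * _); rewrite addr0.
Qed.

Lemma cdel_right f k m : inL1 f -> (m < 2 ^ k)%N ->
  cmean f k.+1 m.*2.+1 = cmean f k m - cdel f k m.
Proof.
move=> L1f mk; have := cmean_split L1f mk => e.
by rewrite /cdel opprB addrA -(mulr2n (cmean f k m)) -mulr_natl -e addrAC subrr add0r.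
Qed.

Lemma cmean_left f k m : cmean f k.+1 m.*2 = cmean f k m + cdel f k m.
Proof. by rewrite addrC subrK. Qed.

Lemma inL1_lin (a : R[i]) f g : inL1 f -> inL1 g -> inL1 (fun x => a * f x + g x).
Proof.
move=> [f1 f2] [g1 g2]; split.
  have := mintD (mintD (mintZ (complex.Re a) f1) (mintZ (- complex.Im a) f2)) g1.
  by apply: eq_integrable => [|x _]; [exact: measurable_circle|
    rewrite cReD cReM mulNr].
have := mintD (mintD (mintZ (complex.Re a) f2) (mintZ (complex.Im a) f1)) g2.
by apply: eq_integrable => [|x _]; [exact: measurable_circle|rewrite cImD cImM].
Qed.

Lemma cmean_lin (a : R[i]) f g k m : (m < 2 ^ k)%N -> inL1 f -> inL1 g ->
  cmean (fun x => a * f x + g x) k m = a * cmean f k m + cmean g k m.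
Proof.
move=> mk [f1 f2] [g1 g2]; apply: complexP; rewrite ?cReD ?cReM ?cImD ?cImM /=.
  rewrite (@eq_mean _ delta _ (fun x => complex.Re a * complex.Re (f x) +
    - complex.Im a * complex.Im (f x) + complex.Re (g x))); last first.
    by move=> x _; rewrite cReD cReM mulNr.
  have i1 := mintZ (complex.Re a) f1; have i2 := mintZ (- complex.Im a) f2.
  by rewrite !meanD ?meanZ ?mulNr//; exact: mintD.
rewrite (@eq_mean _ delta _ (fun x => complex.Re a * complex.Im (f x) +
    complex.Im a * complex.Re (f x) + complex.Im (g x))); last first.
  by move=> x _; rewrite cImD cImM.
have i1 := mintZ (complex.Re a) f2; have i2 := mintZ (complex.Im a) f1.
by rewrite !meanD ?meanZ//; exact: mintD.
Qed.

Lemma cdel_lin (a : R[i]) f g k m : (m < 2 ^ k)%N -> inL1 f -> inL1 g ->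
  cdel (fun x => a * f x + g x) k m = a * cdel f k m + cdel g k m.
Proof.
move=> mk L1f L1g; have [m1 _] := arc_children mk.
by rewrite /cdel !cmean_lin//; ring.
Qed.

Lemma arc_lenE (I : dyadic) : arc_len delta I = len (tag I).
Proof.
case: I => k i; rewrite /arc_len /haar_arc/= fine_measure_arc//.
Qed.

Lemma haarE (I : dyadic) x : circle x -> haar delta I x =
  (Num.sqrt (len (tag I)))^-1 *
  ((node (tag I).+1 x == (tagged I).*2)%:R - (node (tag I).+1 x == (tagged I).*2.+1)%:R).
Proof.
case: I => k i cx; rewrite /haar arc_lenE /=; have [m1 m2] := arc_children (ltn_ord i).
have E j : (j < 2 ^ k.+1)%N ->
    \1_(dyadic_arc delta k.+1 j) x = (node k.+1 x == j)%:R :> R.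
  move=> jk; rewrite indicE; congr (_%:R); congr nat_of_bool.
  by apply/idP/eqP; rewrite inE; [move/(arcP hdelta _ jk) => []|
     move=> e; apply/(arcP hdelta _ jk)].
by rewrite /arc_left /arc_right /= mul2n !E.
Qed.

Lemma sum_pick n (G : nat -> R) a : (a < n)%N ->
  \sum_(j < n) (j == a :> nat)%:R * G j = G a.
Proof.
move=> an; rewrite (bigD1 (Ordinal an))//= eqxx mul1r big1 ?addr0// => i ia.
by rewrite (_ : (i == a :> nat) = false) ?mul0r//; apply/negbTE.
Qed.

Lemma Rint_haar (h : R -> R) (I : dyadic) : mint h ->
  \int[mu]_(x in circle) (h x * haar delta I x) =
  Num.sqrt (len (tag I)) * (mean h (tag I).+1 (tagged I).*2 - mean h (tag I) (tagged I)).
Proof.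
case: I => k i /= ih; have [m1 m2] := arc_children (ltn_ord i).
pose F (j : nat) : R := (Num.sqrt (len k))^-1 * ((j == i.*2)%:R - (j == i.*2.+1)%:R).
transitivity (\int[mu]_(x in circle) (F (node k.+1 x) * h x)).
  by apply: eq_Rintegral => x; rewrite inE => cx; rewrite haarE// mulrC.
rewrite Rint_node// /tavg /F.
under eq_bigr do rewrite -mulrA mulrBl.
rewrite -mulr_sumr sumrB !sum_pick//.
have l0 := len_gt0 (R := R) k; have sl := sqr_sqrtr (ltW l0).
have : 2 * pi * (2 ^+ k.+1)^-1 = len k / 2 :> R.
  by rewrite /len exprS; move: (2 * pi) => p; field; rewrite expf_neq0.
move=> pk; rewrite [LHS]mulrA pk -{1}sl; move: (mean_split hdelta ih (ltn_ord i)).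
have : 0 < Num.sqrt (len (R := R) k) by rewrite sqrtr_gt0.
move: (Num.sqrt _) (mean h k i) (mean h k.+1 i.*2) (mean h k.+1 i.*2.+1).
move=> s a b c e s0; have -> : c = 2 * a - b by lra.
by field; rewrite gt_eqF.
Qed.

(* The collection with mean [c] and Haar coefficients [|I|^(1/2) d_I], so that
   its partial sums jump by [+- d_I] when passing from [I] to its halves. *)
Definition tree_coll (c : R[i]) d : collection R :=
  Collection c (fun I => (Num.sqrt (len (tag I)))%:C%C * d (tag I) (tagged I)).

Lemma coefs_ofE f : inL1 f -> coefs_of delta f = tree_coll (cmean f 0 0) (cdel f).
Proof.
move=> [f1 f2]; rewrite /coefs_of /tree_coll; congr Collection.
  by apply: complexP; rewrite /= mul0r ?subr0 ?addr0 mean_circle// mulrC.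
apply/funext => I; apply: complexP.
  rewrite [RHS]cReZ cReD cReN -Rint_haar//; apply: eq_Rintegral => x _.
  by rewrite mulrC cReZ mulrC.
rewrite [RHS]cImZ cImD cImN -Rint_haar//; apply: eq_Rintegral => x _.
by rewrite mulrC cImZ mulrC.
Qed.

Lemma rsum_node (d : nat -> nat -> R) N x : circle x ->
  rsum d N (node N x) = \sum_(k < N) d k (node k x).
Proof.
move=> cx; elim: N => [|N IH]; first by rewrite big_ord0.
by rewrite rsumS nodeS// IH big_ord_recr.
Qed.

Definition qsum d N m : R := rsum (fun k m => normc (d k m) ^+ 2) N m.

Lemma qsum_ge0 d N m : (m < 2 ^ N)%N -> 0 <= qsum d N m.
Proof. by apply: rsum_ge0 => *; exact: sqr_ge0. Qed.

Lemma qsum_incr d x : circle x ->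
  {homo (fun N => qsum d N (node N x)) : a b / (a <= b)%N >-> a <= b}.
Proof.
move=> cx; apply: homo_leq => [//|a b c|n]; first exact: le_trans.
by rewrite /qsum rsumS nodeS// lerDl sqr_ge0.
Qed.

(** Exactly one arc of each generation contains [x], so the sum over all dyadic arcs is a series
    along the path of [x]; the factor [|I|] in the squared coefficient cancels the weight
    [1 / |I|]. *)
Lemma square_fun_series (c : R[i]) d x : circle x ->
  square_fun delta (tree_coll c d) x =
  ((normc c)%:E + sqrte (\sum_(k <oo) (normc (d k (node k x)) ^+ 2)%:E))%E.
Proof.
move=> cx; rewrite /square_fun; congr (_ + sqrte _)%E.
pose e k : dyadic := existT _ k (Ordinal (node_lt hdelta k cx)).
have bij : set_bij [set: nat] (range e) e.
  by split => [n _|k l _ _ [] //|I [k _ <-]]; exists n || exists k.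
rewrite nneseries_esumT; last by move=> n; rewrite lee_fin sqr_ge0.
transitivity (\esum_(I in range e) (normc (d (tag I) (tagged I)) ^+ 2)%:E).
  rewrite [RHS]esum_mkcond; apply: eq_esum => I _.
  rewrite indicE; case: ifPn => [/set_mem [k _ <-]|nI] /=.
    rewrite mem_set; last by rewrite /haar_arc; exact: arc_node.
    rewrite arc_lenE /= normcM normc_real ger0_norm// exprMn sqr_sqrtr ?(ltW (len_gt0 _))//.
    by rewrite mulr1 mulrAC divff ?mul1r// gt_eqF ?len_gt0.
  rewrite memNset ?mulr0 ?mul0r// => hI; move/negP: nI; apply; apply/mem_set.
  move: I hI => [k i]; rewrite /haar_arc/= => /(arcP hdelta _ (ltn_ord i))[_ ki].
  by exists k => //; congr existT; apply: val_inj.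
by rewrite (reindex_esum _ _ _ _ bij).
Qed.

(** An increasing limit, possibly [+oo]. Through it the square function is measurable and bounds on
    its truncations pass to it by monotone convergence. *)
Lemma square_fun_cvg (c : R[i]) d x : circle x ->
  (fun N => (normc c + Num.sqrt (qsum d N (node N x)))%:E) @ \oo -->
  square_fun delta (tree_coll c d) x.
Proof.
move=> cx; rewrite square_fun_series//.
set Q := (\sum_(k <oo) _)%E.
have QE N : ((qsum d N (node N x))%:E <= Q)%E.
  rewrite /qsum rsum_node// -sumEFin.
  rewrite -(big_mkord xpredT (fun k => (normc (d k (node k x)) ^+ 2)%:E)).
  by apply: nneseries_lim_ge => *; rewrite lee_fin sqr_ge0.
have Q0 : (0 <= Q)%E by apply: nneseries_ge0 => *; rewrite lee_fin sqr_ge0.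
have nd : {homo (fun N => (normc c + Num.sqrt (qsum d N (node N x)))%:E) :
    a b / (a <= b)%N >-> (a <= b)%E}.
  by move=> a b ab; rewrite lee_fin lerD2l ler_wsqrtr// qsum_incr.
suff -> : ((normc c)%:E + sqrte Q = ereal_sup (range
    (fun N => (normc c + Num.sqrt (qsum d N (node N x)))%:E)))%E.
  exact: ereal_nondecreasing_cvgn.
apply/eqP; rewrite eq_le; apply/andP; split; last first.
  apply: ge_ereal_sup => _ [N _ <-]; rewrite EFinD leeD2l//.
  by rewrite -[leLHS]/(sqrte (qsum d N (node N x))%:E) lee_sqrt.
set s := ereal_sup _; have sup N : ((normc c + Num.sqrt (qsum d N (node N x)))%:E <= s)%E.
  by apply: ereal_sup_ubound; exists N.
case: s sup => [s||] sup; [|by rewrite leey|by have := sup 0].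
have {}sup N : normc c + Num.sqrt (qsum d N (node N x)) <= s by rewrite -lee_fin.
have cs : 0 <= s - normc c.
  by have := sup 0; have := sqrtr_ge0 (qsum d 0 (node 0 x)); lra.
have : (Q <= ((s - normc c) ^+ 2)%:E)%E.
  apply: lime_le; first by apply: is_cvg_nneseries => *; rewrite lee_fin sqr_ge0.
  apply: nearW => N; rewrite big_mkord sumEFin -(rsum_node (fun k m => normc (d k m) ^+ 2))// lee_fin -/(qsum d N (node N x)).
  rewrite -[leLHS]sqr_sqrtr ?qsum_ge0 ?node_lt// ler_sqr ?nnegrE//.
  by have := sup N; lra.
have s0 : (0 <= ((s - normc c) ^+ 2)%:E)%E by rewrite lee_fin sqr_ge0.
rewrite -(lee_sqrt _ s0).
rewrite /= sqrtr_sqr ger0_norm// => h.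
by apply: le_trans (leeD2l _ h) _; rewrite -EFinD lee_fin; lra.
Qed.

Lemma measurable_square_fun (c : R[i]) d :
  measurable_fun circle (square_fun delta (tree_coll c d)).
Proof.
apply: (emeasurable_fun_cvg (fun N x =>
  (normc c + Num.sqrt (qsum d N (node N x)))%:E)) => [N|x cx].
  exact: (measurable_node hdelta (fun m => (normc c + Num.sqrt (qsum d N m))%:E)).
exact: square_fun_cvg.
Qed.

Lemma square_fun_ge (c : R[i]) d N x : circle x ->
  ((normc c + Num.sqrt (qsum d N (node N x)))%:E <=
    square_fun delta (tree_coll c d) x)%E.
Proof.
move=> cx; rewrite square_fun_series// EFinD leeD2l//.
rewrite -[leLHS]/(sqrte (qsum d N (node N x))%:E) lee_sqrt.
  rewrite /qsum rsum_node// -sumEFin.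
  rewrite -(big_mkord xpredT (fun k => (normc (d k (node k x)) ^+ 2)%:E)).
  by apply: nneseries_lim_ge => *; rewrite lee_fin sqr_ge0.
by apply: nneseries_ge0 => *; rewrite lee_fin sqr_ge0.
Qed.

Lemma H1norm_ge f N : inL1 f ->
  ((2 * pi * (normc (cmean f 0 0) + tavg N (fun m => Num.sqrt (qsum (cdel f) N m))))%:E
     <= H1norm delta f)%E.
Proof.
move=> L1f; rewrite /H1norm coefs_ofE//.
rewrite -{1}(tavg_cst N (normc _)) -tavgD -(integral_node hdelta (N := N)); last first.
  by move=> m _; rewrite addr_ge0 ?normc_ge0 ?sqrtr_ge0.
apply: ge0_le_integral.
- exact: measurable_circle.
- by move=> x _; rewrite lee_fin addr_ge0 ?normc_ge0 ?sqrtr_ge0.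
- exact: (measurable_node hdelta (fun m =>
    (normc (cmean f 0 0) + Num.sqrt (qsum (cdel f) N m))%:E)).
- exact: measurable_square_fun.
- by move=> x cx; exact: square_fun_ge.
Qed.

End ComplexMeans.

(** * H^1-BMO duality *)

Section ComplexLimits.
Context {R : realType}.
Implicit Types (u v : nat -> R[i]) (l m : R[i]).

(** Convergence in the complex plane written with the real modulus, the form required by
    [is_iota]. *)
Definition ccvg u l : Prop := (fun N => normc (u N - l)) @ \oo --> (0 : R).

Lemma normc_subC (z w : R[i]) : normc (z - w) = normc (w - z).
Proof. by rewrite -opprB normcN. Qed.

Lemma squeeze0 (a b : nat -> R) : (forall n, 0 <= a n <= b n) ->
  b @ \oo --> (0 : R) -> a @ \oo --> (0 : R).
Proof.
move=> ab b0; apply: (squeeze_cvgr _ (cvg_cst (0 : R)) b0).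
exact: nearW.
Qed.

Lemma cvg_sub0 (a : nat -> R) (l : R) :
  (fun n => `|a n - l|) @ \oo --> (0 : R) <-> a @ \oo --> l.
Proof.
split=> [/norm_cvg0|] h.
  by apply/subr_cvg0.
by apply/norm_cvg0P/subr_cvg0.
Qed.

Lemma ccvgP u l : ccvg u l <->
  ((fun n => complex.Re (u n)) @ \oo --> complex.Re l) /\
  ((fun n => complex.Im (u n)) @ \oo --> complex.Im l).
Proof.
split=> [ul|[/cvg_sub0 h1 /cvg_sub0 h2]].
  split; apply/cvg_sub0; apply: squeeze0 ul => n; rewrite normr_ge0/=.
    by rewrite -cReN -cReD normc_geRe.
  by rewrite -cImN -cImD normc_geIm.
have h : (fun n => `|complex.Re (u n) - complex.Re l| +
    `|complex.Im (u n) - complex.Im l|) @ \oo --> (0 : R).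
  by have -> : 0 = 0 + 0 :> R; [rewrite addr0|exact: cvgD].
apply: squeeze0 h => n.
by rewrite normc_ge0 /= -!cReN -!cReD -cImN -cImD normc_leD.
Qed.

Lemma ccvg_lin (a : R[i]) u v l m : ccvg u l -> ccvg v m ->
  ccvg (fun n => a * u n + v n) (a * l + m).
Proof.
move=> ul vm.
have h : (fun n => normc a * normc (u n - l) + normc (v n - m)) @ \oo --> (0 : R).
  have -> : 0 = normc a * 0 + 0 :> R by rewrite mulr0 addr0.
  by apply: cvgD => //; apply: cvgM => //; exact: cvg_cst.
apply: squeeze0 h => n; rewrite normc_ge0 /=.
rewrite -normcM; apply: le_trans (le_normcD _ _).
by rewrite le_eqVlt; apply/orP; left; apply/eqP; congr normc; ring.
Qed.

Definition climn u : R[i] :=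
  Complex (limn (fun n => complex.Re (u n))) (limn (fun n => complex.Im (u n))).

Lemma climnE u l : ccvg u l -> climn u = l.
Proof.
by move=> /ccvgP[h1 h2]; apply: complexP => /=; exact: cvg_lim.
Qed.

Lemma ccvg_bound u l (K : R) : ccvg u l -> (forall n, normc (u n) <= K) ->
  normc l <= K.
Proof.
move=> ul uK; apply/ler_addgt0Pr => e e0.
have /cvgrPdist_lt/(_ _ e0)[n _ /(_ n (leqnn n))] := ul.
rewrite sub0r normrN ger0_norm ?normc_ge0// => h.
have -> : l = u n + (l - u n) by rewrite addrC subrK.
apply: le_trans (le_normcD _ _) _; rewrite lerD// normc_subC; exact: ltW.
Qed.

Lemma ccvg_sub u v l : ccvg u l -> (fun n => normc (u n - v n)) @ \oo --> (0 : R) ->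
  ccvg v l.
Proof.
move=> ul uv.
have h : (fun n => normc (v n - u n) + normc (u n - l)) @ \oo --> (0 : R).
  have -> : 0 = 0 + 0 :> R by rewrite addr0.
  by apply: cvgD => //; under eq_fun do rewrite normc_subC.
apply: squeeze0 h => n; rewrite normc_ge0 /=.
have -> : v n - l = (v n - u n) + (u n - l) by ring.
exact: le_normcD.
Qed.

Lemma rcvg_series (a : nat -> R) (e : nat -> R) (K : R) :
  (forall n, `|a n.+1 - a n| <= e n) ->
  (forall N, \sum_(n < N) e n <= K) -> exists l : R, a @ \oo --> l.
Proof.
move=> ae eK.
have : cvgn [normed series (fun n => a n.+1 - a n)].
  apply: nondecreasing_is_cvgn.
    by apply/nondecreasing_seqP => n; rewrite /normed_series_of seriesSr lerDl /= normr_ge0.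
  exists K => _ [N _ <-]; rewrite /normed_series_of /series/= big_mkord; apply: le_trans (eK N).
  by apply: ler_sum => i _.
move=> /normed_cvg h; exists (a 0%N + limn (series (fun n => a n.+1 - a n))).
have E : (fun n => a 0%N + series (fun n => a n.+1 - a n) n) = a.
  by apply/funext => n; rewrite /series/= telescope_sumr// addrC subrK.
rewrite -[X in X @ _]E; apply: cvgD; last exact: h.
exact: cvg_cst.
Qed.

Lemma ccvg_series u (e : nat -> R) (K : R) :
  (forall n, normc (u n.+1 - u n) <= e n) ->
  (forall N, \sum_(n < N) e n <= K) -> exists l, ccvg u l.
Proof.
move=> ue eK.
have [n|a ha] := rcvg_series (a := fun n => complex.Re (u n)) _ eK.
  by apply: le_trans (ue n); rewrite -cReN -cReD normc_geRe.
have [n|b hb] := rcvg_series (a := fun n => complex.Im (u n)) _ eK.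
  by apply: le_trans (ue n); rewrite -cImN -cImD normc_geIm.
by exists (Complex a b); apply/ccvgP.
Qed.

End ComplexLimits.

(** * Coefficient bounds and the pairing as a limit of finite sums *)

Section Coefficients.
Context {R : realType}.
Variable delta : R.
Hypothesis hdelta : 0 <= delta < 1.
Implicit Types (x y : R) (f g b : R -> R[i]) (F G : nat -> R[i]).
Local Notation mu := (@lebesgue_measure R).
Local Notation arc := (dyadic_arc delta).
Local Notation mint h := (mu.-integrable circle (fun x => (h x)%:E)).
Local Notation node := (node delta).
Local Notation mean := (mean delta).
Local Notation cmean := (cmean delta).
Local Notation cdel := (cdel delta).

Definition ctavg N F : R[i] :=
  Complex (tavg N (fun m => complex.Re (F m))) (tavg N (fun m => complex.Im (F m))).

Lemma ctavgE N F : ctavg N F = (((2 ^+ N)^-1)%:C%C : R[i]) * \sum_(m < 2 ^ N) F m.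
Proof.
have E (P : R[i] -> R) : P 0 = 0 -> (forall z w, P (z + w) = P z + P w) ->
    P (\sum_(m < 2 ^ N) F m) = \sum_(m < 2 ^ N) P (F m).
  by move=> P0 PD; rewrite (big_morph P PD P0).
by apply: complexP; rewrite ?cReZ ?cImZ ?(E (@complex.Re R)) ?(E (@complex.Im R))// => *;
  rewrite ?cReD ?cImD.
Qed.

Lemma normc_ctavg N F : normc (ctavg N F) <= tavg N (fun m => normc (F m)).
Proof.
rewrite ctavgE normcM normc_real ger0_norm ?invr_ge0 ?exprn_ge0//.
rewrite /tavg ler_wpM2l ?invr_ge0 ?exprn_ge0//.
elim/big_ind2 : _ => [|u v w t uv wt|//]; first by rewrite normc0.
by apply: le_trans (le_normcD _ _) _; exact: lerD.
Qed.

Lemma ctavgS N F : ctavg N.+1 F = ctavg N (fun m => (F m.*2 + F m.*2.+1) / 2%:R).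
Proof.
apply: complexP => /=; rewrite tavgS /tavg; congr (_ * _); apply: eq_bigr => i _.
  have -> : (2%:R : R[i])^-1 = (2^-1)%:C%C by rewrite fmorphV rmorph_nat.
  by rewrite mulrC [in RHS]mulrC cReZ cReD.
have -> : (2%:R : R[i])^-1 = (2^-1)%:C%C by rewrite fmorphV rmorph_nat.
by rewrite mulrC [in RHS]mulrC cImZ cImD.
Qed.

Lemma ctavg_lin N (a : R[i]) F G :
  ctavg N (fun m => a * F m + G m) = a * ctavg N F + ctavg N G.
Proof. by rewrite !ctavgE big_split/= -mulr_sumr mulrDr mulrCA. Qed.

Lemma eq_ctavg N F G : (forall m, (m < 2 ^ N)%N -> F m = G m) ->
  ctavg N F = ctavg N G.
Proof.
by move=> FG; rewrite !ctavgE; congr (_ * _); apply: eq_bigr => i _; exact: FG.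
Qed.

Lemma cint_node F g N : inL1 g ->
  cint circle (fun x => F (node N x) * g x) =
  (2 * pi)%:C%C * ctavg N (fun m => F m * cmean g N m).
Proof.
move=> [g1 g2]; apply: complexP; rewrite ?cReZ ?cImZ /=.
  under eq_Rintegral do rewrite cReM.
  rewrite RintegralB ?mint_node// ?(Rint_node hdelta (fun m => complex.Re (F m)))//
    ?(Rint_node hdelta (fun m => complex.Im (F m)))//.
  - rewrite -mulrBr -tavgB; congr (_ * tavg _ _).
    by apply/funext => m; rewrite cReM.
  - exact: measurable_circle.
  - exact: (mint_node hdelta (fun m => complex.Re (F m))).
  - exact: (mint_node hdelta (fun m => complex.Im (F m))).
under eq_Rintegral do rewrite cImM.
rewrite RintegralD ?mint_node// ?(Rint_node hdelta (fun m => complex.Re (F m)))//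
  ?(Rint_node hdelta (fun m => complex.Im (F m)))//.
- rewrite -mulrDr -tavgD; congr (_ * tavg _ _).
  by apply/funext => m; rewrite cImM.
- exact: measurable_circle.
- exact: (mint_node hdelta (fun m => complex.Re (F m))).
- exact: (mint_node hdelta (fun m => complex.Im (F m))).
Qed.

(** The terms mixing a mean and a jump cancel between the two halves, whose jumps are opposite; only
    the product of jumps survives. *)
Lemma cmean_tel f g N : inL1 f -> inL1 g ->
  ctavg N.+1 (fun m => cmean f N.+1 m * cmean g N.+1 m) =
  ctavg N (fun m => cmean f N m * cmean g N m) +
  ctavg N (fun m => cdel f N m * cdel g N m).
Proof.
move=> L1f L1g; rewrite ctavgS -[X in X + _]mul1r -ctavg_lin; apply: eq_ctavg => m mN.
rewrite !cdel_right// mul1r.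
have two : (2%:R : R[i]) != 0 by rewrite pnatr_eq0.
apply: (mulIf two); rewrite mulfVK//.
by rewrite !cmean_left; ring.
Qed.

Definition csqint g : Prop :=
  sqint (fun x => complex.Re (g x)) /\ sqint (fun x => complex.Im (g x)).

Definition cvar g k m : R :=
  var delta (fun x => complex.Re (g x)) k m + var delta (fun x => complex.Im (g x)) k m.

Lemma csqint_L1 g : csqint g -> inL1 g.
Proof. by move=> [[? _] [? _]]. Qed.

Lemma mint_csqr g (c : R[i]) : csqint g -> mint (fun x => normc (g x - c) ^+ 2).
Proof.
move=> [g1 g2]; have := mintD (sqint_shift (complex.Re c) g1)
  (sqint_shift (complex.Im c) g2).
apply: eq_integrable => [|x _]; first exact: measurable_circle.
by rewrite sqr_normcE !cReD !cImD !cReN !cImN.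
Qed.

Lemma mean_csqr g (c : R[i]) k m : csqint g -> (m < 2 ^ k)%N ->
  mean (fun x => normc (g x - c) ^+ 2) k m = cvar g k m + normc (cmean g k m - c) ^+ 2.
Proof.
move=> [g1 g2] mk; rewrite (@eq_mean _ delta _ (fun x => (complex.Re (g x) - complex.Re c) ^+ 2
   + (complex.Im (g x) - complex.Im c) ^+ 2)); last first.
  by move=> x _; rewrite sqr_normcE !cReD !cImD !cReN !cImN.
rewrite meanD ?mean_shift_sqr//; [|exact: (sqint_shift)|exact: (sqint_shift)].
by rewrite sqr_normcE !cReD !cImD !cReN !cImN /cvar /=; ring.
Qed.

Lemma cvar_ge0 g k m : csqint g -> (m < 2 ^ k)%N -> 0 <= cvar g k m.
Proof. by move=> [? ?] mk; rewrite addr_ge0// var_ge0. Qed.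

Lemma cvar_split g k m : csqint g -> (m < 2 ^ k)%N ->
  2 * normc (cdel g k m) ^+ 2 + (cvar g k.+1 m.*2 + cvar g k.+1 m.*2.+1)
    = 2 * cvar g k m.
Proof.
move=> [g1 g2] mk; have := var_split hdelta g1 mk; have := var_split hdelta g2 mk.
rewrite sqr_normcE /cdel cReD cImD cReN cImN /cvar /=; lra.
Qed.

(* [B] bounds the BMO norm of [g], up to the term [|g_0|]. *)
Definition bmo_le (B : R) g : Prop := csqint g /\
  (forall k m, (m < 2 ^ k)%N -> cvar g k m <= B ^+ 2).

Lemma bmo_le_cdel B g k m : 0 <= B -> bmo_le B g -> (m < 2 ^ k)%N ->
  normc (cdel g k m) <= B.
Proof.
move=> B0 [sg gB] mk; have [m1 m2] := arc_children mk.
rewrite -ler_sqr ?nnegrE ?normc_ge0//.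
have := cvar_split sg mk; have := gB _ _ mk; have := cvar_ge0 sg m1.
by have := cvar_ge0 sg m2; lra.
Qed.

(** The form in which a bound on the [H^1] norm enters the estimates. Since [2 pi >= 1], passing
    from integrals to averages costs no constant. *)
Definition h1_le (A : R) f : Prop := [/\ inL1 f, normc (cmean f 0 0) <= A &
  forall N, tavg N (fun m => Num.sqrt (qsum (cdel f) N m)) <= A].

Lemma h1_leP f (A : R) : inL1 f -> (H1norm delta f <= A%:E)%E -> h1_le A f.
Proof.
move=> L1f fA.
have H N : normc (cmean f 0 0) + tavg N (fun m => Num.sqrt (qsum (cdel f) N m)) <= A.
  have := le_trans (H1norm_ge hdelta N L1f) fA; rewrite lee_fin.
  have : 0 <= normc (cmean f 0 0) + tavg N (fun m => Num.sqrt (qsum (cdel f) N m)).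
    by rewrite addr_ge0 ?normc_ge0// tavg_ge0// => *; exact: sqrtr_ge0.
  by have := pihalf_ge1 R; nra.
split=> //.
  by have := H 0; rewrite tavg0; have := sqrtr_ge0 (qsum (cdel f) 0 0); lra.
by move=> N; have := H N; have := normc_ge0 (cmean f 0 0); lra.
Qed.

Lemma duality f g A B N : h1_le A f -> bmo_le B g -> 0 <= B ->
  tavg N (rsum (fun k m => normc (cdel f k m) * normc (cdel g k m)) N) <= 2 * B * A.
Proof.
move=> [L1f f0 fA] [sg gB] B0.
have A0 : 0 <= A := le_trans (normc_ge0 _) f0.
(* [garsia_herz] needs a positive bound while [B] may vanish. It is applied with [B + t], and [t] is
   such that the excess [2 * t * A] is at most [e]. *)
apply/ler_addgt0Pr => e e0; pose t := e / (2 * A + 1).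
have t0 : 0 < t by rewrite divr_gt0//; lra.
have Bt : 0 < B + t by lra.
apply: (@le_trans _ _ (2 * (B + t) * A)).
  apply: (@garsia_herz _ _ _ _ fA _ (cvar g) _ _ Bt) => [k m _|k m _|k m mk|k m mk].
  - exact: normc_ge0.
  - exact: normc_ge0.
  - rewrite cvar_ge0//=; apply: le_trans (gB _ _ mk) _.
    by rewrite ler_sqr ?nnegrE; lra.
  - by rewrite cvar_split.
rewrite mulrDr mulrDl lerD2l.
have -> : e = t * (2 * A + 1) by rewrite divfK// gt_eqF//; lra.
by rewrite mulrDr mulr1 mulrAC [2 * A * t]mulrC lerDl ltW.
Qed.

(** The integral of [E_N f * E_N g]. By [cmean_tel] its increments are diagonal averages, summable
    by [duality], so the limit exists even when [f g] is not integrable. *)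
Definition pair_seq f g N : R[i] :=
  (2 * pi)%:C%C * ctavg N (fun m => cmean f N m * cmean g N m).

Definition pairing f g : R[i] := climn (pair_seq f g).

Lemma tavg_rsum (d : nat -> nat -> R) N : tavg N (rsum d N) = \sum_(k < N) tavg k (d k).
Proof.
elim: N => [|N IH]; first by rewrite big_ord0 tavg0.
by rewrite big_ord_recr/= -IH -tavgD -[RHS]tavg_half.
Qed.

Lemma pairing_cvg f g A B : h1_le A f -> bmo_le B g -> 0 <= B ->
  ccvg (pair_seq f g) (pairing f g).
Proof.
move=> fA gB B0.
have [l hl] : exists l, ccvg (pair_seq f g) l.
  apply: (ccvg_series (e := fun N => 2 * pi * tavg N (fun m =>
    normc (cdel f N m) * normc (cdel g N m))) (K := 2 * pi * (2 * B * A))) => [N|N].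
    rewrite /pair_seq -mulrBr normcM normc_real ger0_norm ?mulr_ge0 ?pi_ge0//.
    rewrite ler_pM2l ?mulr_gt0 ?pi_gt0//.
    rewrite cmean_tel; [|by case: fA|exact: csqint_L1 gB.1].
    rewrite addrAC subrr add0r; apply: le_trans (normc_ctavg _ _) _.
    by apply: tavg_le => m _; rewrite normcM.
  rewrite -mulr_sumr ler_pM2l ?mulr_gt0 ?pi_gt0// -(tavg_rsum (fun k m => normc (cdel f k m) * normc (cdel g k m))).
  exact: duality.
by rewrite /pairing (climnE hl).
Qed.

Lemma pair_seq_le f g A B N : h1_le A f -> bmo_le B g -> 0 <= B ->
  normc (pair_seq f g N) <= 2 * pi * (A * normc (cmean g 0 0) + 2 * B * A).
Proof.
move=> fA gB B0; have L1f : inL1 f by case: fA.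
have L1g := csqint_L1 gB.1.
rewrite /pair_seq normcM normc_real ger0_norm ?mulr_ge0 ?pi_ge0//.
rewrite ler_pM2l ?mulr_gt0 ?pi_gt0//.
apply: (@le_trans _ _ (normc (cmean f 0 0) * normc (cmean g 0 0) +
    tavg N (rsum (fun k m => normc (cdel f k m) * normc (cdel g k m)) N))).
  rewrite tavg_rsum; elim: N => [|N IH].
    by rewrite big_ord0 addr0; apply: le_trans (normc_ctavg _ _) _; rewrite tavg0 normcM.
  rewrite cmean_tel// big_ord_recr addrA; apply: le_trans (le_normcD _ _) _.
  apply: lerD; [exact: IH|apply: le_trans (normc_ctavg _ _) _].
  by apply: tavg_le => m _; rewrite normcM.
apply: lerD; last exact: duality.
by rewrite ler_wpM2r ?normc_ge0//; case: fA.
Qed.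

Lemma pairing_le f g A B : h1_le A f -> bmo_le B g -> 0 <= B ->
  normc (pairing f g) <= 2 * pi * (A * normc (cmean g 0 0) + 2 * B * A).
Proof.
move=> fA gB B0; apply: ccvg_bound (pairing_cvg fA gB B0) _ => N.
exact: pair_seq_le.
Qed.

End Coefficients.

(** * Multiplication by test functions *)

Section BoundedOscillation.
Context {R : realType}.
Variable delta : R.
Hypothesis hdelta : 0 <= delta < 1.
Implicit Types (x y M B : R) (f g b phi : R -> R[i]).
Local Notation mu := (@lebesgue_measure R).
Local Notation arc := (dyadic_arc delta).
Local Notation mint h := (mu.-integrable circle (fun x => (h x)%:E)).
Local Notation node := (node delta).
Local Notation mean := (mean delta).
Local Notation cmean := (cmean delta).
Local Notation cdel := (cdel delta).
Local Notation cvar := (cvar delta).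
Local Notation bmo_le := (bmo_le delta).
Let mC := @measurable_circle R.

Lemma arc_meanE b k m (mk : (m < 2 ^ k)%N) :
  arc_mean delta b (existT _ k (Ordinal mk)) = cmean b k m.
Proof.
rewrite /arc_mean arc_lenE//; apply: complexP; rewrite ?cReZ ?cImZ /=.
  by rewrite mulrC.
by rewrite mulrC.
Qed.

Lemma csqint_shift b (c : R[i]) : inL1 b ->
  mint (fun x => normc (b x - c) ^+ 2) -> csqint b.
Proof.
move=> [b1 b2] h.
have H (p : R[i] -> R) : mint (fun x => p (b x)) -> (forall z, `|p z| <= normc z) ->
    (forall z w, p (z + w) = p z + p w) -> sqint (fun x => p (b x)).
  move=> ib pn pD; split=> //.
  have ih : mint (fun x => 2 * normc (b x - c) ^+ 2 + 2 * p c ^+ 2).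
    by apply: mintD; [exact: mintZ|exact: mint_cst].
  apply: mint_le ih _ => [|x cx].
    by apply: measurable_funX; exact: mint_meas ib.
  rewrite ger0_norm ?sqr_ge0//.
  have -> : p (b x) = p (b x - c) + p c by rewrite -pD subrK.
  have := pn (b x - c); have := normc_ge0 (b x - c).
  have : p (b x - c) ^+ 2 = `|p (b x - c)| ^+ 2 by rewrite -normrX ger0_norm ?sqr_ge0.
  move: (p (b x - c)) (p c) (normc _) => s t n e n0 sn.
  have : s ^+ 2 <= n ^+ 2 by rewrite e ler_sqr ?nnegrE.
  by have := sqr_ge0 (s - t); lra.
split; [apply: (H (@complex.Re R))|apply: (H (@complex.Im R))] => //.
- exact: normc_geRe.
- exact: cReD.
- exact: normc_geIm.
- exact: cImD.
Qed.

(** Functions of [inBMO] are only assumed integrable. Their square integrability comes from the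
    oscillation over the root arc, which is the whole circle. *)
Lemma bmo_leP b B : inL1 b -> 0 <= B -> (BMOnorm delta b <= B%:E)%E ->
  bmo_le B b /\ normc (cmean b 0 0) <= B.
Proof.
move=> L1b B0; rewrite /BMOnorm; set s := ereal_sup _ => H.
have bB : normc (cmean b 0 0) <= B.
  have : ((normc (cint circle b))%:E <= B%:E)%E.
    by apply: le_trans H; rewrite leeDr// sqrte_ge0.
  rewrite lee_fin; apply: le_trans.
  have -> : cmean b 0 0 = ((2 * pi)^-1)%:C%C * cint circle b.
    by apply: complexP; rewrite ?cReZ ?cImZ /= mean_circle// mulrC.
  have p1 : 1 <= 2 * pi :> R by have := pihalf_ge1 R; lra.
  rewrite normcM normc_real ger0_norm ?invr_ge0; last by lra.
  by rewrite -[leRHS]mul1r ler_wpM2r ?normc_ge0// invf_le1; lra.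
have sB : (s <= (B ^+ 2)%:E)%E.
  have B2 : (0 <= (B ^+ 2)%:E)%E by rewrite lee_fin sqr_ge0.
  rewrite -(lee_sqrt _ B2) /= sqrtr_sqr ger0_norm//; apply: le_trans H.
  by rewrite leeDl// lee_fin normc_ge0.
have HI k m (mk : (m < 2 ^ k)%N) :
    (((len k)^-1)%:E * \int[mu]_(x in arc k m) (normc (b x - cmean b k m) ^+ 2)%:E
      <= (B ^+ 2)%:E)%E.
  apply: le_trans sB; apply: ereal_sup_ubound => /=.
  by exists (existT _ k (Ordinal mk)) => //; rewrite arc_meanE arc_lenE.
have mb (c : R[i]) : measurable_fun circle (fun x => normc (b x - c) ^+ 2).
  have -> : (fun x => normc (b x - c) ^+ 2) = (fun x =>
    (complex.Re (b x) - complex.Re c) ^+ 2 + (complex.Im (b x) - complex.Im c) ^+ 2).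
    by apply/funext => x; rewrite sqr_normcE !cReD !cImD cReN cImN.
  case: L1b => b1 b2; apply: measurable_funD; apply: measurable_funX;
    by apply: measurable_funB => //; exact: mint_meas.
have sb : csqint b.
  apply: (csqint_shift (c := cmean b 0 0)) => //; apply/integrableP; split.
    by apply/measurable_EFinP; exact: mb.
  under eq_integral => x _ do rewrite gee0_abs ?lee_fin ?sqr_ge0//.
  have := HI 0%N 0%N erefl; rewrite (arc00 hdelta) /len expr0 divr1 => h.
  rewrite ltNge; apply/negP; rewrite leye_eq => /eqP e; move: h; rewrite e.
  by rewrite gt0_muley ?lte_fin ?invr_gt0 ?mulr_gt0 ?pi_gt0.
split=> //; split=> // k m mk.
have := mean_csqr hdelta (cmean b k m) sb mk; rewrite subrr normc0 expr0n addr0 => <-.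
have := HI k m mk; rewrite /mean /Rintegral -lee_fin; apply: le_trans.
rewrite mulrC EFinM fineK//.
apply: integrable_fin_num; first exact: measurable_arc.
by apply: mint_arc => //; exact: mint_csqr.
Qed.

(* What the proof uses of a test function: [M] bounds it, and [2 M |I|] bounds
   its oscillation on each arc [I], including those that wrap around. *)
Definition tame M phi : Prop :=
  [/\ measurable_fun circle (fun x => complex.Re (phi x)),
      measurable_fun circle (fun x => complex.Im (phi x)),
      forall x, circle x -> normc (phi x) <= M
    & forall k m x y, (m < 2 ^ k)%N -> arc k m x -> arc k m y ->
      normc (phi x - phi y) <= 2 * M * len k].

Lemma csqint_mul M phi b : measurable_fun circle (fun x => complex.Re (phi x)) ->
  measurable_fun circle (fun x => complex.Im (phi x)) ->
  (forall x, circle x -> normc (phi x) <= M) ->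
  csqint b -> csqint (fun x => phi x * b x).
Proof.
move=> m1 m2 pM [[b1 b1s] [b2 b2s]].
have p1 x : circle x -> `|complex.Re (phi x)| <= M.
  by move=> cx; apply: le_trans (normc_geRe _) _; exact: pM.
have p2 x : circle x -> `|complex.Im (phi x)| <= M.
  by move=> cx; apply: le_trans (normc_geIm _) _; exact: pM.
have i3 : mint (fun x => M ^+ 2 * (complex.Re (b x) ^+ 2 + complex.Im (b x) ^+ 2)).
  by apply: mintZ; exact: mintD.
have bound x : circle x -> normc (phi x * b x) ^+ 2 <=
    M ^+ 2 * (complex.Re (b x) ^+ 2 + complex.Im (b x) ^+ 2).
  move=> cx; rewrite -sqr_normcE normcM exprMn ler_wpM2r ?sqr_ge0//.
  have M0 : 0 <= M := le_trans (normc_ge0 _) (pM _ cx).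
  by rewrite ler_sqr ?nnegrE ?normc_ge0// pM.
have iR : mint (fun x => complex.Re (phi x * b x)).
  have := mintD (mint_mulb m1 p1 b1) (mintZ (-1) (mint_mulb m2 p2 b2)).
  by apply: eq_integrable => // x _; rewrite cReM mulN1r.
have iI : mint (fun x => complex.Im (phi x * b x)).
  have := mintD (mint_mulb m1 p1 b2) (mint_mulb m2 p2 b1).
  by apply: eq_integrable => // x _; rewrite cImM.
split; split=> //; apply: mint_le i3 _.
- by apply: measurable_funX; exact: mint_meas iR.
- move=> x cx; apply: le_trans (bound x cx).
  by rewrite ger0_norm ?sqr_ge0// sqr_normcE lerDl sqr_ge0.
- by apply: measurable_funX; exact: mint_meas iI.
- move=> x cx; apply: le_trans (bound x cx).
  by rewrite ger0_norm ?sqr_ge0// sqr_normcE lerDr sqr_ge0.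
Qed.

Lemma normc_cmean_le g C k m : csqint g -> (m < 2 ^ k)%N -> 0 <= C ->
  (mean (fun x => normc (g x) ^+ 2) k m <= C ^+ 2) -> normc (cmean g k m) <= C.
Proof.
move=> sg mk C0; have := mean_csqr hdelta 0 sg mk.
under eq_mean do rewrite subr0.
rewrite subr0 => -> h; rewrite -ler_sqr ?nnegrE ?normc_ge0//.
by apply: le_trans h; rewrite lerDr cvar_ge0.
Qed.

Lemma normc_sq_le2 (z w : R[i]) : normc (z + w) ^+ 2 <= 2 * normc z ^+ 2 + 2 * normc w ^+ 2.
Proof.
have := le_normcD z w; have := normc_ge0 (z + w).
move: (normc z) (normc w) (normc (z + w)) => s t n n0 h.
have : n ^+ 2 <= (s + t) ^+ 2 by rewrite ler_sqr ?nnegrE//; lra.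
by have := sqr_ge0 (s - t); lra.
Qed.

(** One jump, of modulus at most [B], is added per generation. *)
Lemma bmo_growth B b k m : bmo_le B b -> 0 <= B -> normc (cmean b 0 0) <= B ->
  (m < 2 ^ k)%N -> normc (cmean b k m) <= B * k.+1%:R.
Proof.
move=> bB B0 b0; elim: k m => [|k IH] m; first by case: m => // _; rewrite mulr1.
have L1b := csqint_L1 bB.1.
move: m; apply: half_eq => m mk; have := IH _ mk; have := bmo_le_cdel hdelta B0 bB mk.
rewrite -(natr1 k.+1) mulrDr mulr1 => h1 h2; split.
  by rewrite cmean_left; apply: le_trans (le_normcD _ _) _; exact: lerD.
rewrite cdel_right//; apply: le_trans (le_normcD _ _) _; rewrite normcN; exact: lerD.
Qed.

Lemma arc_inhabited k m : (m < 2 ^ k)%N -> exists x, arc k m x.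
Proof.
move=> mk; apply: contrapT => h.
have e : arc k m = set0 by apply/seteqP; split=> x // ax; apply: h; exists x.
have := measure_arc hdelta mk; rewrite e measure0 => /eqP.
by rewrite eq_sym eqe gt_eqF// len_gt0.
Qed.

(** For [y] in the arc, [phi b - phi(y) b_I = phi (b - b_I) + (phi - phi(y)) b_I], and the variance
    is at most the mean square distance to any constant. The second term is at most
    [2 M |I| B (k + 1) <= 16 M B], because [k + 1 <= 2^k] and [|I| 2^k = 2 pi <= 8]. Altogether
    [2 + 2 * 16^2 = 514 <= 24^2]. *)
Lemma bmo_le_mul M B phi b : 0 <= M -> 0 <= B -> tame M phi -> bmo_le B b ->
  normc (cmean b 0 0) <= B ->
  bmo_le (24 * M * B) (fun x => phi x * b x) /\
  normc (cmean (fun x => phi x * b x) 0 0) <= 24 * M * B.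
Proof.
move=> M0 B0 [m1 m2 pM posc] bB b0.
have [sb vB] := bB.
have sp := csqint_mul m1 m2 pM sb.
have key k m : (m < 2 ^ k)%N ->
    cvar (fun x => phi x * b x) k m <= (24 * M * B) ^+ 2.
  move=> mk; have [y ay] := arc_inhabited mk.
  have := mean_csqr hdelta (phi y * cmean b k m) sp mk.
  set T := normc (cmean _ k m - _) ^+ 2; have T0 : 0 <= T by exact: sqr_ge0.
  move=> e; apply: (@le_trans _ _ (mean (fun x => normc (phi x * b x - phi y * cmean b k m) ^+ 2) k m)).
    by rewrite e lerDl.
  have i1 := mint_csqr (cmean b k m) sb.
  have i2 := mintZ (2 * M ^+ 2) i1.
  have g1 := bmo_growth bB B0 b0 mk.
  have kk : (k.+1%:R : R) <= 2 ^+ k by rewrite -natrX ler_nat ltn_expl.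
  have lB : len k * normc (cmean b k m) <= 8 * B.
    apply: (@le_trans _ _ (len k * (B * 2 ^+ k))).
      rewrite ler_wpM2l ?(ltW (len_gt0 _))//; apply: le_trans g1 _.
      by rewrite ler_wpM2l.
    have -> : len k * (B * 2 ^+ k) = 2 * pi * B.
      by rewrite /len; move: (2 * pi) => p; field; rewrite expf_neq0.
    by rewrite ler_wpM2r//; have := pihalf_lt2 R; lra.
  apply: (@le_trans _ _ (mean (fun x => (2 * M ^+ 2) * normc (b x - cmean b k m) ^+ 2
      + 2 * (16 * M * B) ^+ 2) k m)).
    apply: mean_le => //; first exact: mint_csqr.
      by apply: mintD => //; exact: mint_cst.
    move=> x ax; have [cx _] := (arcP hdelta x mk).1 ax.
    have -> : phi x * b x - phi y * cmean b k m = phi x * (b x - cmean b k m) +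
      (phi x - phi y) * cmean b k m by ring.
    apply: le_trans (normc_sq_le2 _ _) _; rewrite !normcM !exprMn.
    apply: lerD.
      rewrite -mulrA ler_pM2l// ler_wpM2r ?sqr_ge0//.
      by rewrite ler_sqr ?nnegrE ?normc_ge0// pM.
    rewrite ler_pM2l// -!exprMn ler_sqr ?nnegrE ?mulr_ge0 ?normc_ge0//.
    apply: (@le_trans _ _ (2 * M * len k * normc (cmean b k m))).
      by rewrite ler_wpM2r ?normc_ge0// (posc k m).
    have : M * (len k * normc (cmean b k m)) <= M * (8 * B) by rewrite ler_wpM2l.
    by lra.
  rewrite meanD ?mean_cst//; last exact: mint_cst.
  rewrite meanZ// mean_csqr// subrr normc0 expr0n /= addr0.
  have := vB _ _ mk; have := cvar_ge0 hdelta sb mk => v0 v1.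
  have : M ^+ 2 * cvar b k m <= M ^+ 2 * B ^+ 2 by rewrite ler_wpM2l ?sqr_ge0.
  have : 0 <= M ^+ 2 * B ^+ 2 by rewrite mulr_ge0 ?sqr_ge0.
  by lra.
split; first by split.
apply: normc_cmean_le => //; first by rewrite !mulr_ge0.
have i1 := mint_csqr 0 sb.
apply: (@le_trans _ _ (mean (fun x => M ^+ 2 * normc (b x - 0) ^+ 2) 0 0)).
  apply: mean_le => //.
  - by have := mint_csqr 0 sp; under eq_fun do rewrite subr0.
  - exact: mintZ.
  move=> x ax; have [cx _] := (arcP hdelta x (erefl : (0 < 2 ^ 0)%N)).1 ax.
  rewrite subr0 normcM exprMn ler_wpM2r ?sqr_ge0//.
  by rewrite ler_sqr ?nnegrE ?normc_ge0// pM.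
rewrite meanZ// mean_csqr// subr0.
have h1 := vB 0%N 0%N erefl; have h2 : normc (cmean b 0 0) ^+ 2 <= B ^+ 2.
  by rewrite ler_sqr ?nnegrE ?normc_ge0.
have : M ^+ 2 * (cvar b 0 0 + normc (cmean b 0 0) ^+ 2) <= M ^+ 2 * (2 * B ^+ 2).
  by rewrite ler_wpM2l ?sqr_ge0//; lra.
have : 0 <= M ^+ 2 * B ^+ 2 by rewrite mulr_ge0 ?sqr_ge0.
by lra.
Qed.

Lemma cmean_cst (c : R[i]) k m : (m < 2 ^ k)%N -> cmean (fun=> c) k m = c.
Proof. by move=> mk; apply: complexP; rewrite /= mean_cst. Qed.

Lemma eq_cmean f g k m : (forall x, arc k m x -> f x = g x) ->
  cmean f k m = cmean g k m.
Proof.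
by move=> fg; apply: complexP; apply: eq_mean => x ax; rewrite fg.
Qed.

Lemma inL1_cst (c : R[i]) : inL1 (fun=> c).
Proof. by split; exact: mint_cst. Qed.

Lemma csqint_subc b (c : R[i]) : csqint b -> csqint (fun x => b x - c).
Proof.
move=> [[b1 b1s] [b2 b2s]].
split; split.
- have := mintD b1 (mint_cst (- complex.Re c)).
  by apply: eq_integrable => // x _; rewrite cReD cReN.
- have := sqint_shift (complex.Re c) (conj b1 b1s).
  by apply: eq_integrable => // x _; rewrite cReD cReN.
- have := mintD b2 (mint_cst (- complex.Im c)).
  by apply: eq_integrable => // x _; rewrite cImD cImN.
- have := sqint_shift (complex.Im c) (conj b2 b2s).
  by apply: eq_integrable => // x _; rewrite cImD cImN.
Qed.

Lemma tame_L1 M phi : tame M phi -> inL1 phi.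
Proof.
move=> [m1 m2 pM _]; split.
  apply: (mint_le m1 (mint_cst M)) => x cx.
  by apply: le_trans (normc_geRe _) _; exact: pM.
apply: (mint_le m2 (mint_cst M)) => x cx.
by apply: le_trans (normc_geIm _) _; exact: pM.
Qed.

(** The difference is a covariance, the mean of [(phi - phi(y)) (b - b_I)] for any [y] in the arc:
    at most the oscillation of [phi] times the standard deviation of [b]. *)
Lemma cmean_mul M B phi b k m : 0 <= M -> 0 <= B -> tame M phi -> bmo_le B b ->
  (m < 2 ^ k)%N ->
  normc (cmean (fun x => phi x * b x) k m - cmean phi k m * cmean b k m)
    <= 2 * M * len k * B.
Proof.
move=> M0 B0 tp [sb vB] mk; have [m1 m2 pM posc] := tp.
have [y ay] := arc_inhabited mk.
have l0 := len_gt0 (R := R) k.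
pose beta := cmean b k m; pose g x := (phi x - phi y) * (b x - beta).
have cy := ((arcP hdelta y mk).1 ay).1.
have sg : csqint g.
  apply: (csqint_mul (M := M + M)); last exact: csqint_subc.
  - have -> : (fun x => complex.Re (phi x - phi y)) =
      (fun x => complex.Re (phi x) - complex.Re (phi y)).
      by apply/funext => x; rewrite cReD cReN.
    exact: measurable_funB.
  - have -> : (fun x => complex.Im (phi x - phi y)) =
      (fun x => complex.Im (phi x) - complex.Im (phi y)).
      by apply/funext => x; rewrite cImD cImN.
    exact: measurable_funB.
  - move=> x cx; apply: le_trans (le_normcD _ _) _; rewrite normcN.
    by apply: lerD; exact: pM.
have L1p := tame_L1 tp; have L1b := csqint_L1 sb; have L1g := csqint_L1 sg.
have e : cmean (fun x => phi x * b x) k m = beta * cmean phi k m + cmean g k m.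
  rewrite (@eq_cmean _ (fun x => beta * phi x + (phi y * b x + (1 * g x + - (phi y * beta))))).
    have i1 := inL1_lin 1 L1g (inL1_cst (- (phi y * beta))).
    have i2 := inL1_lin (phi y) L1b i1.
    rewrite cmean_lin// cmean_lin// cmean_lin//; last exact: inL1_cst.
    by rewrite cmean_cst// -/beta; ring.
  by move=> x _; rewrite /g; ring.
have C0 : 0 <= 2 * M * len k * B by do 2?apply: mulr_ge0 => //; [exact: mulr_ge0|exact: ltW].
rewrite e -/beta addrAC mulrC subrr add0r.
apply: normc_cmean_le => //.
have i1 := mint_csqr beta sb.
apply: (@le_trans _ _ (mean (fun x => (2 * M * len k) ^+ 2 * normc (b x - beta) ^+ 2) k m)).
  apply: mean_le => //.
  - have := mint_csqr 0 sg.
    by apply: eq_integrable => // x _; rewrite subr0.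
  - exact: mintZ.
  move=> x ax; rewrite normcM exprMn ler_wpM2r ?sqr_ge0//.
  rewrite ler_sqr ?nnegrE ?normc_ge0//; first exact: (posc k m).
  by apply: mulr_ge0; [exact: mulr_ge0|exact: ltW].
rewrite meanZ// mean_csqr// subrr normc0 expr0n /= addr0 [leRHS]exprMn.
by rewrite ler_wpM2l ?sqr_ge0// vB.
Qed.

End BoundedOscillation.

(** * Smooth periodic functions are tame *)

Section TestFunctions.
Context {R : realType}.
Variable delta : R.
Hypothesis hdelta : 0 <= delta < 1.
Implicit Types (x y M B : R) (f g b phi : R -> R[i]).
Local Notation mu := (@lebesgue_measure R).
Local Notation arc := (dyadic_arc delta).
Local Notation node := (node delta).
Local Notation mean := (mean delta).
Local Notation cmean := (cmean delta).
Local Notation tame := (tame delta).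
Local Notation window := `[0 : R, 2 * (2 * pi)].

Let p0 : 0 < 2 * pi :> R. Proof. by rewrite mulr_gt0 ?pi_gt0. Qed.

Lemma derivable_lip (h : R -> R) M : (forall x, derivable h x 1) ->
  (forall x, x \in window -> `|derive1 h x| <= M) ->
  forall x y, x \in window -> y \in window -> `|h x - h y| <= M * `|x - y|.
Proof.
move=> dh hM.
have H x y : x \in window -> y \in window -> x <= y -> `|h y - h x| <= M * `|y - x|.
  move=> xw yw xy.
  have fd z : z \in `]x, y[ -> is_derive z 1 h (derive1 h z).
    by move=> _; rewrite derive1E; exact: derivableP.
  have fc : {within `[x, y], continuous h}.
    by apply: derivable_within_continuous => z _; exact: dh.
  have [c cxy ->] := MVT_segment xy fd fc; rewrite normrM ler_wpM2r// hM//.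
  move: xw yw cxy; rewrite !in_itv/= => /andP[? ?] /andP[? ?] /andP[? ?].
  by apply/andP; split; lra.
move=> x y xw yw; case: (leP x y) => [xy|/ltW xy]; last exact: H.
by rewrite distrC [`|x - y|]distrC; exact: H.
Qed.

Lemma periodic_int phi : (forall x, phi (x + 2 * pi) = phi x) ->
  forall (j : int) x, phi (x + 2 * pi * j%:~R) = phi x.
Proof.
move=> per; have H (n : nat) x : phi (x + 2 * pi * n%:R) = phi x.
  elim: n => [|n IH]; first by rewrite mulr0 addr0.
  by rewrite -[n.+1%:R]natr1 mulrDr mulr1 addrA per.
case=> n x; first exact: H.
by rewrite -[LHS](H n.+1) NegzE rmorphN /= mulrN subrK.
Qed.

(** An arc that wraps around is not an interval of the fundamental domain, but it lifts to one
    within two periods. There two of its points are at distance at most [|I|]. *)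
Lemma arc_lift k m x : (m < 2 ^ k)%N -> arc k m x -> exists j : int,
  x + 2 * pi * j%:~R \in window /\
  2 * pi * (m%:R / 2 ^+ k + delta) <= x + 2 * pi * j%:~R
       < 2 * pi * (m%:R / 2 ^+ k + delta) + len k.
Proof.
move=> mk [_ [j /andP[h1 h2]]]; exists j.
have k0 : 0 < 2 ^+ k :> R by rewrite exprn_gt0.
have M : (m.+1%:R : R) / 2 ^+ k <= 1 by rewrite ler_pdivrMr// mul1r -natrX ler_nat.
have M0 : 0 <= (m%:R : R) / 2 ^+ k by rewrite divr_ge0// ltW.
have /andP[d0 d1] := hdelta.
have a0 : 0 <= 2 * pi * (m%:R / 2 ^+ k + delta).
  by apply: mulr_ge0; [exact: ltW|exact: addr_ge0].
have b2 : 2 * pi * (m.+1%:R / 2 ^+ k + delta) <= 2 * (2 * pi).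
  by rewrite [leRHS]mulrC ler_pM2l//; lra.
have e : 2 * pi * (m.+1%:R / 2 ^+ k + delta) =
    2 * pi * (m%:R / 2 ^+ k + delta) + len k.
  rewrite /len -[m.+1%:R]natr1; move: (2 * pi) => p; field; by rewrite gt_eqF.
by rewrite in_itv/= -e h1 h2; split=> //; apply/andP; split; lra.
Qed.

Lemma circle_window x : circle x -> x \in window.
Proof. by move=> /circleP/andP[? ?]; rewrite in_itv/=; apply/andP; split; lra. Qed.

(** The real and imaginary parts are both [M]-Lipschitz, which gives the factor [2] in [tame].
    Bounds are requested on the window only, where compactness supplies them in [test_tame]. *)
Lemma tame_test M phi : test_function phi ->
  (forall j x, (j <= 1)%N -> x \in window -> normc (cderiv j phi x) <= M) ->
  tame M phi.
Proof.
move=> [per der] H.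
have phiM x : x \in window -> normc (phi x) <= M.
  move=> xw; have := H 0%N x erefl xw; rewrite /cderiv /=.
  by case: (phi x).
have dR x : derivable (fun y => complex.Re (phi y)) x 1 by have [] := der 0%N x.
have dI x : derivable (fun y => complex.Im (phi y)) x 1 by have [] := der 0%N x.
have lipR := derivable_lip dR (M := M); have lipI := derivable_lip dI (M := M).
have meas (h : R -> R) : (forall x, derivable h x 1) -> measurable_fun circle h.
  move=> dh; apply: measurable_funTS; apply: continuous_measurable_fun => x.
  by apply: differentiable_continuous; apply/derivable1_diffP.
split; [exact: meas|exact: meas| |].
  by move=> x /circle_window; exact: phiM.
move=> k m x y mk /(arc_lift mk)[i [xw /andP[x1 x2]]] /(arc_lift mk)[j [yw /andP[y1 y2]]].
rewrite -(periodic_int per i x) -(periodic_int per j y).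
move: (x + _) (y + _) xw yw x1 x2 y1 y2 => {}x {}y xw yw x1 x2 y1 y2.
apply: le_trans (normc_leD _) _; rewrite cReD cImD cReN cImN.
have M0 : 0 <= M := le_trans (normc_ge0 _) (phiM _ xw).
have h1 : `|complex.Re (phi x) - complex.Re (phi y)| <= M * `|x - y|.
  apply: lipR => // z zw; apply: le_trans (H 1%N z erefl zw).
  by have := normc_geRe (cderiv 1 phi z).
have h2 : `|complex.Im (phi x) - complex.Im (phi y)| <= M * `|x - y|.
  apply: lipI => // z zw; apply: le_trans (H 1%N z erefl zw).
  by have := normc_geIm (cderiv 1 phi z).
have xy : `|x - y| <= len k by rewrite ler_norml; apply/andP; split; lra.
have : M * `|x - y| <= M * len k by rewrite ler_wpM2l.
by lra.
Qed.

Lemma test_tame phi : test_function phi -> exists2 M, 0 <= M & tame M phi.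
Proof.
move=> tp; have [per der] := tp.
have w0 : (0 : R) <= 2 * (2 * pi) by rewrite mulr_ge0// ltW.
have bd (h : R -> R) : (forall x, derivable h x 1) ->
    exists c, forall x, x \in window -> `|h x| <= c.
  move=> dh; have [|c _ hc] := @EVT_max _ (fun x => `|h x|) _ _ w0.
    apply: continuous_subspaceT => x; apply: continuous_comp.
      exact/differentiable_continuous/derivable1_diffP.
    exact: norm_continuous.
  by exists `|h c|.
have [a0 A0] := bd _ (fun x => (der 0%N x).1).
have [b0 B0] := bd _ (fun x => (der 0%N x).2).
have [a1 A1] := bd _ (fun x => (der 1%N x).1).
have [b1 B1] := bd _ (fun x => (der 1%N x).2).
have z0 : 0 \in window by rewrite in_itv/= lexx.
have a00 := le_trans (normr_ge0 _) (A0 _ z0).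
have a10 := le_trans (normr_ge0 _) (A1 _ z0).
have b00 := le_trans (normr_ge0 _) (B0 _ z0).
have b10 := le_trans (normr_ge0 _) (B1 _ z0).
exists (a0 + b0 + a1 + b1); first by rewrite !addr_ge0.
apply: tame_test => // -[|[|//]] x _ xw; apply: le_trans (normc_leD _) _.
  by have := A0 _ xw; have := B0 _ xw; rewrite /cderiv /=; lra.
by have := A1 _ xw; have := B1 _ xw; rewrite /cderiv /=; lra.
Qed.

Lemma normc_cmean_L1 f : inL1 f -> exists K, forall N,
  tavg N (fun m => normc (cmean f N m)) <= K.
Proof.
move=> [f1 f2].
exists (mean (fun x => `|complex.Re (f x)|) 0 0 + mean (fun x => `|complex.Im (f x)|) 0 0).
have n1 := mint_norm f1; have n2 := mint_norm f2.
move=> N; rewrite -(tavg_mean hdelta N n1) -(tavg_mean hdelta N n2) -tavgD.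
apply: tavg_le => m mN; apply: le_trans (normc_leD _) _.
have mean_norm (h : R -> R) : mu.-integrable circle (fun x => (h x)%:E) ->
    `|mean h N m| <= mean (fun x => `|h x|) N m.
  move=> ih; rewrite /mean normrM [`|_^-1|]gtr0_norm ?invr_gt0 ?len_gt0//.
  rewrite ler_wpM2r ?invr_ge0 ?(ltW (len_gt0 _))//.
  by apply: le_normr_Rintegral; [exact: measurable_arc|exact: mint_arc].
by apply: lerD; exact: mean_norm.
Qed.

Lemma product_defect M B phi f b : 0 <= M -> 0 <= B -> tame M phi ->
  bmo_le delta B b -> inL1 f ->
  (fun N => normc (pair_seq delta f (fun x => phi x * b x) N -
     cint circle (fun x => cmean f N (node N x) * cmean b N (node N x) * phi x)))
    @ \oo --> (0 : R).
Proof.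
move=> M0 B0 tp bB L1f; have [K fK] := normc_cmean_L1 L1f.
have L1p := tame_L1 tp.
pose C := 2 * pi * (2 * M * (2 * pi) * B * K).
have cv : (fun N => C * (2^-1) ^+ N) @ \oo --> (0 : R).
  rewrite -[X in _ --> X](mulr0 C); apply: cvgM; first exact: cvg_cst.
  by apply: cvg_expr; rewrite ger0_norm ?invr_ge0// invf_lt1// ltr1n.
apply: squeeze0 cv => N; apply/andP; split; first exact: normc_ge0.
rewrite (_ : cint circle _ = (2 * pi)%:C%C *
    ctavg N (fun m => cmean f N m * cmean b N m * cmean phi N m)); last first.
  exact: (cint_node hdelta (fun m => cmean f N m * cmean b N m) N L1p).
rewrite /pair_seq -mulrBr.
rewrite normcM normc_real ger0_norm ?(ltW p0)// /C -mulrA ler_pM2l//.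
set F := fun m => cmean f N m * _; set G := fun m => _ * cmean phi N m.
have -> : ctavg N F - ctavg N G = ctavg N (fun m => (-1) * G m + F m).
  by rewrite ctavg_lin mulN1r addrC.
apply: le_trans (normc_ctavg _ _) _.
apply: (@le_trans _ _ (tavg N (fun m => 2 * M * len N * B * normc (cmean f N m)))).
  apply: tavg_le => m mN; rewrite /F /G.
  have -> : -1 * (cmean f N m * cmean b N m * cmean phi N m) +
      cmean f N m * cmean (fun x => phi x * b x) N m = cmean f N m *
      (cmean (fun x => phi x * b x) N m - cmean phi N m * cmean b N m) by ring.
  by rewrite normcM mulrC ler_wpM2r ?normc_ge0// cmean_mul.
rewrite tavgZ; apply: (@le_trans _ _ (2 * M * len N * B * K)).
  apply: ler_wpM2l => //; apply: mulr_ge0 => //.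
  by apply: mulr_ge0; [exact: mulr_ge0|exact: ltW (len_gt0 _)].
rewrite le_eqVlt; apply/orP; left; apply/eqP; rewrite /len exprVn.
by move: (2 * pi) => p; ring.
Qed.

End TestFunctions.

(** * The diagonal part *)

Section PathSeries.
Context {R : realType}.
Variable delta : R.
Hypothesis hdelta : 0 <= delta < 1.
Implicit Types (x : R) (d : nat -> nat -> R).
Local Notation mu := (@lebesgue_measure R).
Local Notation mint h := (mu.-integrable circle (fun x => (h x)%:E)).
Local Notation node := (node delta).
Let mC := @measurable_circle R.

(** The upper limit is defined and measurable without any convergence, so [S(f, b)] is a total
    function; it equals the sum of the series wherever that converges. *)
Definition psum d x : R :=
  fine (limn_esup (fun N => (rsum d N (node N x))%:E)).

Definition pabs d x : \bar R := (\sum_(k <oo) `|d k (node k x)|%:E)%E.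

Lemma measurable_psum d : measurable_fun circle (psum d).
Proof.
apply: (measurableT_comp (f := fine)) => //.
apply: measurable_fun_limn_esup => N.
exact: (measurable_node hdelta (fun m => (rsum d N m)%:E)).
Qed.

Lemma measurable_pabs d : measurable_fun circle (pabs d).
Proof.
apply: ge0_emeasurable_sum => [k x _ _|k _]; first by rewrite lee_fin.
exact: (measurable_node hdelta (fun m => `|d k m|%:E)).
Qed.

Lemma pabs_ge0 d x : (0 <= pabs d x)%E.
Proof. by apply: nneseries_ge0 => k _ _; rewrite lee_fin. Qed.

Lemma rsum_pabs d N x : circle x -> (`|rsum d N (node N x)|%:E <= pabs d x)%E.
Proof.
move=> cx; rewrite rsum_node//.
apply: (@le_trans _ _ (\sum_(0 <= k < N) `|d k (node k x)|%:E)%E).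
  by rewrite sumEFin lee_fin big_mkord; exact: ler_norm_sum.
by apply: nneseries_lim_ge => k _; rewrite lee_fin.
Qed.

Lemma psumE d x (l : R) : (fun N => rsum d N (node N x)) @ \oo --> l -> psum d x = l.
Proof.
move=> hl; have h : (fun N => (rsum d N (node N x))%:E) @ \oo --> l%:E.
  by apply: cvg_EFin => //; exact: nearW.
rewrite /psum is_cvg_limn_esupE; last by apply/cvg_ex; exists l%:E.
by rewrite (cvg_lim _ h).
Qed.

Lemma psum_cvg d x : circle x -> (pabs d x < +oo)%E ->
  (fun N => rsum d N (node N x)) @ \oo --> psum d x.
Proof.
move=> cx; have := pabs_ge0 d x; case E : (pabs d x) => [K||]// _ _.
have [n|N|l hl] := @rcvg_series _ (fun N => rsum d N (node N x))
    (fun k => `|d k (node k x)|) K.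
- by rewrite rsumS nodeS// addrAC subrr add0r.
- rewrite -lee_fin -E -sumEFin -(big_mkord xpredT (fun k => `|d k (node k x)|%:E)).
  by apply: nneseries_lim_ge => k _; rewrite lee_fin.
by rewrite (psumE hl).
Qed.

Lemma psum_le d x : circle x -> (pabs d x < +oo)%E -> (`|psum d x|%:E <= pabs d x)%E.
Proof.
move=> cx fx; have h := psum_cvg cx fx.
move: fx (pabs_ge0 d x) (fun N => rsum_pabs d N cx); case: (pabs d x) => [K||]// _ _ H.
rewrite lee_fin; apply: cvgr_to_le (cvg_norm h) _.
by apply: nearW => N; rewrite -lee_fin.
Qed.

Variables (d : nat -> nat -> R) (K : R).
Hypothesis dK : forall N, tavg N (rsum (fun k m => `|d k m|) N) <= K.

Lemma integral_pabs : (\int[mu]_(x in circle) pabs d x <= (2 * pi * K)%:E)%E.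
Proof.
rewrite integral_nneseries//; last first.
  by move=> k; exact: (measurable_node hdelta (fun m => `|d k m|%:E)).
under eq_eseriesr => k _ do rewrite (integral_node hdelta (F := fun m => `|d k m|))//.
apply: lime_le.
  apply: is_cvg_nneseries => k _ _; rewrite lee_fin; apply: mulr_ge0.
    by rewrite mulr_ge0 ?pi_ge0.
  by apply: tavg_ge0 => m _; exact: normr_ge0.
apply: nearW => N; rewrite sumEFin big_mkord -mulr_sumr lee_fin.
rewrite ler_pM2l ?mulr_gt0 ?pi_gt0//.
by rewrite -(tavg_rsum (fun k m => `|d k m|)).
Qed.

Lemma integrable_pabs : mu.-integrable circle (pabs d).
Proof.
apply/integrableP; split; first exact: measurable_pabs.
under eq_integral => x _ do rewrite gee0_abs ?pabs_ge0//.
exact: le_lt_trans integral_pabs (ltry _).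
Qed.

Lemma pabs_ae : {ae mu, forall x, circle x -> (pabs d x < +oo)%E}.
Proof.
have := integrable_ae mC integrable_pabs; apply: filterS => x H cx.
by have := H cx; rewrite ge0_fin_numE// pabs_ge0.
Qed.

(** The series of absolute values [pabs d] is integrable and dominates all partial sums at once. *)
Lemma psum_dominated (phi : R -> R) (M : R) : measurable_fun circle phi ->
  (forall x, circle x -> `|phi x| <= M) ->
  mint (fun x => psum d x * phi x) /\
  (fun N => \int[mu]_(x in circle) (rsum d N (node N x) * phi x)) @ \oo -->
    \int[mu]_(x in circle) (psum d x * phi x).
Proof.
move=> mphi phiM.
pose f_ N x := (rsum d N (node N x) * phi x)%:E.
pose g x := (`|M|%:E * pabs d x)%E.
have mf_ N : measurable_fun circle (f_ N).
  apply/measurable_EFinP; apply: measurable_funM => //.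
  exact: (measurable_node hdelta (rsum d N)).
have mf : measurable_fun circle (fun x => (psum d x * phi x)%:E).
  by apply/measurable_EFinP; apply: measurable_funM => //; exact: measurable_psum.
have f_f : {ae mu, forall x, circle x ->
    f_ ^~ x @ \oo --> (psum d x * phi x)%:E}.
  apply: (@filterS _ _ (ae_filter_ringOfSetsType mu) _ _ _ pabs_ae) => x H cx.
  apply: cvg_EFin; first exact: nearW.
  by apply: cvgM; [exact: psum_cvg (H cx)|exact: cvg_cst].
have ig : mu.-integrable circle g by exact: integrableZl integrable_pabs.
have f_g : {ae mu, forall x N, circle x -> (`|f_ N x| <= g x)%E}.
  apply: aeW => x N cx; rewrite /f_ /g /= normrM mulrC EFinM.
  apply: lee_pmul; rewrite ?lee_fin//.
    exact: le_trans (phiM _ cx) (ler_norm _).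
  exact: rsum_pabs.
have [i1 _ i3] := dominated_convergence mC mf_ mf f_f ig f_g.
split=> //; apply: fine_cvg.
by rewrite fineK//; exact: integrable_fin_num.
Qed.

Lemma psum_abs_le : (\int[mu]_(x in circle) `|psum d x|%:E <= (2 * pi * K)%:E)%E.
Proof.
apply: le_trans integral_pabs; apply: ae_ge0_le_integral => //.
- by apply/measurable_EFinP; apply: measurableT_comp => //; exact: measurable_psum.
- by move=> x _; exact: pabs_ge0.
- exact: measurable_pabs.
apply: (@filterS _ _ (ae_filter_ringOfSetsType mu) _ _ _ pabs_ae) => x H cx.
exact: psum_le (H cx).
Qed.

End PathSeries.

(** * The scale of Psi_0 *)

Section LogScale.
Context {R : realType}.
Implicit Types (r s t u v : R).

Definition psi r : R := r / ln (expR 1 + r).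

Lemma ln_e_ge1 r : 0 <= r -> 1 <= ln (expR 1 + r).
Proof.
move=> r0; rewrite -{1}(expRK (1 : R)) ler_ln ?posrE ?expR_gt0//.
  by rewrite lerDl.
by rewrite ltr_wpDr ?expR_gt0.
Qed.

Lemma ln_e_mono r s : 0 <= r -> r <= s -> ln (expR 1 + r) <= ln (expR 1 + s).
Proof.
move=> r0 rs; have e0 := expR_gt0 (1 : R).
by rewrite ler_ln ?posrE ?lerD2l//; lra.
Qed.

Lemma psi_ge0 r : 0 <= r -> 0 <= psi r.
Proof. by move=> r0; have := ln_e_ge1 r0 => h; rewrite divr_ge0//; lra. Qed.

Lemma psi_le r : 0 <= r -> psi r <= r.
Proof.
by move=> r0; have h := ln_e_ge1 r0; rewrite ler_pdivrMr ?ler_peMr//; lra.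
Qed.

(** From [ln (1 + z) <= z], the logarithm grows by at most [(s - r) / (e + r)]. Multiplied by [r]
    this is at most [s - r], hence at most [s - r] times the logarithm at [r], which is at least
    [1]. *)
Lemma psi_mono r s : 0 <= r -> r <= s -> psi r <= psi s.
Proof.
move=> r0 rs; have s0 : 0 <= s by lra.
have Lr := ln_e_ge1 r0; have Ls := ln_e_ge1 s0; have e1 := expR_ge1Dx (1 : R).
have e0 : 0 < expR 1 + r by lra.
have ratio : expR 1 + s = (expR 1 + r) * (1 + (s - r) / (expR 1 + r)).
  by rewrite mulrDr mulr1 mulrCA divff ?mulr1 ?gt_eqF//; lra.
have q0 : 0 <= (s - r) / (expR 1 + r) by rewrite divr_ge0//; lra.
have L : ln (expR 1 + s) <= ln (expR 1 + r) + (s - r) / (expR 1 + r).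
  by rewrite ratio lnM ?posrE// ?lerD2l ?le_ln1Dx//; lra.
have rq : r * ((s - r) / (expR 1 + r)) <= s - r.
  rewrite mulrA ler_pdivrMr// mulrC ler_wpM2l//; lra.
rewrite /psi ler_pdivrMr; last by lra.
rewrite mulrAC ler_pdivlMr; last by lra.
apply: le_trans (ler_wpM2l r0 L) _; rewrite mulrDr.
have : 0 <= (s - r) * (ln (expR 1 + r) - 1) by rewrite mulr_ge0//; lra.
by lra.
Qed.

(** Each summand of the numerator is divided by a larger logarithm on the left than on the right. *)
Lemma psiD r s : 0 <= r -> 0 <= s -> psi (r + s) <= psi r + psi s.
Proof.
move=> r0 s0; rewrite /psi mulrDl.
have Lr := ln_e_ge1 r0; have Ls := ln_e_ge1 s0.
have h1 : ln (expR 1 + r) <= ln (expR 1 + (r + s)) by apply: ln_e_mono => //; lra.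
have h2 : ln (expR 1 + s) <= ln (expR 1 + (r + s)) by apply: ln_e_mono => //; lra.
by apply: lerD; rewrite ler_wpM2l// lef_pV2 ?posrE//; lra.
Qed.

Lemma psiZ (c : R) t : 1 <= c -> 0 <= t -> psi (c * t) <= c * psi t.
Proof.
move=> c1 t0; rewrite /psi mulrA ler_wpM2l ?mulr_ge0//; first by lra.
have ct : t <= c * t by rewrite ler_peMl.
have := ln_e_mono t0 ct; have := ln_e_ge1 t0 => h1 h2.
by rewrite lef_pV2 ?posrE//; lra.
Qed.

(** Let [L = ln (e + u v)]. If [v <= L] the logarithm cancels [v] and [u] remains; otherwise
    [e + u v < expR v], and [psi (u v) <= u v] is already enough. *)
Lemma psi_young u v : 0 <= u -> 0 <= v -> psi (u * v) <= u + (expR v - 1).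
Proof.
move=> u0 v0; have uv0 : 0 <= u * v by rewrite mulr_ge0.
have L1 := ln_e_ge1 uv0; have e1 := expR_ge1Dx (1 : R); have ev := expR_ge1Dx v.
have [vL|Lv] := leP v (ln (expR 1 + u * v)).
  apply: (@le_trans _ _ u); last by lra.
  by rewrite /psi ler_pdivrMr ?ler_wpM2l//; lra.
apply: le_trans (psi_le uv0) _.
have : expR (ln (expR 1 + u * v)) <= expR v by rewrite ler_expR ltW.
by rewrite lnK ?posrE//; lra.
Qed.

(** Convexity of the exponential on [[0, w]]: the bounds [expR (e w) (1 + (1 - e) w) <= expR w] and
    [expR (e w) (1 - e w) <= 1] are added with weights [e] and [1 - e]. *)
Lemma expR_convex01 (e w : R) : 0 <= e <= 1 -> 0 <= w ->
  expR (e * w) - 1 <= e * (expR w - 1).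
Proof.
move=> /andP[e0 e1] w0.
have E : expR w = expR (e * w) * expR ((1 - e) * w).
  by rewrite -expRD; congr expR; lra.
have h1 := expR_ge1Dx ((1 - e) * w).
have h2 := expR_ge1Dx (- (e * w)); rewrite expRN in h2.
have p := expR_gt0 (e * w).
have h3 : expR (e * w) * (1 - e * w) <= 1.
  by rewrite -ler_pdivlMl// mulr1; lra.
have h4 : expR (e * w) * (1 + (1 - e) * w) <= expR w by rewrite E ler_pM2l.
have : (1 - e) * (expR (e * w) * (1 - e * w)) <= (1 - e) * 1 by rewrite ler_wpM2l//; lra.
have : e * (expR (e * w) * (1 + (1 - e) * w)) <= e * expR w by rewrite ler_wpM2l.
by lra.
Qed.

Lemma psi_continuous r : 0 <= r -> {for r, continuous psi}.
Proof.
move=> r0; have L1 := ln_e_ge1 r0; have e0 := expR_gt0 (1 : R).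
apply: cvgM; first exact: cvg_id.
apply: cvgV; first by rewrite gt_eqF//; lra.
apply: (@continuous_comp _ _ _ (fun x => expR 1 + x) (@ln R)).
  by apply: cvgD; [exact: cvg_cst|exact: cvg_id].
by apply: continuous_ln; lra.
Qed.

(** Needed where the square function is infinite, since [Psi0] is [+oo] there. *)
Lemma psi_unbounded (A : R) : exists2 r, 0 <= r & A <= psi r.
Proof.
have e1 := expR_ge1Dx (1 : R).
(* With this [r] the logarithm in [psi r] is [t], and the choice of [t] makes
   [expR t >= 1 + t^2 / 2] equal to [expR t >= 1 + (|A| + e) t]. *)
pose t := 2 * (`|A| + expR 1); pose r := expR t - expR 1.
have t1 : 1 <= t by rewrite /t; have := normr_ge0 A; lra.
have r0 : 0 <= r by rewrite subr_ge0 ler_expR.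
exists r => //; rewrite /psi [expR 1 + r]addrC subrK expRK ler_pdivlMr; last by lra.
have := @expR_ge1Dxn R t 1; rewrite (_ : 2`!%:R = 2)// => h.
have {}h : 1 + t ^+ 2 / 2 <= expR t by apply: h; lra.
have : t ^+ 2 / 2 = (`|A| + expR 1) * t by rewrite /t; lra.
have : A * t <= `|A| * t by rewrite ler_wpM2r ?ler_norm//; lra.
have : expR 1 * 1 <= expR 1 * t by rewrite ler_wpM2l//; lra.
by rewrite /r; lra.
Qed.

Lemma Psi0_cvg (s : nat -> R) (S : \bar R) : (forall n, 0 <= s n) ->
  (fun n => (s n)%:E) @ \oo --> S -> (fun n => (psi (s n))%:E) @ \oo --> Psi0 S.
Proof.
move=> s0; case: S => [r||] h.
- have {}h : s @ \oo --> r by move/fine_cvgP: h => [].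
  have r0 : 0 <= r by apply: cvgr_to_ge h _; exact: nearW.
  apply: cvg_EFin; first exact: nearW.
  exact: (cvg_comp _ _ h (psi_continuous r0)).
- apply/cvgeyPge => A; have [r r0 Ar] := psi_unbounded A.
  move/cvgeyPge: h => /(_ r); apply: filterS => n; rewrite !lee_fin => rs.
  exact: le_trans Ar (psi_mono r0 rs).
- exfalso; move/cvgeNyPle: h => /(_ (-1)) [N _ /(_ N (leqnn N))].
  by rewrite /= lee_fin; have := s0 N; lra.
Qed.

End LogScale.

(** * The off-diagonal part in the scale of [Psi_0] *)

Section LogEstimate.
Context {R : realType}.
Variable delta : R.
Hypothesis hdelta : 0 <= delta < 1.
Implicit Types (x y : R) (f b : R -> R[i]) (d : nat -> nat -> R[i]).
Local Notation mu := (@lebesgue_measure R).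
Local Notation node := (node delta).
Local Notation mean := (mean delta).
Local Notation cmean := (cmean delta).
Local Notation cdel := (cdel delta).

Lemma integral_Psi0_le (c : R[i]) d (l T : R) : 0 < l ->
  (forall N, tavg N (fun m => psi (l^-1 * (normc c + Num.sqrt (qsum d N m)))) <= T) ->
  (\int[mu]_(x in circle) Psi0 ((l^-1)%:E * square_fun delta (tree_coll c d) x)
     <= (2 * pi * T)%:E)%E.
Proof.
move=> l0 HT; have li : 0 <= l^-1 by rewrite invr_ge0 ltW.
pose F N m := psi (l^-1 * (normc c + Num.sqrt (qsum d N m))).
have F0 N m : 0 <= F N m.
  by rewrite psi_ge0// mulr_ge0// addr_ge0 ?normc_ge0 ?sqrtr_ge0.
have cv x : circle x -> (fun N => (F N (node N x))%:E) @ \oo -->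
    Psi0 ((l^-1)%:E * square_fun delta (tree_coll c d) x)%E.
  move=> cx; apply: Psi0_cvg => [N|].
    by rewrite mulr_ge0// addr_ge0 ?normc_ge0 ?sqrtr_ge0.
  under eq_fun do rewrite EFinM.
  by apply: cvgeZl => //; exact: square_fun_cvg.
have -> : (\int[mu]_(x in circle) Psi0 ((l^-1)%:E * square_fun delta (tree_coll c d) x) =
    \int[mu]_(x in circle) limn (fun N => (F N (node N x))%:E))%E.
  by apply: eq_integral => x; rewrite inE => cx; apply/esym/cvg_lim => //; exact: cv.
rewrite monotone_convergence.
- apply: lime_le.
    apply: ereal_nondecreasing_is_cvgn; apply/nondecreasing_seqP => N.
    apply: ge0_le_integral => //.
    + exact: measurable_circle.
    + by move=> x _; rewrite lee_fin.
    + exact: (measurable_node hdelta (fun m => (F N m)%:E)).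
    + exact: (measurable_node hdelta (fun m => (F N.+1 m)%:E)).
    + move=> x cx; rewrite lee_fin psi_mono// ?mulr_ge0 ?addr_ge0 ?normc_ge0 ?sqrtr_ge0//.
      by rewrite ler_wpM2l// lerD2l ler_wsqrtr// (qsum_incr hdelta d cx).
  apply: nearW => N; rewrite (integral_node hdelta (F := F N))//.
  rewrite lee_fin ler_pM2l ?mulr_gt0 ?pi_gt0//; exact: HT.
- exact: measurable_circle.
- by move=> N; exact: (measurable_node hdelta (fun m => (F N m)%:E)).
- by move=> N x _; rewrite lee_fin.
- move=> x cx m n mn; rewrite lee_fin psi_mono// ?mulr_ge0 ?addr_ge0 ?normc_ge0 ?sqrtr_ge0//.
  by rewrite ler_wpM2l// lerD2l ler_wsqrtr// (qsum_incr hdelta d cx).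
Qed.

(* The jumps of the martingale [E_N f * E_N b - sum_(k < N) d_k f * d_k b]. *)
Definition para f b k m : R[i] := cdel f k m * cmean b k m + cmean f k m * cdel b k m.

Lemma rsum_rmax_le (q x : nat -> nat -> R) N m : (m < 2 ^ N)%N ->
  (forall k m, (m < 2 ^ k)%N -> 0 <= q k m) ->
  rsum (fun k m => x k m ^+ 2 * q k m) N m <= rmax x N m ^+ 2 * rsum q N m.
Proof.
move=> mN q0; elim: N m mN => [|N IH] m mN; first by rewrite mulr0.
rewrite !rsumS; have := IH _ (half_lt mN).
have Q0 := rsum_ge0 q0 (half_lt mN); have qm := q0 _ _ (half_lt mN).
have h1 := rmax_half x N m; have h2 := rmax_ge x N m./2.
have h3 : rmax x N m./2 ^+ 2 <= rmax x N.+1 m ^+ 2.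
  by rewrite ler_sqr ?nnegrE ?rmax_ge0.
have h4 : x N m./2 ^+ 2 <= rmax x N.+1 m ^+ 2.
  rewrite -[x N m./2 ^+ 2]ger0_norm ?sqr_ge0// normrX ler_sqr ?nnegrE ?rmax_ge0//.
  exact: le_trans h2 h1.
move: (rmax x N m./2 ^+ 2) (rmax x N.+1 m ^+ 2) (x N m./2 ^+ 2) h3 h4 => X0 X1 y h3 h4.
move: (rsum q N _) (q N _) Q0 qm => Q e Q0 e0 h.
have : X0 * Q <= X1 * Q by rewrite ler_wpM2r.
have : y * e <= X1 * e by rewrite ler_wpM2r.
by lra.
Qed.

(** Here [p] is the real or the imaginary part: the maximal inequalities on the tree concern real
    martingales. *)
Definition maxmean (p : R[i] -> R) b N m : R := rmax (fun k m => p (cmean b k m)) N m.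

Definition paraq (p : R[i] -> R) f b N m : R :=
  Num.sqrt (rsum (fun k m => (p (cmean f k m) * normc (cdel b k m)) ^+ 2) N m).

(** Each jump splits into four products with real or imaginary parts of means; the square of a sum
    of four is at most four times the sum of squares, which gives the factor [2] outside the
    root. *)
Lemma sqrt_qsum_para f b N m : (m < 2 ^ N)%N ->
  Num.sqrt (qsum (para f b) N m) <=
  2 * (Num.sqrt (qsum (cdel f) N m) * maxmean (@complex.Re R) b N m +
       Num.sqrt (qsum (cdel f) N m) * maxmean (@complex.Im R) b N m +
       (paraq (@complex.Re R) f b N m + paraq (@complex.Im R) f b N m)).
Proof.
move=> mN; pose M p := maxmean p b N m; pose P p := paraq p f b N m.
rewrite -!/(M _) -!/(P _); set s := Num.sqrt (qsum (cdel f) N m).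
have s0 : 0 <= s by exact: sqrtr_ge0.
have M0 p : 0 <= M p by exact: rmax_ge0.
have P0 p : 0 <= P p by exact: sqrtr_ge0.
pose q k m := normc (cdel f k m) ^+ 2.
have q0 k i : (i < 2 ^ k)%N -> 0 <= q k i by move=> _; exact: sqr_ge0.
have ss : s ^+ 2 = rsum q N m by rewrite sqr_sqrtr// qsum_ge0.
have PP p : P p ^+ 2 = rsum (fun k m => (p (cmean f k m) * normc (cdel b k m)) ^+ 2) N m.
  by rewrite sqr_sqrtr// rsum_ge0// => *; exact: sqr_ge0.
have MM p : rsum (fun k m => p (cmean b k m) ^+ 2 * q k m) N m <= M p ^+ 2 * s ^+ 2.
  by rewrite ss; exact: (@rsum_rmax_le q (fun k m => p (cmean b k m))).
set U := 2 * _; have U0 : 0 <= U by rewrite /U !(addr_ge0, mulr_ge0).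
rewrite -[U]ger0_norm// -sqrtr_sqr ler_wsqrtr//.
apply: (@le_trans _ _ (4 * (rsum (fun k m => complex.Re (cmean b k m) ^+ 2 * q k m) N m +
   rsum (fun k m => complex.Im (cmean b k m) ^+ 2 * q k m) N m +
   (P (@complex.Re R) ^+ 2 + P (@complex.Im R) ^+ 2)))).
  rewrite !PP -!rsumD -rsumZ /qsum; apply: rsum_le => // k i ik.
  apply: (@le_trans _ _ ((`|complex.Re (cmean b k i)| * normc (cdel f k i) +
    `|complex.Im (cmean b k i)| * normc (cdel f k i) +
    (`|complex.Re (cmean f k i)| * normc (cdel b k i) +
    `|complex.Im (cmean f k i)| * normc (cdel b k i))) ^+ 2)).
    rewrite ler_sqr ?nnegrE ?normc_ge0 ?addr_ge0 ?mulr_ge0 ?normc_ge0//.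
    apply: le_trans (le_normcD _ _) _; rewrite !normcM -!mulrDl.
    rewrite [normc (cdel f k i) * _]mulrC.
    by apply: lerD; rewrite ler_wpM2r ?normc_ge0 ?normc_leD.
  have E (t : R) : t ^+ 2 = `|t| ^+ 2 by rewrite -normrX ger0_norm ?sqr_ge0.
  cbv beta; rewrite /q; move: (complex.Re (cmean b k i)) (complex.Im (cmean b k i))
    (complex.Re (cmean f k i)) (complex.Im (cmean f k i)) => c1 c2 c3 c4.
  move: (normc _) (normc _) => n1 n2.
  rewrite !exprMn (E c1) (E c2) (E c3) (E c4) -!exprMn.
  move: (_ * _) (_ * _) (_ * _) (_ * _) => a1 a2 a3 a4.
  have := sqr_ge0 (a1 - a2); have := sqr_ge0 (a3 - a4).
  by have := sqr_ge0 (a1 + a2 - a3 - a4); lra.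
have h1 := MM (@complex.Re R); have h2 := MM (@complex.Im R).
move: h1 h2 (P0 (@complex.Re R)) (P0 (@complex.Im R)) (M0 (@complex.Re R)) (M0 (@complex.Im R)).
rewrite /U; move: (rsum _ N m) (rsum _ N m) (P _) (P _) (M _) (M _) => r1 r2 p1 p2 m1 m2.
move=> h1 h2 p10 p20 m10 m20.
have : 0 <= (s * m1) * (s * m2) by rewrite !mulr_ge0.
have : 0 <= (s * m1) * p1 by rewrite !mulr_ge0.
have : 0 <= (s * m1) * p2 by rewrite !mulr_ge0.
have : 0 <= (s * m2) * p1 by rewrite !mulr_ge0.
have : 0 <= (s * m2) * p2 by rewrite !mulr_ge0.
have : 0 <= p1 * p2 by rewrite !mulr_ge0.
by lra.
Qed.

(** The constant [128 = 2 * 16 * 4] lets [2 s M] over the normalisation factor as [s / (16 A)] times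
    [M / (4 B) / 32^2]. For the real and imaginary parts together, [s] then contributes at most
    [2/16] and the exponentials at most [2/8]; the mean and the paraproducts add at most
    [41 / (128 * 32^2)]. The sum stays below [1]. *)
Lemma tavg_psi_para f b A B N : 0 < A -> 0 < B -> h1_le delta A f ->
  bmo_le delta B b -> normc (cmean b 0 0) <= B ->
  tavg N (fun m => psi ((128 * (32 * 32) * A * B)^-1 *
    (normc (cmean f 0 0 * cmean b 0 0) + Num.sqrt (qsum (para f b) N m)))) <= 1.
Proof.
move=> A0 B0 [L1f fA0 fA] [sb vB] b0.
have L1b := csqint_L1 sb.
pose l := 128 * (32 * 32) * A * B; have l0 : 0 < l by rewrite !mulr_gt0.
rewrite -/l.
pose s m := Num.sqrt (qsum (cdel f) N m).
pose M (p : R[i] -> R) m := maxmean p b N m.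
pose P (p : R[i] -> R) m := paraq p f b N m.
pose w p m := expR (M p m / (4 * B)) - 1.
have M0 p m : 0 <= M p m by exact: rmax_ge0.
have P0 p m : 0 <= P p m by exact: sqrtr_ge0.
have s0 m : 0 <= s m by exact: sqrtr_ge0.
(* The factor [1 / 32^2] in front of the exponent brings the mean of [w], which
   is at most 128, below [1 / 8], see [expR_convex01]. *)
have sM m p : psi (l^-1 * (2 * (s m * M p m))) <= (16 * A)^-1 * s m + (32 * 32)^-1 * w p m.
  have -> : l^-1 * (2 * (s m * M p m)) =
      ((16 * A)^-1 * s m) * ((32 * 32)^-1 * (M p m / (4 * B))).
    rewrite /l; move: (s m) (M p m) => sm mp; field.
    by rewrite !gt_eqF.
  have v0 : 0 <= M p m / (4 * B) by rewrite divr_ge0// mulr_ge0// ltW.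
  apply: le_trans (psi_young _ _) _.
  - by rewrite mulr_ge0// invr_ge0 mulr_ge0// ltW.
  - by rewrite mulr_ge0// invr_ge0.
  by rewrite lerD2l; apply: expR_convex01 => //; apply/andP; split; lra.
have li : 0 <= l^-1 by rewrite invr_ge0 ltW.
set c := normc _.
have c0 : 0 <= c by exact: normc_ge0.
apply: (@le_trans _ _ (tavg N (fun m => l^-1 * c + (
   ((16 * A)^-1 * s m + (32 * 32)^-1 * w (@complex.Re R) m) +
   ((16 * A)^-1 * s m + (32 * 32)^-1 * w (@complex.Im R) m) +
   (l^-1 * 2) * (P (@complex.Re R) m + P (@complex.Im R) m))))).
  apply: tavg_le => m mN.
  have h := sqrt_qsum_para f b mN.
  set S := Num.sqrt _ in h *; have S0 : 0 <= S by exact: sqrtr_ge0.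
  have := sM m (@complex.Re R); have := sM m (@complex.Im R).
  have := M0 (@complex.Re R) m; have := M0 (@complex.Im R) m.
  have := P0 (@complex.Re R) m; have := P0 (@complex.Im R) m.
  move: h; rewrite -/(s m) -/(M (@complex.Re R) m) -/(M (@complex.Im R) m)
    -/(P (@complex.Re R) m) -/(P (@complex.Im R) m).
  move: (M (@complex.Re R) m) (M (@complex.Im R) m) (P (@complex.Re R) m)
    (P (@complex.Im R) m) (w (@complex.Re R) m) (w (@complex.Im R) m)
    (s m) (s0 m) => m1 m2 p1 p2 w1 w2 sm sm0 h p20 p10 m20 m10 k2 k1.
  have x1 : 0 <= l^-1 * (2 * (sm * m1)) by rewrite !mulr_ge0.
  have x2 : 0 <= l^-1 * (2 * (sm * m2)) by rewrite !mulr_ge0.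
  have x3 : 0 <= l^-1 * 2 * (p1 + p2) by rewrite !mulr_ge0 ?addr_ge0.
  have x4 : 0 <= l^-1 * c by rewrite mulr_ge0.
  apply: (@le_trans _ _ (psi (l^-1 * c + (l^-1 * (2 * (sm * m1)) +
     l^-1 * (2 * (sm * m2)) + l^-1 * 2 * (p1 + p2))))).
    apply: psi_mono; first by rewrite mulr_ge0// addr_ge0.
    apply: le_trans (ler_wpM2l li (lerD (lexx c) h)) _.
    by rewrite le_eqVlt; apply/orP; left; apply/eqP; ring.
  apply: le_trans (psiD x4 (addr_ge0 (addr_ge0 x1 x2) x3)) _.
  apply: lerD; first exact: psi_le.
  apply: le_trans (psiD (addr_ge0 x1 x2) x3) _.
  apply: lerD; last exact: psi_le.
  by apply: le_trans (psiD x1 x2) _; exact: lerD.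
have Es : tavg N s <= A by exact: fA.
have Ew (p : R[i] -> R) : (forall z, `|p z| <= normc z) ->
    (forall z u, p (z + u) = p z + p u) -> (forall z, p (- z) = - p z) ->
    tavg N (w p) <= 128.
  move=> pn pD pN; rewrite tavgB tavg_cst.
  have h : tavg N (fun m => expR (M p m / (4 * B))) <=
      64 * expR (`|p (cmean b 0 0)| / (4 * B)).
    apply: (@john_nirenberg_max R (fun k m => p (cmean b k m)) (cvar delta b)) => // k m mk.
    - by rewrite cmean_left cdel_right// (pD _ (cdel b k m)) (pD _ (- cdel b k m)) pN; lra.
    - by rewrite cvar_ge0 ?vB.
    rewrite cmean_left pD addrAC subrr add0r -(cvar_split hdelta sb mk) lerD2r ler_pM2l//.
    by rewrite -[p _ ^+ 2]ger0_norm ?sqr_ge0// normrX ler_sqr ?nnegrE ?normc_ge0.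
  have : expR (`|p (cmean b 0 0)| / (4 * B)) <= 2.
    have q1 : `|p (cmean b 0 0)| / (4 * B) <= 4^-1.
      rewrite ler_pdivrMr ?mulr_gt0//; apply: le_trans (pn _) _; apply: le_trans b0 _.
      by lra.
    apply: (@le_trans _ _ (expR 4^-1)); first by rewrite ler_expR.
    by have := @expR_le_quad R 4^-1; rewrite ger0_norm// => /(_ _)/le_trans; apply; lra.
  move=> h2; apply: (@le_trans _ _ (64 * 2 - 1)); last by lra.
  by rewrite lerB//; apply: le_trans h _; rewrite ler_pM2l.
have EP (p : R[i] -> R) : (forall z, `|p z| <= normc z) ->
    (forall z u, p (z + u) = p z + p u) -> (forall z, p (- z) = - p z) ->
    tavg N (P p) <= 10 * (A * B).
  move=> pn pD pN.
  have h : tavg N (P p) <= B * (`|p (cmean f 0 0)| + 9 * A).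
    apply: (@paraproduct R (fun k m => normc (cdel f k m)) A _ fA
      (fun k m => p (cmean f k m)) (fun k m => normc (cdel b k m)) (cvar delta b)) => // k m mk.
    - exact: normc_ge0.
    - by rewrite cmean_left pD addrAC subrr add0r.
    - by rewrite cmean_left cdel_right// (pD _ (cdel f k m)) (pD _ (- cdel f k m)) pN; lra.
    - by rewrite cvar_ge0 ?vB.
    - by rewrite cvar_split.
  apply: le_trans h _.
  have : `|p (cmean f 0 0)| <= A by exact: le_trans (pn _) fA0.
  by move=> h; have := ler_wpM2l (ltW B0) h; lra.
have cAB : c <= A * B.
  by rewrite /c normcM ler_pM ?normc_ge0.
have lc : l^-1 * c <= (128 * (32 * 32))^-1.
  rewrite mulrC ler_pdivrMr//; apply: le_trans cAB _; rewrite /l; lra.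
have lP (p : R) : p <= 20 * (A * B) -> l^-1 * 2 * p <= 40 / (128 * (32 * 32)).
  move=> h; rewrite -mulrA mulrC ler_pdivrMr// /l; lra.
have sA : (16 * A)^-1 * tavg N s <= 16^-1.
  by rewrite mulrC ler_pdivrMr ?mulr_gt0//; lra.
have w1 := Ew (@complex.Re R) (@normc_geRe R) (@cReD R) (@cReN R).
have w2 := Ew (@complex.Im R) (@normc_geIm R) (@cImD R) (@cImN R).
have P1 := EP (@complex.Re R) (@normc_geRe R) (@cReD R) (@cReN R).
have P2 := EP (@complex.Im R) (@normc_geIm R) (@cImD R) (@cImN R).
have hs : tavg N (P (@complex.Re R)) + tavg N (P (@complex.Im R)) <= 20 * (A * B) by lra.
move: {lP}(lP _ hs) lc sA w1 w2; clear sM Ew EP; clearbody w.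
rewrite !tavgD !tavgZ !tavgD tavg_cst.
move: (tavg N (w _)) (tavg N (w _)) (_ * c) ((16 * A)^-1 * _) (_ * 2 * _).
by clear; move=> W1 W2 c1 s1 p1; lra.
Qed.

End LogEstimate.

(** * The operators S and T *)

Section Operators.
Context {R : realType}.
Variable delta : R.
Hypothesis hdelta : 0 <= delta < 1.
Implicit Types (x y K M A B : R) (f g b phi : R -> R[i]).
Local Notation mu := (@lebesgue_measure R).
Local Notation mint h := (mu.-integrable circle (fun x => (h x)%:E)).
Local Notation node := (node delta).
Local Notation cmean := (cmean delta).
Local Notation cdel := (cdel delta).
Local Notation bmo_le := (bmo_le delta).
Local Notation h1_le := (h1_le delta).
Local Notation tame := (tame delta).
Local Notation psum := (psum delta).
Local Notation pabs := (pabs delta).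
Let mC := @measurable_circle R.

Definition diag (p : R[i] -> R) f b k m : R := p (cdel f k m * cdel b k m).

Definition Spart f b N x : R[i] := \sum_(k < N) cdel f k (node k x) * cdel b k (node k x).

Definition Sop f b x : R[i] :=
  Complex (psum (diag (@complex.Re R) f b) x) (psum (diag (@complex.Im R) f b) x).

Lemma diagC p f b : diag p f b = diag p b f.
Proof. by apply/funext => k; apply/funext => m; rewrite /diag mulrC. Qed.

(** Serves to deduce linearity in [b] of the integrals against test functions from linearity in
    [f]. *)
Lemma SopC f b : Sop f b = Sop b f.
Proof. by apply/funext => x; rewrite /Sop !(diagC _ f). Qed.

Definition Top f b phi : R[i] :=
  pairing delta f (fun x => phi x * b x) - dist_of_fun (Sop f b) phi.

(** All that [S(f, b)] requires. Unlike the pair of norm bounds it comes from, this condition is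
    symmetric in [f] and [b]. *)
Definition prod_le K f b : Prop := [/\ inL1 f, inL1 b &
  forall N, tavg N (rsum (fun k m => normc (cdel f k m) * normc (cdel b k m)) N) <= K].

Lemma prod_le_duality A B f b : h1_le A f -> bmo_le B b -> 0 <= B ->
  prod_le (2 * B * A) f b.
Proof.
move=> fA bB B0; split; [by case: fA|exact: csqint_L1 bB.1|].
by move=> N; exact: duality.
Qed.

Lemma prod_leC K f b : prod_le K f b -> prod_le K b f.
Proof.
move=> [L1f L1b H]; split=> // N; apply: le_trans (H N); apply: tavg_le => m mN.
by apply: rsum_le => // *; rewrite mulrC.
Qed.

Lemma prod_le_lin (a : R[i]) K1 K2 f1 f2 b : prod_le K1 f1 b -> prod_le K2 f2 b ->
  prod_le (normc a * K1 + K2) (fun x => a * f1 x + f2 x) b.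
Proof.
move=> [L1 Lb H1] [L2 _ H2]; split=> //; first exact: inL1_lin.
move=> N; apply: le_trans (lerD (ler_wpM2l (normc_ge0 a) (H1 N)) (H2 N)).
rewrite -tavgZ -tavgD; apply: tavg_le => m mN; rewrite -rsumZ -rsumD.
apply: rsum_le => // k i ik; rewrite cdel_lin// mulrA -mulrDl.
rewrite ler_wpM2r ?normc_ge0//; apply: le_trans (le_normcD _ _) _.
by rewrite normcM.
Qed.

Lemma prod_le_diag (p : R[i] -> R) K f b N : (forall z, `|p z| <= normc z) ->
  prod_le K f b -> tavg N (rsum (fun k m => `|diag p f b k m|) N) <= K.
Proof.
move=> pn [_ _ H]; apply: le_trans (H N); apply: tavg_le => m mN.
by apply: rsum_le => // *; rewrite -normcM; exact: pn.
Qed.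

Lemma additive_big (p : R[i] -> R) (F : nat -> R[i]) N : p 0 = 0 ->
  (forall z w, p (z + w) = p z + p w) -> p (\sum_(k < N) F k) = \sum_(k < N) p (F k).
Proof. by move=> p0 pD; rewrite (big_morph p pD p0). Qed.

Lemma Re_Spart f b N x : circle x ->
  complex.Re (Spart f b N x) = rsum (diag (@complex.Re R) f b) N (node N x).
Proof.
move=> cx; rewrite rsum_node//.
exact: (additive_big (fun k => cdel f k (node k x) * cdel b k (node k x)) N erefl (@cReD R)).
Qed.

Lemma Im_Spart f b N x : circle x ->
  complex.Im (Spart f b N x) = rsum (diag (@complex.Im R) f b) N (node N x).
Proof.
move=> cx; rewrite rsum_node//.
exact: (additive_big (fun k => cdel f k (node k x) * cdel b k (node k x)) N erefl (@cImD R)).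
Qed.

Lemma Sop_cvg f b x : circle x -> (pabs (diag (@complex.Re R) f b) x < +oo)%E ->
  (pabs (diag (@complex.Im R) f b) x < +oo)%E ->
  ccvg (fun N => Spart f b N x) (Sop f b x).
Proof.
move=> cx h1 h2; apply/ccvgP; split=> /=.
  by under eq_fun do rewrite Re_Spart//; exact: psum_cvg.
by under eq_fun do rewrite Im_Spart//; exact: psum_cvg.
Qed.

Lemma SopE f b x (l : R[i]) : circle x -> ccvg (fun N => Spart f b N x) l -> Sop f b x = l.
Proof.
move=> cx /ccvgP[h1 h2]; apply: complexP => /=; apply: psumE.
  by move: h1; under eq_fun do rewrite Re_Spart//.
by move: h2; under eq_fun do rewrite Im_Spart//.
Qed.

Lemma Sop_ae K f b : prod_le K f b ->
  {ae mu, forall x, circle x -> ccvg (fun N => Spart f b N x) (Sop f b x)}.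
Proof.
move=> fb.
have h1 := pabs_ae hdelta (fun N => prod_le_diag N (@normc_geRe R) fb).
have h2 := pabs_ae hdelta (fun N => prod_le_diag N (@normc_geIm R) fb).
apply: (@filterS2 _ _ (ae_filter_ringOfSetsType mu) _ _ _ _ h1 h2) => x H1 H2 cx.
exact: Sop_cvg (H1 cx) (H2 cx).
Qed.

Lemma Spart_linl (a : R[i]) f1 f2 b N x : circle x -> inL1 f1 -> inL1 f2 ->
  Spart (fun x => a * f1 x + f2 x) b N x = a * Spart f1 b N x + Spart f2 b N x.
Proof.
move=> cx L1 L2; rewrite /Spart mulr_sumr -big_split/=; apply: eq_bigr => k _.
by rewrite cdel_lin ?node_lt//; ring.
Qed.

Lemma Spart_linr (a : R[i]) f b1 b2 N x : circle x -> inL1 b1 -> inL1 b2 ->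
  Spart f (fun x => a * b1 x + b2 x) N x = a * Spart f b1 N x + Spart f b2 N x.
Proof.
move=> cx L1 L2; rewrite /Spart mulr_sumr -big_split/=; apply: eq_bigr => k _.
by rewrite cdel_lin ?node_lt//; ring.
Qed.

Lemma Sop_linl (a : R[i]) K1 K2 f1 f2 b : prod_le K1 f1 b -> prod_le K2 f2 b ->
  ae_circle (Sop (fun x => a * f1 x + f2 x) b) (fun x => a * Sop f1 b x + Sop f2 b x).
Proof.
move=> h1 h2.
apply: (@filterS2 _ _ (ae_filter_ringOfSetsType mu) _ _ _ _ (Sop_ae h1) (Sop_ae h2)).
move=> x H1 H2 cx; apply: SopE => //.
case: h1 => L1 _ _; case: h2 => L2 _ _.
under eq_fun do rewrite Spart_linl//.
exact: ccvg_lin (H1 cx) (H2 cx).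
Qed.

Lemma Sop_linr (a : R[i]) K1 K2 f b1 b2 : prod_le K1 f b1 -> prod_le K2 f b2 ->
  ae_circle (Sop f (fun x => a * b1 x + b2 x)) (fun x => a * Sop f b1 x + Sop f b2 x).
Proof.
move=> h1 h2.
apply: (@filterS2 _ _ (ae_filter_ringOfSetsType mu) _ _ _ _ (Sop_ae h1) (Sop_ae h2)).
move=> x H1 H2 cx; apply: SopE => //.
case: h1 => _ L1 _; case: h2 => _ L2 _.
under eq_fun do rewrite Spart_linr//.
exact: ccvg_lin (H1 cx) (H2 cx).
Qed.

Let rcvgB (u v : nat -> R) (l m : R) : u @ \oo --> l -> v @ \oo --> m ->
  (fun N => u N - v N) @ \oo --> l - m.
Proof. by move=> ul vm; exact: cvgB. Qed.

Let rcvgD (u v : nat -> R) (l m : R) : u @ \oo --> l -> v @ \oo --> m ->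
  (fun N => u N + v N) @ \oo --> l + m.
Proof. by move=> ul vm; exact: cvgD. Qed.

Lemma Sop_dist_cvg K M f b phi : prod_le K f b -> tame M phi ->
  ccvg (fun N => dist_of_fun (Spart f b N) phi) (dist_of_fun (Sop f b) phi).
Proof.
move=> fb [m1 m2 pM _].
have p1 x : circle x -> `|complex.Re (phi x)| <= M.
  by move=> cx; apply: le_trans (normc_geRe _) _; exact: pM.
have p2 x : circle x -> `|complex.Im (phi x)| <= M.
  by move=> cx; apply: le_trans (normc_geIm _) _; exact: pM.
have hR := fun N => prod_le_diag N (@normc_geRe R) fb.
have hI := fun N => prod_le_diag N (@normc_geIm R) fb.
have [iRR cRR] := psum_dominated hdelta hR m1 p1.
have [iRI cRI] := psum_dominated hdelta hR m2 p2.
have [iIR cIR] := psum_dominated hdelta hI m1 p1.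
have [iII cII] := psum_dominated hdelta hI m2 p2.
have int (d : nat -> nat -> R) (h : R -> R) N : measurable_fun circle h ->
    (forall x, circle x -> `|h x| <= M) -> mint (fun x => rsum d N (node N x) * h x).
  move=> mh hM; apply: (mint_node hdelta (rsum d N)).
  exact: mint_le mh (mint_cst M) hM.
apply/ccvgP; split.
  have -> : complex.Re (dist_of_fun (Sop f b) phi) =
    \int[mu]_(x in circle) (psum (diag (@complex.Re R) f b) x * complex.Re (phi x)) -
    \int[mu]_(x in circle) (psum (diag (@complex.Im R) f b) x * complex.Im (phi x)).
    by rewrite /= -RintegralB//; apply: eq_Rintegral => x _; rewrite cReM.
  have -> : (fun N => complex.Re (dist_of_fun (Spart f b N) phi)) = (fun N =>
    \int[mu]_(x in circle) (rsum (diag (@complex.Re R) f b) N (node N x) * complex.Re (phi x)) -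
    \int[mu]_(x in circle) (rsum (diag (@complex.Im R) f b) N (node N x) * complex.Im (phi x))).
    apply/funext => N; rewrite /= -RintegralB//; [|exact: int|exact: int].
    by apply: eq_Rintegral => x; rewrite inE => cx; rewrite cReM Re_Spart// Im_Spart.
  exact: (rcvgB cRR cII).
have -> : complex.Im (dist_of_fun (Sop f b) phi) =
  \int[mu]_(x in circle) (psum (diag (@complex.Re R) f b) x * complex.Im (phi x)) +
  \int[mu]_(x in circle) (psum (diag (@complex.Im R) f b) x * complex.Re (phi x)).
  by rewrite /= -RintegralD//; apply: eq_Rintegral => x _; rewrite cImM.
have -> : (fun N => complex.Im (dist_of_fun (Spart f b N) phi)) = (fun N =>
  \int[mu]_(x in circle) (rsum (diag (@complex.Re R) f b) N (node N x) * complex.Im (phi x)) +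
  \int[mu]_(x in circle) (rsum (diag (@complex.Im R) f b) N (node N x) * complex.Re (phi x))).
  apply/funext => N; rewrite /= -RintegralD//; [|exact: int|exact: int].
  by apply: eq_Rintegral => x; rewrite inE => cx; rewrite cImM Re_Spart// Im_Spart.
exact: (rcvgD cRI cIR).
Qed.

(** Exhibits the partial sum as a function of the node, so that [cint_node] evaluates its integral
    against a test function. *)
Lemma Spart_node f b N : exists F : nat -> R[i],
  (forall x, circle x -> Spart f b N x = F (node N x)) /\
  (forall m, (m < 2 ^ N)%N -> normc (F m) <=
     2 * rsum (fun k m => normc (cdel f k m) * normc (cdel b k m)) N m).
Proof.
exists (fun m => Complex (rsum (diag (@complex.Re R) f b) N m)
                         (rsum (diag (@complex.Im R) f b) N m)); split=> [x cx|m mN].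
  by apply: complexP; rewrite ?Re_Spart ?Im_Spart.
have H p : (forall z, `|p z| <= normc z) -> `|rsum (diag p f b) N m| <=
    rsum (fun k m => normc (cdel f k m) * normc (cdel b k m)) N m.
  move=> pn; elim: N m mN => [|N IH] m mN; first by rewrite normr0.
  rewrite !rsumS; apply: le_trans (ler_normD _ _) _.
  by apply: lerD; [exact: IH (half_lt mN)|rewrite -normcM; exact: pn].
apply: le_trans (normc_leD _) _ => /=.
have := H _ (@normc_geRe R); have := H _ (@normc_geIm R).
by move: (rsum _ N m) => *; lra.
Qed.

Lemma eq_cint (D : set R) f g : (forall x, D x -> f x = g x) -> cint D f = cint D g.
Proof.
by move=> fg; apply: complexP; apply: eq_Rintegral => x; rewrite inE => /fg ->.
Qed.

Lemma normc_cmean_tame M phi k m : 0 <= M -> tame M phi -> (m < 2 ^ k)%N ->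
  normc (cmean phi k m) <= 2 * M.
Proof.
move=> M0 tp mk; have [p1 p2] := tame_L1 tp; case: tp => _ _ pM _.
apply: le_trans (normc_leD _) _ => /=.
have H (h : R -> R) : mint h -> (forall x, circle x -> `|h x| <= M) ->
    `|mean delta h k m| <= M.
  move=> ih hM; have hb x : dyadic_arc delta k m x -> - M <= h x <= M.
    by move=> /(arcP hdelta x mk)[cx _]; rewrite -ler_norml; exact: hM.
  rewrite ler_norml; apply/andP; split.
    rewrite -(mean_cst hdelta (- M) mk); apply: mean_le => //; first exact: mint_cst.
    by move=> x /hb/andP[].
  rewrite -(mean_cst hdelta M mk); apply: mean_le => //; first exact: mint_cst.
  by move=> x /hb/andP[].
have h1 := H _ p1 (fun x cx => le_trans (normc_geRe _) (pM x cx)).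
have h2 := H _ p2 (fun x cx => le_trans (normc_geIm _) (pM x cx)).
by lra.
Qed.

Lemma Sop_dist_le K M f b phi : prod_le K f b -> 0 <= M -> tame M phi ->
  normc (dist_of_fun (Sop f b) phi) <= 2 * pi * (4 * K) * M.
Proof.
move=> fb M0 tp; apply: ccvg_bound (Sop_dist_cvg fb tp) _ => N.
have [F [SF FK]] := Spart_node f b N.
rewrite /dist_of_fun (eq_cint (g := fun x => F (node N x) * phi x)); last first.
  by move=> x cx; rewrite SF.
rewrite (cint_node hdelta F N (tame_L1 tp)) normcM normc_real.
rewrite ger0_norm ?mulr_ge0 ?pi_ge0// -mulrA ler_pM2l ?mulr_gt0 ?pi_gt0//.
apply: le_trans (normc_ctavg _ _) _; case: fb => _ _ HK.
(* The factor [4] is [2] from [Spart_node] times [2] from [normc_cmean_tame], both due to splitting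
   into real and imaginary parts. *)
apply: (@le_trans _ _ (tavg N (fun m => 4 * M * rsum (fun k m => normc (cdel f k m) * normc (cdel b k m)) N m))).
  apply: tavg_le => m mN; rewrite normcM.
  have h1 := FK m mN; have h2 := normc_cmean_tame M0 tp mN.
  apply: le_trans (ler_pM (normc_ge0 _) (normc_ge0 _) h1 h2) _.
  by rewrite le_eqVlt; apply/orP; left; apply/eqP; ring.
rewrite tavgZ; apply: le_trans (ler_wpM2l _ (HK N)) _; first by rewrite mulr_ge0.
by rewrite le_eqVlt; apply/orP; left; apply/eqP; ring.
Qed.

Lemma Sop_L1 A B f b : h1_le A f -> bmo_le B b -> 0 <= B ->
  inL1 (Sop f b) /\ (L1norm (Sop f b) <= (8 * pi * B * A)%:E)%E.
Proof.
move=> fA bB B0; have fb := prod_le_duality fA bB B0.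
have hR := fun N => prod_le_diag N (@normc_geRe R) fb.
have hI := fun N => prod_le_diag N (@normc_geIm R) fb.
have one x : circle x -> `|1 : R| <= 1 by rewrite normr1.
have [iR _] := psum_dominated hdelta hR (measurable_cst (1 : R)) one.
have [iI _] := psum_dominated hdelta hI (measurable_cst (1 : R)) one.
have {}iR : mint (psum (diag (@complex.Re R) f b)).
  by move: iR; under eq_fun do rewrite mulr1.
have {}iI : mint (psum (diag (@complex.Im R) f b)).
  by move: iI; under eq_fun do rewrite mulr1.
split; first by split.
have mR := mint_meas iR; have mI := mint_meas iI.
have ms : measurable_fun circle (fun x => (normc (Sop f b x))%:E).
  apply/measurable_EFinP; apply: (@measurableT_comp _ _ _ _ _ _ (@Num.sqrt R) _
    (fun x => psum (diag (@complex.Re R) f b) x ^+ 2 +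
              psum (diag (@complex.Im R) f b) x ^+ 2)).
    by apply: continuous_measurable_fun => t; exact: sqrt_continuous.
  by apply: measurable_funD; apply: measurable_funX.
have mn (h : R -> R) : measurable_fun circle h ->
    measurable_fun circle (fun x => `|h x|%:E).
  by move=> mh; apply/measurable_EFinP; apply: measurableT_comp.
apply: (@le_trans _ _ (\int[mu]_(x in circle)
   (`|psum (diag (@complex.Re R) f b) x|%:E + `|psum (diag (@complex.Im R) f b) x|%:E))%E).
  apply: ge0_le_integral => //.
  - by move=> x _; rewrite lee_fin normc_ge0.
  - by apply: emeasurable_funD; exact: mn.
  - by move=> x _; rewrite -EFinD lee_fin normc_leD.
rewrite ge0_integralD//; [|exact: mn|exact: mn].
(* Two parts, each at most [2 pi] times the bound [2 B A] of [duality]. *)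
apply: le_trans (leeD (psum_abs_le hdelta hR) (psum_abs_le hdelta hI)) _.
by rewrite -EFinD lee_fin le_eqVlt; apply/orP; left; apply/eqP; ring.
Qed.

End Operators.

(** * Partial sums of Haar expansions and properties of the pairing *)

Section HaarSums.
Context {R : realType}.
Variable delta : R.
Hypothesis hdelta : 0 <= delta < 1.
Implicit Types (x y : R) (f g b phi : R -> R[i]) (d : nat -> nat -> R[i]).
Local Notation mu := (@lebesgue_measure R).
Local Notation node := (node delta).
Local Notation cmean := (cmean delta).
Local Notation cdel := (cdel delta).
Local Notation bmo_le := (bmo_le delta).
Local Notation h1_le := (h1_le delta).
Local Notation tame := (tame delta).

(** The sign at [x] of the Haar function of the arc of generation [k] through [x]: even indices are
    left halves. *)
Definition side k x : R := (-1) ^+ odd (node k.+1 x).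

Lemma sideE k x : side k x = if odd (node k.+1 x) then -1 else 1.
Proof. by rewrite /side; case: odd; rewrite ?expr1 ?expr0. Qed.

Lemma node_odd k x : circle x ->
  node k.+1 x = if odd (node k.+1 x) then (node k x).*2.+1 else (node k x).*2.
Proof.
move=> cx; have := odd_double_half (node k.+1 x); rewrite nodeS//.
by case: odd => /= <-.
Qed.

Lemma cmean_step f k x : inL1 f -> circle x ->
  cmean f k.+1 (node k.+1 x) = cmean f k (node k x) + (side k x)%:C%C * cdel f k (node k x).
Proof.
move=> L1f cx; rewrite sideE [in LHS]node_odd//; case: odd.
  by rewrite cdel_right ?node_lt// rmorphN1 mulN1r.
by rewrite cmean_left rmorph1 mul1r.
Qed.

Definition path_node x (cx : circle x) k : dyadic :=
  existT _ k (Ordinal (node_lt hdelta k cx)).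

Lemma haar_path x (cx : circle x) k :
  haar delta (path_node cx k) x = (Num.sqrt (len k))^-1 * side k x.
Proof.
rewrite haarE//=; congr (_ * _); rewrite sideE [in LHS]node_odd//.
case: odd; first by rewrite eqxx (_ : _ == _ = false) ?sub0r//; lia.
by rewrite eqxx (_ : _ == _.+1 = false) ?subr0//; lia.
Qed.

Lemma haar_off_path x (cx : circle x) (I : dyadic) :
  I <> path_node cx (tag I) -> haar delta I x = 0.
Proof.
move=> Ix; rewrite haarE//.
have ni : (tagged I : nat) <> node (tag I) x.
  move=> e; apply: Ix; case: I e => k i /= e; congr existT.
  exact: val_inj.
have := nodeS hdelta (tag I) cx => h.
have -> : (node (tag I).+1 x == (tagged I).*2) = false.
  by apply/eqP => e; apply: ni; rewrite -h e doubleK.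
have -> : (node (tag I).+1 x == (tagged I).*2.+1) = false.
  by apply/eqP => e; apply: ni; rewrite -h e half_doubleS.
by rewrite subrr mulr0.
Qed.

(** The condition reads [2^k <= 2 pi 2^N] for [I] of generation [k], and [4 <= 2 pi < 8] makes it
    [k <= N + 2]. Truncation by length is thus truncation by generation with a shift of [3]. *)
Lemma arc_len_ge (I : dyadic) N : (2 ^- N <= arc_len delta I) = (tag I < N.+3)%N.
Proof.
have := pihalf_ge1 R; have := pihalf_lt2 R => p2 p1.
have N0 : 0 < 2 ^+ N :> R by rewrite exprn_gt0.
have k0 : 0 < 2 ^+ tag I :> R by rewrite exprn_gt0.
rewrite arc_lenE// /len ler_pdivlMr// mulrC ler_pdivrMr//.
have [kN|Nk] := ltnP (tag I) N.+3.
  have : 2 ^+ tag I <= 2 ^+ N.+2 :> R by rewrite ler_eXn2l// ltr1n.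
  rewrite 2!exprS => h; apply/idP; apply: le_trans h _.
  have : 0 <= (2 * pi - 4) * 2 ^+ N :> R by rewrite mulr_ge0 ?(ltW N0)//; lra.
  by lra.
have : 2 ^+ N.+3 <= 2 ^+ tag I :> R by rewrite ler_eXn2l// ltr1n.
rewrite 3!exprS => h; apply/negbTE; rewrite -ltNge; apply: lt_le_trans h.
have : 0 < (8 - 2 * pi) * 2 ^+ N :> R by rewrite mulr_gt0//; lra.
by lra.
Qed.

Lemma haar_partial_tree (c : R[i]) d N x : circle x ->
  haar_partial delta (tree_coll c d) N x =
  c + \sum_(k < N.+3) (side k x)%:C%C * d k (node k x).
Proof.
move=> cx; rewrite /haar_partial; congr (_ + _).
set A := [set I | _]; pose e := path_node cx.
set F := fun I : dyadic => _.
have eA : e @` `I_N.+3 `<=` A by move=> _ [k /= kN <-]; rewrite /A /= arc_len_ge.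
rewrite -(fsbig_widen (e @` `I_N.+3) A)//; last first.
  move=> I [/= AI eI]; rewrite /F haar_off_path ?mulr0// => Ie; apply: eI.
  by exists (tag I) => //; rewrite /= -(arc_len_ge I).
rewrite (reindex_fsbig e `I_N.+3); last first.
  by split => [k kN|k l _ _ [] //|I [k kN <-]]; exists k.
rewrite -fsbig_ord; apply: eq_bigr => k _.
rewrite /F haar_path /= mulrAC -rmorphM mulrA divff ?mul1r//.
by rewrite gt_eqF// sqrtr_gt0 len_gt0.
Qed.

(** The product rule for increments. At [x] both martingales jump with the same sign, which squares
    to [1]: the product of the jumps is the diagonal term, and the mixed terms keep the sign and
    form [para]. *)
Lemma para_sum f b n x : inL1 f -> inL1 b -> circle x ->
  cmean f 0 0 * cmean b 0 0 + \sum_(k < n) (side k x)%:C%C * para delta f b k (node k x) =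
  cmean f n (node n x) * cmean b n (node n x) - Spart delta f b n x.
Proof.
move=> L1f L1b cx; elim: n => [|n IH].
  have -> : node 0 x = 0%N by have := node_lt hdelta 0 cx; case: node.
  by rewrite /Spart !big_ord0 subr0 addr0.
have -> : Spart delta f b n.+1 x = Spart delta f b n x +
    cdel f n (node n x) * cdel b n (node n x) by rewrite /Spart big_ord_recr.
rewrite big_ord_recr addrA IH !cmean_step// -[nat_of_ord ord_max]/n /para.
have : (side n x)%:C%C * (side n x)%:C%C = 1 :> R[i].
  by rewrite -rmorphM /side -expr2 sqrr_sign.
move: (cmean f n _) (cmean b n _) (cdel f n _) (cdel b n _) (side n x)%:C%C (Spart _ _ _ _ _).
by move=> u v du dv s S ss; ring: ss.
Qed.

Lemma node_eq_le k N x y : circle x -> circle y -> (k <= N)%N ->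
  node N x = node N y -> node k x = node k y.
Proof.
move=> cx cy kN; rewrite -(subnK kN); elim: (N - k)%N => [//|j IH] e.
by apply: IH; rewrite -!(nodeS hdelta (j + k)) // -addSn e.
Qed.

Lemma finite_haar_node f : finite_haar delta f -> exists n, forall N, (n <= N)%N ->
  forall x, circle x -> f x = cmean f N (node N x).
Proof.
move=> [ff [fin fE]]; set A := [set I | _] in fin fE.
(* The successor is needed because a Haar function of generation [k] is constant only on arcs of
   generation [k + 1]. *)
pose n := (\max_(I <- finmap.enum_fset (fset_set A)) (tag I).+1)%N.
have nP I : A I -> (tag I < n)%N.
  move=> AI; apply: (@leq_bigmax_seq _ _ xpredT (fun I : dyadic => (tag I).+1)) => //.
  by have := in_fset_set fin I; rewrite (mem_set AI).
exists n => N nN x cx.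
have mN := node_lt hdelta N cx.
rewrite (@eq_cmean _ delta f (fun=> f x)) ?cmean_cst// => y /(arcP hdelta y mN)[cy e].
rewrite fE; congr (_ + _); apply: eq_fsbigr => I; rewrite inE => AI.
rewrite !haarE//; congr (_ * (_ * (_ - _))%:C%C);
  by rewrite (node_eq_le cy cx (leq_trans (nP _ AI) nN) e).
Qed.

(** The sequence [pair_seq] is stationary: once [E_N f = f], replacing [g] by its means does not
    change the integral. *)
Lemma pairing_finite f g : finite_haar delta f -> inL1 g ->
  pairing delta f g = cint circle (fun x => f x * g x).
Proof.
move=> /finite_haar_node[n fn] L1g; apply: climnE.
suff h : forall N, (n <= N)%N ->
    normc (pair_seq delta f g N - cint circle (fun x => f x * g x)) = 0.
  by apply: cvg_near_cst; exists n => // N /= nN; rewrite h.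
move=> N nN; rewrite /pair_seq -(cint_node hdelta (cmean f N) N L1g).
rewrite (eq_cint (g := fun x => f x * g x)) ?subrr ?normc0// => x cx.
by rewrite -fn.
Qed.

Lemma pair_seq_linl (a : R[i]) f1 f2 g N : inL1 f1 -> inL1 f2 ->
  pair_seq delta (fun x => a * f1 x + f2 x) g N =
  a * pair_seq delta f1 g N + pair_seq delta f2 g N.
Proof.
move=> L1 L2; rewrite /pair_seq mulrCA -mulrDr -ctavg_lin; congr (_ * _).
by apply: eq_ctavg => m mN; rewrite cmean_lin//; ring.
Qed.

Lemma pair_seq_linr (a : R[i]) f g1 g2 N : inL1 g1 -> inL1 g2 ->
  pair_seq delta f (fun x => a * g1 x + g2 x) N =
  a * pair_seq delta f g1 N + pair_seq delta f g2 N.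
Proof.
move=> L1 L2; rewrite /pair_seq mulrCA -mulrDr -ctavg_lin; congr (_ * _).
by apply: eq_ctavg => m mN; rewrite cmean_lin//; ring.
Qed.

Lemma pairing_linl (a : R[i]) A1 A2 B f1 f2 g : h1_le A1 f1 -> h1_le A2 f2 ->
  bmo_le B g -> 0 <= B -> pairing delta (fun x => a * f1 x + f2 x) g =
  a * pairing delta f1 g + pairing delta f2 g.
Proof.
move=> h1 h2 gB B0; apply: climnE.
have [L1 _ _] := h1; have [L2 _ _] := h2.
rewrite (_ : pair_seq delta _ g = fun N => a * pair_seq delta f1 g N + pair_seq delta f2 g N).
  exact: ccvg_lin (pairing_cvg hdelta h1 gB B0) (pairing_cvg hdelta h2 gB B0).
by apply/funext => N; exact: pair_seq_linl.
Qed.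

Lemma pairing_linr (a : R[i]) A B1 B2 f g1 g2 : h1_le A f -> bmo_le B1 g1 ->
  bmo_le B2 g2 -> 0 <= B1 -> 0 <= B2 -> pairing delta f (fun x => a * g1 x + g2 x) =
  a * pairing delta f g1 + pairing delta f g2.
Proof.
move=> fA h1 h2 B10 B20; apply: climnE.
have L1 := csqint_L1 h1.1; have L2 := csqint_L1 h2.1.
rewrite (_ : pair_seq delta f _ = fun N => a * pair_seq delta f g1 N + pair_seq delta f g2 N).
  exact: ccvg_lin (pairing_cvg hdelta fA h1 B10) (pairing_cvg hdelta fA h2 B20).
by apply/funext => N; exact: pair_seq_linr.
Qed.

Lemma h1_normP f : inH1 delta f -> exists A : R,
  [/\ 0 <= A, H1norm delta f = A%:E & h1_le A f].
Proof.
move=> [L1f fin].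
have H0 : (0 <= H1norm delta f)%E.
  apply: integral_ge0 => x _; apply: adde_ge0; first by rewrite lee_fin normc_ge0.
  exact: sqrte_ge0.
have E : H1norm delta f = (fine (H1norm delta f))%:E by rewrite fineK// ge0_fin_numE.
exists (fine (H1norm delta f)); split=> //; first exact: fine_ge0.
by apply: (h1_leP hdelta) => //; rewrite -E.
Qed.

Lemma bmo_normP b : inBMO delta b -> exists B : R,
  [/\ 0 <= B, BMOnorm delta b = B%:E, bmo_le B b & normc (cmean b 0 0) <= B].
Proof.
move=> [L1b fin].
have H0 : (0 <= BMOnorm delta b)%E.
  by apply: adde_ge0; [exact: sqrte_ge0|rewrite lee_fin normc_ge0].
have E : BMOnorm delta b = (fine (BMOnorm delta b))%:E by rewrite fineK// ge0_fin_numE.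
have B0 := fine_ge0 H0.
have [|h1 h2] := bmo_leP hdelta L1b B0; first by rewrite -E.
by exists (fine (BMOnorm delta b)).
Qed.

Lemma pairing_is_pairing B g : bmo_le B g -> 0 <= B -> normc (cmean g 0 0) <= B ->
  is_pairing delta g (fun f => pairing delta f g).
Proof.
move=> gB B0 g0; split.
- move=> a f1 f2 /h1_normP[A1 [_ _ h1]] /h1_normP[A2 [_ _ h2]].
  exact: pairing_linl h1 h2 gB B0.
- exists (2 * pi * (3 * B)) => f /h1_normP[A [A0 -> fA]].
  rewrite -EFinM lee_fin; apply: le_trans (pairing_le hdelta fA gB B0) _.
  rewrite -[leRHS]mulrA ler_pM2l ?mulr_gt0 ?pi_gt0//.
  by have := ler_wpM2l A0 g0; lra.
- by move=> f ff; apply: pairing_finite => //; exact: csqint_L1 gB.1.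
Qed.

Lemma pairing_mul_lin (a : R[i]) A B M1 M2 f b phi psi : h1_le A f -> bmo_le B b ->
  0 <= B -> normc (cmean b 0 0) <= B -> 0 <= M1 -> 0 <= M2 ->
  tame M1 phi -> tame M2 psi ->
  pairing delta f (fun x => (a * phi x + psi x) * b x) =
  a * pairing delta f (fun x => phi x * b x) + pairing delta f (fun x => psi x * b x).
Proof.
move=> fA bB B0 b0 M10 M20 t1 t2.
have [p1 _] := bmo_le_mul hdelta M10 B0 t1 bB b0.
have [p2 _] := bmo_le_mul hdelta M20 B0 t2 bB b0.
have c1 : 0 <= 24 * M1 * B by apply: mulr_ge0 => //; exact: mulr_ge0.
have c2 : 0 <= 24 * M2 * B by apply: mulr_ge0 => //; exact: mulr_ge0.
have -> : (fun x => (a * phi x + psi x) * b x) =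
    (fun x => a * (phi x * b x) + psi x * b x) by apply/funext => x; ring.
exact: (pairing_linr a fA p1 p2 c1 c2).
Qed.

Lemma pairing_mul_le A B M f b phi : h1_le A f -> bmo_le B b ->
  0 <= B -> normc (cmean b 0 0) <= B -> 0 <= M -> tame M phi ->
  normc (pairing delta f (fun x => phi x * b x)) <= 2 * pi * (72 * B * A) * M.
Proof.
move=> fA bB B0 b0 M0 t.
have A0 : 0 <= A by case: fA => _ h _; exact: le_trans (normc_ge0 _) h.
have [p1 p2] := bmo_le_mul hdelta M0 B0 t bB b0.
(* The factor [72] is [24] from [bmo_le_mul] times [3 = 1 + 2], for the mean and the diagonal part
   in [pairing_le]. *)
apply: le_trans (pairing_le hdelta fA p1 _) _; first by rewrite !mulr_ge0.
rewrite -[leRHS]mulrA ler_pM2l ?mulr_gt0 ?pi_gt0//.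
by have := ler_wpM2l A0 p2; lra.
Qed.

Lemma cint_node_lin (a : R[i]) n (F G : nat -> R[i]) phi : inL1 phi ->
  cint circle (fun x => (a * F (node n x) + G (node n x)) * phi x) =
  a * cint circle (fun x => F (node n x) * phi x) + cint circle (fun x => G (node n x) * phi x).
Proof.
move=> L1p; rewrite (cint_node hdelta F n L1p) (cint_node hdelta G n L1p).
rewrite (cint_node hdelta (fun m => a * F m + G m) n L1p) mulrCA -mulrDr -ctavg_lin.
by congr (_ * _); apply: eq_ctavg => m _; ring.
Qed.

Lemma Top_partial A B M f b phi : h1_le A f -> bmo_le B b ->
  0 <= B -> normc (cmean b 0 0) <= B -> 0 <= M -> tame M phi ->
  ccvg (fun N => dist_of_fun (haar_partial delta
     (tree_coll (cmean f 0 0 * cmean b 0 0) (para delta f b)) N) phi)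
    (Top delta f b phi).
Proof.
move=> fA bB B0 b0 M0 t; have L1f : inL1 f by case: fA.
have L1b := csqint_L1 bB.1; have L1p := tame_L1 t.
have [p1 p2] := bmo_le_mul hdelta M0 B0 t bB b0.
have c1 := ccvg_sub (pairing_cvg hdelta fA p1 (mulr_ge0 (mulr_ge0 (ler0n _ _) M0) B0))
  (product_defect hdelta M0 B0 t bB L1f).
have c2 := Sop_dist_cvg hdelta (prod_le_duality hdelta fA bB B0) t.
have := ccvg_lin (-1) c2 c1; rewrite mulN1r addrC -/(Top delta f b phi) => c3.
(* The partial sum of index [N] contains the jumps up to generation [N + 2], see [arc_len_ge], so it
   is the martingale at time [N + 3]. *)
have := c3; rewrite /ccvg -(cvg_shiftn 3) => {}c3.
rewrite /ccvg; apply: cvg_trans c3; apply: near_eq_cvg; apply: nearW => N.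
congr normc; congr (_ - _); rewrite addn3.
have [F [SF _]] := Spart_node hdelta f b N.+3.
have -> : dist_of_fun (Spart delta f b N.+3) phi =
    cint circle (fun x => F (node N.+3 x) * phi x).
  by apply: eq_cint => x cx; rewrite SF.
apply: eq_trans (esym (cint_node_lin (-1) N.+3 F (fun m => cmean f N.+3 m * cmean b N.+3 m) L1p)) _.
by apply: eq_cint => x cx; rewrite haar_partial_tree// para_sum// SF// mulN1r addrC.
Qed.

End HaarSums.

(** * Bilinearity and boundedness of the two operators *)

Section Assembly.
Context {R : realType}.
Variable delta : R.
Hypothesis hdelta : 0 <= delta < 1.
Implicit Types (A B M : R) (f b phi : R -> R[i]).
Local Notation mu := (@lebesgue_measure R).
Local Notation cmean := (cmean delta).
Local Notation bmo_le := (bmo_le delta).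
Local Notation h1_le := (h1_le delta).
Local Notation tame := (tame delta).
Local Notation Sop := (Sop delta).
Local Notation Top := (Top delta).
Local Notation para_coll f b :=
  (tree_coll (cmean f 0 0 * cmean b 0 0) (para delta f b)).

Lemma dist_Sop_linl (a : R[i]) K1 K2 M f1 f2 b phi : prod_le delta K1 f1 b ->
  prod_le delta K2 f2 b -> tame M phi ->
  dist_of_fun (Sop (fun x => a * f1 x + f2 x) b) phi =
  a * dist_of_fun (Sop f1 b) phi + dist_of_fun (Sop f2 b) phi.
Proof.
move=> h1 h2 t; have [L1 _ _] := h1; have [L2 _ _] := h2.
have c1 := Sop_dist_cvg hdelta (prod_le_lin hdelta a h1 h2) t.
have c2 := ccvg_lin a (Sop_dist_cvg hdelta h1 t) (Sop_dist_cvg hdelta h2 t).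
suff e : (fun N => dist_of_fun (Spart delta (fun x => a * f1 x + f2 x) b N) phi) =
    (fun N => a * dist_of_fun (Spart delta f1 b N) phi + dist_of_fun (Spart delta f2 b N) phi).
  by rewrite e in c1; exact: etrans (esym (climnE c1)) (climnE c2).
apply/funext => N.
have [F [SF _]] := Spart_node hdelta f1 b N; have [G [SG _]] := Spart_node hdelta f2 b N.
have -> : dist_of_fun (Spart delta f1 b N) phi =
    cint circle (fun x => F (node delta N x) * phi x).
  by apply: eq_cint => x cx; rewrite SF.
have -> : dist_of_fun (Spart delta f2 b N) phi =
    cint circle (fun x => G (node delta N x) * phi x).
  by apply: eq_cint => x cx; rewrite SG.
rewrite -(cint_node_lin hdelta a N F G (tame_L1 t)); apply: eq_cint => x cx.
by rewrite Spart_linl// SF// SG.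
Qed.

Lemma cint_circle f : cint circle f = (2 * pi)%:C%C * cmean f 0 0.
Proof.
have p0 : 2 * pi != 0 :> R by rewrite gt_eqF ?mulr_gt0 ?pi_gt0.
by apply: complexP; rewrite ?cReZ ?cImZ /= mean_circle// mulrC divfK.
Qed.

Lemma Sop_phi_L1 K M f b phi : prod_le delta K f b -> tame M phi ->
  inL1 (fun x => Sop f b x * phi x).
Proof.
move=> fb [m1 m2 pM _].
have p1 x : circle x -> `|complex.Re (phi x)| <= M.
  by move=> cx; apply: le_trans (normc_geRe _) _; exact: pM.
have p2 x : circle x -> `|complex.Im (phi x)| <= M.
  by move=> cx; apply: le_trans (normc_geIm _) _; exact: pM.
have hR := fun N => prod_le_diag N (@normc_geRe R) fb.
have hI := fun N => prod_le_diag N (@normc_geIm R) fb.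
have [iRR _] := psum_dominated hdelta hR m1 p1.
have [iRI _] := psum_dominated hdelta hR m2 p2.
have [iIR _] := psum_dominated hdelta hI m1 p1.
have [iII _] := psum_dominated hdelta hI m2 p2.
split.
  have := mintD iRR (mintZ (-1) iII).
  by apply: eq_integrable => [|x _]; [exact: measurable_circle|rewrite cReM mulN1r].
have := mintD iRI iIR.
by apply: eq_integrable => [|x _]; [exact: measurable_circle|rewrite cImM].
Qed.

Lemma dist_Sop_linphi (a : R[i]) K M1 M2 f b phi psi : prod_le delta K f b ->
  tame M1 phi -> tame M2 psi ->
  dist_of_fun (Sop f b) (fun x => a * phi x + psi x) =
  a * dist_of_fun (Sop f b) phi + dist_of_fun (Sop f b) psi.
Proof.
move=> h t1 t2; rewrite /dist_of_fun !cint_circle mulrCA -mulrDr; congr (_ * _).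
rewrite -cmean_lin//; [|exact: Sop_phi_L1 h t1|exact: Sop_phi_L1 h t2].
by apply: eq_cmean => x _; ring.
Qed.

Let lin_sub (a p1 p2 d1 d2 : R[i]) :
  a * p1 + p2 - (a * d1 + d2) = a * (p1 - d1) + (p2 - d2).
Proof. by ring. Qed.

Let eq_sub (p p' d d' : R[i]) : p = p' -> d = d' -> p - d = p' - d'.
Proof. by move=> -> ->. Qed.

Lemma Top_linl (a : R[i]) A1 A2 B f1 f2 b : h1_le A1 f1 -> h1_le A2 f2 ->
  bmo_le B b -> 0 <= B -> normc (cmean b 0 0) <= B ->
  dist_eq (Top (fun x => a * f1 x + f2 x) b) (fun phi => a * Top f1 b phi + Top f2 b phi).
Proof.
move=> h1 h2 bB B0 b0 phi /(test_tame hdelta)[M M0 t].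
have [p1 _] := bmo_le_mul hdelta M0 B0 t bB b0.
have c1 : 0 <= 24 * M * B by apply: mulr_ge0 => //; exact: mulr_ge0.
have k1 := prod_le_duality hdelta h1 bB B0; have k2 := prod_le_duality hdelta h2 bB B0.
apply: etrans (lin_sub _ _ _ _ _).
exact: eq_sub (pairing_linl hdelta a h1 h2 p1 c1) (dist_Sop_linl a k1 k2 t).
Qed.

Lemma Top_linr (a : R[i]) A B1 B2 f b1 b2 : h1_le A f ->
  bmo_le B1 b1 -> 0 <= B1 -> normc (cmean b1 0 0) <= B1 ->
  bmo_le B2 b2 -> 0 <= B2 -> normc (cmean b2 0 0) <= B2 ->
  dist_eq (Top f (fun x => a * b1 x + b2 x)) (fun phi => a * Top f b1 phi + Top f b2 phi).
Proof.
move=> fA h1 B10 b10 h2 B20 b20 phi /(test_tame hdelta)[M M0 t].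
have [p1 _] := bmo_le_mul hdelta M0 B10 t h1 b10.
have [p2 _] := bmo_le_mul hdelta M0 B20 t h2 b20.
have c1 : 0 <= 24 * M * B1 by apply: mulr_ge0 => //; exact: mulr_ge0.
have c2 : 0 <= 24 * M * B2 by apply: mulr_ge0 => //; exact: mulr_ge0.
have k1 := prod_leC (prod_le_duality hdelta fA h1 B10).
have k2 := prod_leC (prod_le_duality hdelta fA h2 B20).
apply: etrans (lin_sub _ _ _ _ _); apply: eq_sub.
  have -> : (fun x => phi x * (a * b1 x + b2 x)) =
    (fun x => a * (phi x * b1 x) + phi x * b2 x) by apply/funext => x; ring.
  exact: (pairing_linr hdelta a fA p1 p2 c1 c2).
rewrite (SopC delta f) (SopC delta f b1) (SopC delta f b2).
exact: (dist_Sop_linl a k1 k2 t).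
Qed.

Lemma tame_ge0 M phi : tame M phi -> 0 <= M.
Proof.
move=> [_ _ pM _]; apply: le_trans (normc_ge0 (phi 0)) (pM 0 _).
by rewrite /circle/= in_itv/= lexx mulr_gt0 ?pi_gt0.
Qed.

(** A bound on [phi] and its first derivative makes [phi] tame, so such a functional is a
    distribution of order at most one. *)
Lemma distribution_tame (u : (R -> R[i]) -> R[i]) (C : R) :
  (forall (a : R[i]) M1 M2 phi psi, tame M1 phi -> tame M2 psi ->
     u (fun x => a * phi x + psi x) = a * u phi + u psi) ->
  (forall M phi, tame M phi -> normc (u phi) <= C * M) ->
  distribution_on_circle u.
Proof.
move=> ulin uC; split=> [a phi psi tp ts|].
  have [M1 _ t1] := test_tame hdelta tp; have [M2 _ t2] := test_tame hdelta ts.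
  exact: ulin t1 t2.
exists 1%N, C => phi M tp H; apply: uC; apply: (tame_test hdelta) => // j x j1 _.
exact: H.
Qed.

Lemma product_operators A B f b : h1_le A f -> bmo_le B b ->
  0 <= B -> normc (cmean b 0 0) <= B ->
  is_product delta f b (fun phi => dist_of_fun (Sop f b) phi + Top f b phi).
Proof.
move=> fA bB B0 b0.
have -> : (fun phi => dist_of_fun (Sop f b) phi + Top f b phi) =
    (fun phi => pairing delta f (fun x => phi x * b x)).
  by apply/funext => phi; rewrite /Top addrC subrK.
split.
  apply: (distribution_tame (C := 2 * pi * (72 * B * A))) => [a M1 M2 phi psi t1 t2|M phi t].
    exact: (pairing_mul_lin hdelta a fA bB B0 b0 (tame_ge0 t1) (tame_ge0 t2) t1 t2).
  exact: (pairing_mul_le hdelta fA bB B0 b0 (tame_ge0 t) t).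
move=> phi /(test_tame hdelta)[M M0 t].
have [p1 p2] := bmo_le_mul hdelta M0 B0 t bB b0.
exists (fun f => pairing delta f (fun x => phi x * b x)); split=> //.
by apply: pairing_is_pairing p2 => //; apply: mulr_ge0 => //; exact: mulr_ge0.
Qed.

Lemma Top_distribution A B f b : h1_le A f -> bmo_le B b ->
  0 <= B -> normc (cmean b 0 0) <= B -> distribution_on_circle (Top f b).
Proof.
move=> fA bB B0 b0; have k := prod_le_duality hdelta fA bB B0.
apply: (distribution_tame (C := 2 * pi * (72 * B * A) + 2 * pi * (4 * (2 * B * A)))) =>
    [a M1 M2 phi psi t1 t2|M phi t].
  apply: etrans (lin_sub _ _ _ _ _); apply: eq_sub.
    exact: (pairing_mul_lin hdelta a fA bB B0 b0 (tame_ge0 t1) (tame_ge0 t2) t1 t2).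
  exact: (dist_Sop_linphi a k t1 t2).
rewrite mulrDl; apply: le_trans (le_normcD _ _) _; rewrite normcN; apply: lerD.
  exact: (pairing_mul_le hdelta fA bB B0 b0 (tame_ge0 t) t).
exact: (Sop_dist_le hdelta k (tame_ge0 t) t).
Qed.

Lemma Top_iota A B f b : h1_le A f -> bmo_le B b ->
  0 <= B -> normc (cmean b 0 0) <= B -> is_iota delta (para_coll f b) (Top f b).
Proof.
move=> fA bB B0 b0; split; first exact: Top_distribution fA bB B0 b0.
move=> phi /(test_tame hdelta)[M M0 t].
exact: Top_partial fA bB B0 b0 M0 t.
Qed.

Lemma para_Psi0 A B f b : 0 < A -> 0 < B -> h1_le A f -> bmo_le B b ->
  normc (cmean b 0 0) <= B ->
  (((2 * pi)^-1)%:E * \int[mu]_(x in circle)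
     Psi0 (((128 * (32 * 32) * A * B)^-1)%:E * square_fun delta (para_coll f b) x)
     <= 1)%E.
Proof.
move=> A0 B0 fA bB b0.
have p0 : 0 < 2 * pi :> R by rewrite mulr_gt0 ?pi_gt0.
rewrite muleC -lee_pdivlMr ?invr_gt0// invrK mul1e -[2 * pi]mulr1.
apply: (integral_Psi0_le hdelta) => [|N]; first by rewrite !mulr_gt0.
exact: (tavg_psi_para hdelta).
Qed.

Lemma h1_le_mono A A' f : A <= A' -> h1_le A f -> h1_le A' f.
Proof. by move=> AA [L1 h1 h2]; split=> // *; apply: le_trans AA. Qed.

Lemma bmo_le_mono B B' b : 0 <= B -> B <= B' -> bmo_le B b -> bmo_le B' b.
Proof.
move=> B0 BB [sb h]; split=> // k m mk; apply: le_trans (h k m mk) _.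
by rewrite ler_sqr ?nnegrE//; lra.
Qed.

(** Membership concerns [Psi_0] of the square function itself, so the normalisation [l] is removed
    by [psiZ] at the price of a factor [l]. Enlarging [A] and [B] by [1] makes them positive and
    [l >= 1]. *)
Lemma para_in_hlog A B f b : h1_le A f -> bmo_le B b -> 0 <= A -> 0 <= B ->
  normc (cmean b 0 0) <= B -> in_hlog delta (para_coll f b).
Proof.
move=> fA bB A0 B0 b0.
have A1 : 0 < A + 1 by lra.
have B1 : 0 < B + 1 by lra.
have fA1 : h1_le (A + 1) f by apply: h1_le_mono fA; lra.
have bB1 : bmo_le (B + 1) b by apply: bmo_le_mono bB; lra.
have b1 : normc (cmean b 0 0) <= B + 1 by lra.
pose l := 128 * (32 * 32) * (A + 1) * (B + 1).
have l1 : 1 <= l.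
  have : 1 <= (A + 1) * (B + 1) by rewrite mulr_ege1//; lra.
  by rewrite /l -mulrA; lra.
have l0 : 0 < l by lra.
have := @integral_Psi0_le R delta hdelta (cmean f 0 0 * cmean b 0 0) (para delta f b) 1 l.
rewrite invr1 => H; have {}H := H ltr01 _.
apply: (@le_lt_trans _ _ (2 * pi * l)%:E); last exact: ltry.
have E : (fun x => Psi0 (1%:E * square_fun delta (para_coll f b) x)%E) =
    (fun x => Psi0 (square_fun delta (para_coll f b) x)).
  by apply/funext => x; rewrite mul1e.
rewrite E in H; apply: H => N.
have := tavg_psi_para hdelta N A1 B1 fA1 bB1 b1; rewrite -/l => h.
apply: (@le_trans _ _ (l * 1)); last by rewrite mulr1.
apply: le_trans (ler_wpM2l (ltW l0) h); rewrite -tavgZ; apply: tavg_le => m mN.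
set t := _ + _; have t0 : 0 <= t by rewrite addr_ge0 ?normc_ge0 ?sqrtr_ge0.
rewrite mul1r -{1}[t](mulVKf (lt0r_neq0 l0)).
by apply: psiZ => //; rewrite mulr_ge0// invr_ge0 ltW.
Qed.

(** The logarithmic estimate needs positive [A] and [B], but either norm may vanish; the sharp
    product is recovered from strictly larger bounds. *)
Lemma le_product_limit (y : \bar R) (K A B : R) : 0 <= K -> 0 <= A -> 0 <= B ->
  (forall A' B' : R, A < A' -> B < B' -> (y <= (K * A' * B')%:E)%E) ->
  (y <= (K * A * B)%:E)%E.
Proof.
move=> K0 A0 B0 H; apply/lee_addgt0Pr => e e0.
have s1 : 0 <= K * (A + B + 1) by rewrite mulr_ge0//; lra.
pose s := K * (A + B + 1) + 1; have s0 : 0 < s by rewrite /s; lra.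
(* Since [t <= 1], the excess of [K (A + t) (B + t)] over [K A B] is at most
   [t K (A + B + 1) <= t s <= e]; the [+ 1] in [s] keeps the divisor positive. *)
pose t := Num.min 1 (e / s).
have t0 : 0 < t by rewrite lt_min ltr01 divr_gt0.
have t1 : t <= 1 by rewrite ge_min lexx.
have ts : t * s <= e by rewrite -ler_pdivlMr// ge_min lexx orbT.
apply: le_trans (H (A + t) (B + t) _ _) _; [lra|lra|].
rewrite -EFinD lee_fin.
have : K * (t * t) <= K * t by rewrite ler_wpM2l//; nra.
by move: ts; rewrite /s; lra.
Qed.

Lemma Top_bounded A B f b : h1_le A f -> bmo_le B b -> 0 <= A -> 0 <= B ->
  normc (cmean b 0 0) <= B ->
  inHlog delta (Top f b) /\
  (Hlog_norm delta (Top f b) <= (128 * (32 * 32) * A * B)%:E)%E.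
Proof.
move=> fA bB A0 B0 b0; have io := Top_iota fA bB B0 b0.
have ih := para_in_hlog fA bB A0 B0 b0.
split; first by exists (para_coll f b).
apply: (@le_trans _ _ (hlog_norm delta (para_coll f b))).
  by apply: ereal_inf_lbound; exists (para_coll f b).
apply: le_product_limit => // A' B' AA BB.
have A'0 : 0 < A' by lra.
have B'0 : 0 < B' by lra.
apply: ereal_inf_lbound; exists (128 * (32 * 32) * A' * B') => //; split.
  by rewrite !mulr_gt0.
apply: para_Psi0 => //; [exact: h1_le_mono (ltW AA) fA|exact: bmo_le_mono B0 (ltW BB) bB|lra].
Qed.

End Assembly.

Theorem theorem21 (R : realType) (delta : R) (hdelta : 0 <= delta < 1) :
  exists (S : (R -> R[i]) -> (R -> R[i]) -> R -> R[i])
         (T : (R -> R[i]) -> (R -> R[i]) -> (R -> R[i]) -> R[i]),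
    [/\ bilinear_on (inH1 delta) (inBMO delta) ae_circle S,
        bilinear_on (inH1 delta) (inBMO delta) dist_eq T,
        forall f b, inH1 delta f -> inBMO delta b ->
          is_product delta f b (fun phi => dist_of_fun (S f b) phi + T f b phi),
        exists C : R, forall f b, inH1 delta f -> inBMO delta b ->
          inL1 (S f b) /\
          (L1norm (S f b) <= C%:E * H1norm delta f * BMOnorm delta b)%E
      & exists C : R, forall f b, inH1 delta f -> inBMO delta b ->
          inHlog delta (T f b) /\
          (Hlog_norm delta (T f b)
             <= C%:E * H1norm delta f * BMOnorm delta b)%E].
Proof.
exists (Sop delta), (Top delta); split.
- split=> [a f1 f2 b|a f b1 b2].
    move=> /(h1_normP hdelta)[A1 [_ _ h1]] /(h1_normP hdelta)[A2 [_ _ h2]].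
    move=> /(bmo_normP hdelta)[B [B0 _ bB _]].
    exact: Sop_linl (prod_le_duality hdelta h1 bB B0) (prod_le_duality hdelta h2 bB B0).
  move=> /(h1_normP hdelta)[A [_ _ fA]].
  move=> /(bmo_normP hdelta)[B1 [B10 _ h1 _]] /(bmo_normP hdelta)[B2 [B20 _ h2 _]].
  exact: Sop_linr (prod_le_duality hdelta fA h1 B10) (prod_le_duality hdelta fA h2 B20).
- split=> [a f1 f2 b|a f b1 b2].
    move=> /(h1_normP hdelta)[A1 [_ _ h1]] /(h1_normP hdelta)[A2 [_ _ h2]].
    move=> /(bmo_normP hdelta)[B [B0 _ bB b0]].
    exact: Top_linl h1 h2 bB B0 b0.
  move=> /(h1_normP hdelta)[A [_ _ fA]].
  move=> /(bmo_normP hdelta)[B1 [B10 _ h1 b10]] /(bmo_normP hdelta)[B2 [B20 _ h2 b20]].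
  exact: Top_linr fA h1 B10 b10 h2 B20 b20.
- move=> f b /(h1_normP hdelta)[A [_ _ fA]] /(bmo_normP hdelta)[B [B0 _ bB b0]].
  exact: product_operators fA bB B0 b0.
- exists (8 * pi) => f b /(h1_normP hdelta)[A [A0 -> fA]].
  move=> /(bmo_normP hdelta)[B [B0 -> bB b0]].
  by rewrite -!EFinM mulrAC; exact: Sop_L1.
- exists (128 * (32 * 32)) => f b /(h1_normP hdelta)[A [A0 -> fA]].
  move=> /(bmo_normP hdelta)[B [B0 -> bB b0]].
  by rewrite -!EFinM; exact: Top_bounded.
Qed.
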